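(* Let $k$ be a field, let $\mu\ge 1$ and $i_1,\ldots,i_\mu\ge 2$ be integers, and let $\Gamma$ be the non-acyclic complete intersection simplicial complex on the vertex set $\{x_{a b} : 1\le a\le\mu,\ 1\le b\le i_a\}$ (distinct indeterminates) whose Stanley-Reisner ideal is $$I_\Gamma=(x_{11}x_{12}\cdots x_{1i_1},\ x_{21}x_{22}\cdots x_{2i_2},\ \ldots,\ x_{\mu1}x_{\mu2}\cdots x_{\mu i_\mu}).$$ Let $1\le p\le\mu$ and $1\le j_1<i_1,\ \ldots,\ 1\le j_p<i_p$ with $j_1+\cdots+j_p\ge 2$, and let $$F=\{x_{11},\ldots,x_{1j_1},\ x_{21},\ldots,x_{2j_2},\ \ldots,\ x_{p1},\ldots,x_{pj_p}\}.$$ Let $\Delta=\Gamma_F$ be the stellar subdivision of $\Gamma$ on $F$, with new vertex $v$, and let $S=k[x_{11},\ldots,x_{1i_1},\ldots,x_{\mu1},\ldots,x_{\mu i_\mu},v]$. Then $S/I_\Delta^2$ is Cohen-Macaulay.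
   Context: A simplicial complex on a vertex set $V$ is a nonempty subset $\Delta\subseteq2^V$ closed under taking subsets and with $\{w\}\in\Delta$ for all $w\in V$. Vertices here are indeterminates, and the Stanley-Reisner ideal $I_\Delta$ is the ideal, in the polynomial ring whose variables are the vertices, generated by all squarefree monomials whose support is not a face of $\Delta$. For a face $F$ of a complex $\Gamma$ on $V$ with $\dim F=\sharp(F)-1\ge1$ and a new vertex $v$, the stellar subdivision of $\Gamma$ on $F$ is the simplicial complex on $V\cup\{v\}$ given by $$\Gamma_F=\big(\Gamma\setminus\{H : F\subseteq H\in\Gamma\}\big)\cup\{H\cup\{v\} : H\in\Gamma,\ F\not\subseteq H,\ F\cup H\in\Gamma\}.$$ *)

(* Defs.v *)
From HB Require Import structures.
From mathcomp Require Import all_boot all_order all_algebra.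
From mathcomp Require Import generic_quotient ring_quotient mpoly.
From mathcomp Require Import boolp classical_sets.

Set Implicit Arguments.
Unset Strict Implicit.
Unset Printing Implicit Defensive.

Import GRing.Theory.
Local Open Scope ring_scope.
Local Open Scope quotient_scope.

(* Ideals of a commutative ring are Prop-valued and need be neither decidable
   nor proper, unlike the library's [idealr]. *)

Definition ideal_closed (R : comPzRingType) (I : set R) : Prop :=
  I 0 /\ forall a u v, I u -> I v -> I (a * u + v).

Record ideal (R : comPzRingType) := Ideal {
  ideal_mem :> R -> Prop;
  idealP : ideal_closed ideal_mem
}.

Coercion ideal_set (R : comPzRingType) (I : ideal R) : set R := ideal_mem I.

Lemma ideal_gen_closed (R : comPzRingType) (G : set R) :
  ideal_closed (smallest (@ideal_closed R) G).
Proof.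
split=> [J [[J0 _] _] //|a u v Iu Iv J JP].
by have [[_ JD] _] := JP; apply: JD; [exact: Iu | exact: Iv].
Qed.

Definition ideal_gen (R : comPzRingType) (G : set R) : ideal R :=
  Ideal (ideal_gen_closed G).

Definition ideal_pow (R : comPzRingType) (I : ideal R) (n : nat) : ideal R :=
  ideal_gen [set g : R | exists2 f : 'I_n -> R,
    (forall l, I (f l)) & g = \prod_(l < n) f l]%classic.

Section QuotientRing.
Variables (R : comPzRingType) (I : ideal R).

Definition ideal_pred : R -> bool := fun x => `[< I x >].

Lemma ideal_predP x : reflect (I x) (x \in ideal_pred).
Proof. exact: asboolP. Qed.

Lemma ideal_predM a x : x \in ideal_pred -> a * x \in ideal_pred.
Proof.
have [I0 ID] := idealP I.
by move=> /ideal_predP Ix; apply/ideal_predP; rewrite -[_ * _]addr0; apply: ID.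
Qed.

Lemma ideal_pred_zmod : zmod_closed ideal_pred.
Proof.
have [I0 ID] := idealP I.
split=> [|x y /ideal_predP Ix /ideal_predP Iy]; apply/ideal_predP => //.
by rewrite addrC -mulN1r; apply: ID.
Qed.

HB.instance Definition _ := GRing.isZmodClosed.Build R ideal_pred ideal_pred_zmod.

Definition ideal_zmod : zmodClosed R := GRing.ZmodClosed.clone R ideal_pred _.

(* The library's quotient group R / I; it carries a ring structure there only
   for proper ideals, so we endow it with the possibly zero quotient ring. *)
Definition qring : Type := Quotient.quot ideal_zmod.

HB.instance Definition _ := GRing.Zmodule.on qring.

Definition qproj (x : R) : qring := \pi_(Quotient.quot ideal_zmod) x.

Lemma qproj_eqP x y : reflect (I (x - y)) (qproj x == qproj y).
Proof. by rewrite /qproj -Quotient.idealrBE; apply: ideal_predP. Qed.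

Definition qrepr (x : qring) : R := repr (x : Quotient.quot ideal_zmod).

Lemma qreprK : cancel qrepr qproj.
Proof. by move=> x; rewrite /qproj /qrepr reprK. Qed.

Definition qone : qring := qproj 1.
Definition qmul (x y : qring) : qring := qproj (qrepr x * qrepr y).

Lemma qprojD x y : qproj (x + y) = qproj x + qproj y.
Proof. exact: (raddfD \pi_(Quotient.quot ideal_zmod)). Qed.

Lemma qprojM x y : qproj (x * y) = qmul (qproj x) (qproj y).
Proof.
apply/eqP/qproj_eqP/ideal_predP.
set x' := qrepr _; set y' := qrepr _.
have Ix : x - x' \in ideal_pred by apply/ideal_predP/qproj_eqP; rewrite qreprK.
have Iy : y - y' \in ideal_pred by apply/ideal_predP/qproj_eqP; rewrite qreprK.
have -> : x * y - x' * y' = y * (x - x') + x' * (y - y').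
  by rewrite !mulrBr addrA [y * x]mulrC [y * x']mulrC subrK.
by rewrite rpredD // ideal_predM.
Qed.

Lemma qmulA : associative qmul.
Proof.
by move=> x y z; rewrite -[x]qreprK -[y]qreprK -[z]qreprK -!qprojM mulrA.
Qed.

Lemma qmulC : commutative qmul.
Proof. by move=> x y; rewrite /qmul mulrC. Qed.

Lemma qmul1 : left_id qone qmul.
Proof. by move=> x; rewrite -[x]qreprK -qprojM mul1r. Qed.

Lemma qmulDl : left_distributive qmul +%R.
Proof.
move=> x y z; rewrite -[x]qreprK -[y]qreprK -[z]qreprK.
by rewrite -qprojD -!qprojM -qprojD mulrDl.
Qed.

HB.instance Definition _ :=
  GRing.Zmodule_isComPzRing.Build qring qmulA qmulC qmul1 qmulDl.

Lemma qproj_is_zmod_morphism : zmod_morphism qproj.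
Proof. exact: (raddfB \pi_(Quotient.quot ideal_zmod)). Qed.

Lemma qproj_is_monoid_morphism : monoid_morphism qproj.
Proof. by split=> // x y; rewrite qprojM. Qed.

HB.instance Definition _ :=
  GRing.isZmodMorphism.Build R qring qproj qproj_is_zmod_morphism.
HB.instance Definition _ :=
  GRing.isMonoidMorphism.Build R qring qproj qproj_is_monoid_morphism.

End QuotientRing.

Section CohenMacaulay.
Variable A : comPzRingType.

Definition noetherian : Prop :=
  forall I : ideal A, exists s : seq A, I = ideal_gen [set` s] :> set A.

Definition prime_ideal (P : ideal A) : Prop :=
  ~ P 1 /\ forall a b, P (a * b) -> P a \/ P b.

Definition maximal_ideal (M : ideal A) : Prop :=
  ~ M 1 /\ forall J : ideal A, (M `<=` J)%classic -> ~ J 1 -> (J `<=` M)%classic.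

Definition prime_chain (P : ideal A) (n : nat) : Prop :=
  exists c : nat -> ideal A,
    [/\ forall l, (l <= n)%N -> prime_ideal (c l),
        forall l, (l < n)%N -> (c l `<` c l.+1)%classic
      & c n = P :> set A].

Definition has_height (P : ideal A) (n : nat) : Prop :=
  prime_chain P n /\ forall m, prime_chain P m -> (m <= n)%N.

Definition regular_sequence (s : seq A) : Prop :=
  (forall l, (l < size s)%N -> forall y,
     ideal_gen [set` take l s] (s`_l * y) -> ideal_gen [set` take l s] y)
  /\ ~ ideal_gen [set` s] 1.

Definition regular_sequence_in (I : ideal A) (n : nat) : Prop :=
  exists s : seq A,
    [/\ size s = n, regular_sequence s & forall x, x \in s -> I x].

Definition has_grade (I : ideal A) (n : nat) : Prop :=
  regular_sequence_in I n /\ forall m, regular_sequence_in I m -> (m <= n)%N.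

(* The definition of Kaplansky (Commutative Rings, 3-1) and of Eisenbud
   (Commutative Algebra, 18.2), which needs no localization: depth and
   codimension agree at every maximal ideal. *)
Definition cohen_macaulay : Prop :=
  noetherian /\
  forall M : ideal A, maximal_ideal M ->
    exists n, has_height M n /\ has_grade M n.

End CohenMacaulay.

Section StanleyReisner.
Variable V : finType.

Definition simplicial_complex (D : {set {set V}}) : Prop :=
  [/\ D != finset.set0,
      forall G H : {set V}, H \in D -> G \subset H -> G \in D
    & forall w : V, [set w] \in D].

(* The polynomial ring whose variables are the vertices is {mpoly k[#|V|]},
   the vertices being numbered by [enum_rank]. *)
Definition vertex_var (k : fieldType) (w : V) : {mpoly k[#|V|]} :=
  'X_(enum_rank w).

Definition SR_ideal (k : fieldType) (D : {set {set V}}) : ideal {mpoly k[#|V|]} :=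
  ideal_gen [set g | exists2 H : {set V},
    H \notin D & g = \prod_(w in H) vertex_var k w]%classic.

(* The vertex set of the subdivision is [option V]: old vertices are [Some w],
   the new vertex is [None]. *)
Definition stellar_subdivision (D : {set {set V}}) (F : {set V}) :
    {set {set option V}} :=
  [set Some @: H | H : {set V} in D & ~~ (F \subset H)] :|:
  [set None |: Some @: H | H : {set V} in D &
     ~~ (F \subset H) && (F :|: H \in D)].

End StanleyReisner.

(* x_{ab} is [Tagged _ b : {a : 'I_mu & 'I_(i a)}], both indices shifted to
   start from 0. *)
Definition block_face (mu : nat) (i : 'I_mu -> nat) (p : nat) (hp : (p <= mu)%N)
    (j : 'I_p -> nat) : {set {a : 'I_mu & 'I_(i a)}} :=
  [set w : {a : 'I_mu & 'I_(i a)} |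
    [exists a : 'I_p, (tag w == widen_ord hp a) && (tagged w < j a)%N]].

(* Main.v *)
(* Group the variables into the products y_a (the part of block a in F), z_a (the
   rest of block a), v, and t_c (the blocks disjoint from F). Then
   I = (y_a z_a, prod_a y_a, v z_a, t_c), and the set of monomials outside I^2
   splits, along rank functions that increase under multiplication, into cells
   which are translates of the complements of monomial complete intersections of
   height mu + 1. This filters S / I^2 by shifted quotients S / P_W, with P_W
   generated by a set W of mu + 1 variables.

   A maximal ideal M contains, for every variable x_w, a polynomial h_w (x_w)
   divisible by x_w (Zariski's lemma). The elementary symmetric functions
   e_d, ..., e_1 of the h_w (x_w), with d = n - mu - 1 for n variables, are weakly
   regular on each S / P_W: modulo P_W the first one is the product of the d
   polynomials h_w (x_w) with w outside W, and the quotient by that product is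
   filtered again. Hence they form a regular sequence of length d in M on S / I^2.

   Below the last term of a regular sequence in a prime there is a smaller prime
   avoiding it, so a regular sequence yields a chain of primes of its length.
   Chains have length at most d because d + 1 polynomials in d variables are
   algebraically dependent. So height and grade of M are both d. *)

Require Import Defs.
From HB Require Import structures.
From mathcomp Require Import all_boot all_order all_algebra.
From mathcomp Require Import mpoly.
From mathcomp Require Import boolp classical_sets.
From mathcomp Require Import zify ring.

Set Implicit Arguments.
Unset Strict Implicit.
Unset Printing Implicit Defensive.

Import GRing.Theory.
Local Open Scope ring_scope.

(** * Weakly regular sequences on quotients of ideals *)

(** The Cohen-Macaulay property is required at every maximal ideal, not only at the homogeneous one,
    over a field that need not be algebraically closed. The parameters must therefore be adapted to
    M, and one sequence must serve all the quotients S / P_W at once although they live on different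
    sets of variables. Symmetric functions treat all variables alike, and the factor x_w of h_w
    (x_w) makes it vanish modulo every P_W with w in W. Weak regularity is what passes along
    filtrations; properness is supplied once, at the end, by M. The complete intersections behind
    the cells are of two kinds. Where the exponent of v is constant, the generators are v, the t_c
    and one of y_a, z_a, y_a z_a for each block; where v is free, they are the z_a, the product of
    the y_a, and the t_c. The second ideal is the colon of I by v, and v^2 times the square of (z_a,
    prod_a y_a) lies in I^2: comparing I^2 with that square leaves only finitely many layers in
    v. *)

Section Ideals.
Variable R : comPzRingType.
Implicit Types (A B C I J : set R) (x y z a b g u : R).

Section Closed.
Variables (I : set R) (cI : ideal_closed I).

Lemma icl0 : I 0. Proof. by case: cI. Qed.

Lemma iclD x y : I x -> I y -> I (x + y).
Proof. by case: cI => _ h Ix Iy; have := h 1 _ _ Ix Iy; rewrite mul1r. Qed.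

Lemma iclM a x : I x -> I (a * x).
Proof. by case: cI => I0 h Ix; have := h a _ _ Ix I0; rewrite addr0. Qed.

Lemma iclMr a x : I x -> I (x * a).
Proof. by rewrite mulrC; apply: iclM. Qed.

Lemma iclN x : I x -> I (- x).
Proof. by rewrite -mulN1r; apply: iclM. Qed.

Lemma iclB x y : I x -> I y -> I (x - y).
Proof. by move=> Ix Iy; apply: iclD => //; apply: iclN. Qed.

Lemma icl_sum (T : Type) (r : seq T) (P : pred T) (F : T -> R) :
  (forall i, P i -> I (F i)) -> I (\sum_(i <- r | P i) F i).
Proof. by move=> h; elim/big_ind: _ => //; [exact: icl0 | exact: iclD]. Qed.

Lemma icl_subr x y : I (x - y) -> I y -> I x.
Proof. by move=> h Iy; rewrite -[x](subrK y); apply: iclD. Qed.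

End Closed.

Lemma closed_setT : ideal_closed (@setT R).
Proof. by split. Qed.

Lemma ideal_gen_sub (G : set R) x : G x -> ideal_gen G x.
Proof. by move=> Gx J [_]; apply. Qed.

Lemma ideal_gen_min (G I : set R) : ideal_closed I -> (G `<=` I)%classic ->
  (ideal_gen G `<=` I)%classic.
Proof. by move=> cI GI x; apply. Qed.

Definition addmul A g B : set R := [set x | exists a b, [/\ A a, B b & x = a + g * b]]%classic.

Lemma addmul_closed A g B : ideal_closed A -> ideal_closed B ->
  ideal_closed (addmul A g B).
Proof.
move=> cA cB; split.
  by exists 0, 0; split; rewrite ?mulr0 ?addr0 //; apply: icl0.
move=> r _ _ [a [b [Aa Bb ->]]] [a' [b' [Aa' Bb' ->]]].
exists (r * a + a'), (r * b + b'); split; last by ring.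
  by apply: iclD => //; apply: iclM.
by apply: iclD => //; apply: iclM.
Qed.

Lemma addmul_subl A g B : B 0 -> (A `<=` addmul A g B)%classic.
Proof. by move=> B0 x Ax; exists x, 0; rewrite mulr0 addr0. Qed.

Lemma addmul_mem A g B x : A 0 -> B x -> addmul A g B (g * x).
Proof. by move=> A0 Bx; exists 0, x; rewrite add0r. Qed.

Lemma addmul_gen (s : seq R) g :
  addmul (ideal_gen [set` s]) g setT = ideal_gen [set` rcons s g] :> set R.
Proof.
apply/seteqP; split.
  move=> _ [a [b [sa _ ->]]]; apply: (iclD (idealP _)).
    apply: (ideal_gen_min _ _ sa); first exact: idealP.
    by move=> x /= xs; apply: ideal_gen_sub; rewrite /= mem_rcons inE xs orbT.
  apply: (iclMr (idealP _)).
  by apply: ideal_gen_sub; rewrite /= mem_rcons mem_head.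
apply: ideal_gen_min.
  by apply: addmul_closed; [exact: idealP | exact: closed_setT].
move=> x /=; rewrite mem_rcons inE => /orP[/eqP->|xs].
  by rewrite -[X in addmul _ _ _ X]mulr1; apply: addmul_mem => //; exact: (@icl0 _ (idealP (ideal_gen _))).
by apply: addmul_subl => //; apply: ideal_gen_sub.
Qed.

(* [s] is a regular sequence on the module [B / A], except that [B / A] need
   not differ from its quotient by [s]. *)
Fixpoint wreg (s : seq R) A B : Prop :=
  if s is g :: s' then
    (forall y, B y -> A (g * y) -> A y) /\ wreg s' (addmul A g B) B
  else True.

(* Multiplication by [u] induces an isomorphism from [B / A] to [B' / A']. *)
Lemma wreg_iso u s A B A' B' :
    ideal_closed A -> ideal_closed B -> ideal_closed A' -> (A `<=` B)%classic ->
    B' = addmul A' u B -> (forall b, B b -> A' (u * b) <-> A b) ->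
  wreg s A B -> wreg s A' B'.
Proof.
elim: s A A' => [//|g s IH] A A' cA cB cA' AB eB' h [reg wr].
have cB' : ideal_closed B' by rewrite eB'; apply: addmul_closed.
have A'B' : (A' `<=` B')%classic.
  by rewrite eB'; apply: addmul_subl; apply: icl0.
split.
  rewrite eB' => _ [a [b [Aa Bb ->]]] Agab.
  have Agub : A' (u * (g * b)).
    have -> : u * (g * b) = g * (a + u * b) - g * a by ring.
    by apply: (iclB cA') => //; apply: (iclM cA').
  have Ab : A b by apply: reg => //; apply/h => //; apply: (iclM cB).
  by apply: (iclD cA') => //; apply/h.
have cA1 := addmul_closed g cA cB.
have cA1' := addmul_closed g cA' cB'.
apply: IH wr => //.
- move=> _ [a [b [Aa Bb ->]]].
  by apply: (iclD cB); [exact: AB | exact: (iclM cB)].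
- rewrite eB'; apply/seteqP; split => [_ [a [b [Aa Bb ->]]]|].
    by exists a, b; split => //; apply: addmul_subl => //; rewrite -eB'; exact: icl0.
  move=> _ [_ [b [[a [c [Aa Bc ->]] Bb ->]]]]; rewrite -eB' in Bc *.
  apply: (iclD cB').
    by apply: (iclD cB'); [exact: A'B' | exact: (iclM cB')].
  by rewrite eB'; apply: addmul_mem => //; apply: icl0.
move=> b Bb; split.
  move=> [a [c [Aa]]]; rewrite eB' => -[a' [b' [Aa' Bb' ->]]] e.
  have : A' (u * (b - g * b')).
    have -> : u * (b - g * b') = a + g * a'.
      by rewrite mulrBr e; ring.
    by apply: (iclD cA') => //; apply: (iclM cA').
  move/h => Ab; exists (b - g * b'), b'; split; rewrite ?subrK //.
  by apply: Ab; apply: (iclB cB) => //; apply: (iclM cB).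
move=> [a [c [Aa Bc ->]]]; exists (u * a), (u * c); split; last by ring.
  by apply/h => //; apply: AB.
by rewrite eB'; apply: addmul_mem => //; apply: icl0.
Qed.

(** The sequence [0 -> B/A -> C/A -> C/B -> 0] stays exact after dividing by [g], because [g] is a
    nonzerodivisor on [C/B]. The induction then applies to [A + gC], [B + gC] and [C]. *)
Lemma wreg_trans s A B C :
    ideal_closed A -> ideal_closed B -> ideal_closed C ->
    (A `<=` B)%classic -> (B `<=` C)%classic ->
  wreg s A B -> wreg s B C -> wreg s A C.
Proof.
elim: s A B => [//|g s IH] A B cA cB cC AB BC [r1 w1] [r2 w2]; split.
  move=> y Cy Agy; apply: r1 => //; apply: r2 => //; exact: AB.
have cA1 := addmul_closed g cA cC.
have cB1 := addmul_closed g cB cC.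
apply: (IH _ (addmul B g C)) => //.
- by move=> _ [a [b [Aa Cb ->]]]; exists a, b; split => //; apply: AB.
- move=> _ [a [b [Aa Cb ->]]].
  by apply: (iclD cC); [exact: BC | exact: (iclM cC)].
(* [B / (A + gB)] is isomorphic to [(B + gC) / (A + gC)]: an element of [B] in [A + gC] lies in
   [A + gB] by [r2]. *)
apply: (wreg_iso (u := 1) _ _ _ _ _ _ w1) => //.
- exact: addmul_closed.
- move=> _ [a [b [Aa Bb ->]]].
  by apply: (iclD cB); [exact: AB | exact: (iclM cB)].
- apply/seteqP; split=> [_ [b [c [Bb Cc ->]]]|].
    exists (g * c), b; split => //; last by ring.
    by apply: addmul_mem => //; exact: icl0.
  move=> _ [_ [b [[a [c [Aa Cc ->]]] Bb ->]]].
  exists (a + b), c; split => //; last by ring.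
  by apply: (iclD cB) => //; apply: AB.
move=> b Bb; rewrite mul1r; split=> [[a [c [Aa Cc e]]]|].
  exists a, c; split => //; apply: r2 => //.
  have -> : g * c = b - a by rewrite e; ring.
  by apply: (iclB cB) => //; apply: AB.
by move=> [a [c [Aa Bc ->]]]; exists a, c; split => //; apply: BC.
Qed.

(** The zero module: empty products and empty cells lead to it, which is why [wreg] asks for no
    properness. *)
Lemma wreg_refl s A : ideal_closed A -> wreg s A A.
Proof.
elim: s A => [//|g s IH] A cA; split => //.
have -> : addmul A g A = A; last exact: IH.
apply/seteqP; split; last by apply: addmul_subl; exact: icl0.
by move=> _ [a [b [Aa Ab ->]]]; apply: (iclD cA) => //; apply: (iclM cA).
Qed.

(** Multiplication by [a] embeds [R / (A + bR)] into [R / (A + abR)], with cokernel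
    [R / (A + aR)]. *)
Lemma wreg_mul s A a b : ideal_closed A -> (forall y, A (a * y) -> A y) ->
    wreg s (addmul A a setT) setT -> wreg s (addmul A b setT) setT ->
  wreg s (addmul A (a * b) setT) setT.
Proof.
move=> cA rega wa wb.
have cT := closed_setT.
have cAa := addmul_closed a cA cT.
have cAb := addmul_closed b cA cT.
have cAab := addmul_closed (a * b) cA cT.
apply: (wreg_trans (B := addmul A a setT)) => //.
  move=> _ [x [y [Ax _ ->]]]; exists x, (b * y); split => //; ring.
apply: (wreg_iso (u := a) _ _ _ _ _ _ wb) => //.
  apply/seteqP; split=> [_ [x [y [Ax _ ->]]]|].
    by exists x, y; split => //; apply: addmul_subl.
  move=> _ [_ [y [[x [z [Ax _ ->]]] _ ->]]].
  by exists x, (b * z + y); split => //; ring.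
move=> y _; split=> [[x [z [Ax _ e]]]|[x [z [Ax _ ->]]]].
  exists (y - b * z), z; split; rewrite ?subrK //; apply: rega.
  have -> : a * (y - b * z) = x by rewrite mulrBr e; ring.
  done.
by exists (a * x), z; split => //; [exact: (iclM cA) | ring].
Qed.

Lemma wreg_prod s A (T : Type) (r : seq T) (P : pred T) (X : T -> R) :
    ideal_closed A -> (forall i y, P i -> A (X i * y) -> A y) ->
    (forall i, P i -> wreg s (addmul A (X i) setT) setT) ->
  wreg s (addmul A (\prod_(i <- r | P i) X i) setT) setT.
Proof.
move=> cA reg wr.
elim: r => [|i r IH].
  rewrite big_nil; have -> : addmul A 1 setT = setT.
    by apply/seteqP; split=> // x _; exists 0, x; rewrite add0r mul1r; split => //; apply: icl0.
  exact/wreg_refl/closed_setT.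
rewrite big_cons; case: ifP => // Pi; apply: wreg_mul => //; last exact: wr.
by move=> y; apply: reg.
Qed.

End Ideals.

(** * Chains of primes from regular sequences *)

Section PrimeChains.
Variable A : comPzRingType.
Implicit Types (J : set A) (P Q : ideal A) (x y : A).

(* The saturation argument: [Q] is maximal among the ideals containing [J] and
   disjoint from the multiplicative set of all [a * x ^+ n] with [a] outside [P]. *)
Lemma exists_prime_avoiding J P x :
    prime_ideal P -> ideal_closed J -> (J `<=` P)%classic ->
    (forall y, J (x * y) -> J y) ->
  exists Q, [/\ prime_ideal Q, (J `<=` Q)%classic, (Q `<=` P)%classic & ~ Q x].
Proof.
move=> [P1 Pprime] cJ JP regx.
pose adm (X : set A) := ideal_closed X /\ forall a n, X (a * x ^+ n) -> P a.
have admJ : adm J.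
  split=> // a n; elim: n => [|n IH]; first by rewrite expr0 mulr1; apply: JP.
  by rewrite exprS mulrCA => /regx.
(* Zorn's lemma also asks for an upper bound of the empty chain, and the empty set is not an ideal;
   hence admissibility is imposed on the union of [X] with [J]. *)
have [X [[cX dX] maxX]] : exists X, adm (X `|` J)%classic /\
    forall B, (X `<` B)%classic -> ~ adm (B `|` J)%classic.
  apply: Zorn_bigcup => F Fadm Ftot.
  have [->|/set0P[X0 FX0]] := eqVneq F set0.
    by rewrite bigcup_set0 set0U.
  have inc X u : F X -> (X `|` J)%classic u -> ((\bigcup_(X in F) X) `|` J)%classic u.
    by move=> FX [Xu|Ju]; [left; exists X | right].
  have ex u : ((\bigcup_(X in F) X) `|` J)%classic u -> exists2 X, F X & (X `|` J)%classic u.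
    by case=> [[X FX Xu]|Ju]; [exists X => //; left | exists X0 => //; right].
  split; last by move=> a n /ex[X FX Xu]; have [_] := Fadm _ FX; apply; exact: Xu.
  split; first by right; case: cJ.
  move=> a u v /ex[X FX Xu] /ex[Y FY Yv].
  case: (Ftot _ _ FX FY) => XY.
    apply: (inc Y) => //; have [[_ cl] _] := Fadm _ FY; apply: cl => //.
    by case: Xu => [/XY|]; [left | right].
  apply: (inc X) => //; have [[_ cl] _] := Fadm _ FX; apply: cl => //.
  by case: Yv => [/XY|]; [left | right].
set Q0 := (X `|` J)%classic in cX dX.
(* By maximality, adjoining to [Q0] an element outside it produces some [s * x ^+ n] with [s]
   outside [P]. *)
have grow a : ~ Q0 a -> exists q r s n, [/\ Q0 q, q + a * r = s * x ^+ n & ~ P s].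
  move=> nQa.
  have cB := addmul_closed a cX (@closed_setT A).
  have QB : (Q0 `<=` addmul Q0 a setT)%classic by apply: addmul_subl.
  have eB : (addmul Q0 a setT `|` J)%classic = addmul Q0 a setT.
    by apply/setUidPl => z Jz; apply: QB; right.
  have := maxX (addmul Q0 a setT).
  rewrite eB => nadm.
  have {nadm} : ~ adm (addmul Q0 a setT).
    apply: nadm; split; first by move=> z Xz; apply: QB; left.
    move=> BX; apply: nQa; left; apply: BX.
    by rewrite -[X in addmul _ _ _ X]mulr1; apply: addmul_mem => //; exact: icl0 cX.
  move=> nadm; apply: contrapT => nex; apply: nadm; split=> // s n.
  move=> [q [r [Qq _ e]]]; apply: contrapT => nPs; apply: nex.
  by exists q, r, s, n.
exists (Ideal cX); split=> /=.
- split=> [Q1|a b Qab].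
    by apply: P1; apply: (dX 1 0%N); rewrite expr0 mulr1.
  apply: contrapT => /not_orP[/grow [q [r [s [n [Qq e nPs]]]]]].
  move=> /grow [q' [r' [s' [n' [Qq' e' nPs']]]]].
  have : Q0 ((s * s') * x ^+ (n + n')).
    have -> : (s * s') * x ^+ (n + n') = (s * x ^+ n) * (s' * x ^+ n').
      by rewrite exprD; ring.
    rewrite -e -e'.
    have -> : (q + a * r) * (q' + b * r') =
       (q' + b * r') * q + ((a * r) * q' + (r * r') * (a * b)) by ring.
    by apply: (iclD cX); [|apply: (iclD cX)]; apply: (iclM cX).
  by move/dX/Pprime => [].
- by move=> z Jz; right.
- by move=> z Qz; apply: (dX z 0%N); rewrite expr0 mulr1.
- by move=> Qx; apply: P1; apply: (dX 1 1%N); rewrite expr1 mul1r.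
Qed.

Lemma prime_chain_weak_regular (s : seq A) P : prime_ideal P ->
    (forall l, (l < size s)%N -> forall y,
      ideal_gen [set` take l s] (s`_l * y) -> ideal_gen [set` take l s] y) ->
    (forall x, x \in s -> P x) ->
  prime_chain P (size s).
Proof.
elim/last_ind: s P => [|s x IH] P pP reg sP.
  by exists (fun=> P); split.
have [Q [pQ sQ QP nQx]] : exists Q, [/\ prime_ideal Q,
    (ideal_gen [set` s] `<=` Q)%classic, (Q `<=` P)%classic & ~ Q x].
  apply: exists_prime_avoiding => //.
  - exact: (idealP (ideal_gen _)).
  - apply: ideal_gen_min; first exact: (idealP P).
    by move=> z /= zs; apply: sP; rewrite mem_rcons inE zs orbT.
  have := reg (size s); rewrite size_rcons ltnSn => /(_ isT).
  by rewrite nth_rcons ltnn eqxx -cats1 take_cat ltnn subnn take0 cats0.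
have [c [pc sc ec]] : prime_chain Q (size s).
  apply: IH => // [l ls y|z zs].
    have := reg l; rewrite size_rcons ltnS (ltnW ls) => /(_ isT y).
    by rewrite nth_rcons ls -cats1 take_cat ls.
  by apply: sQ; apply: ideal_gen_sub.
exists (fun l => if (l <= size s)%N then c l else P); rewrite size_rcons; split.
- by move=> l _; case: ifP => [/pc|].
- move=> l; rewrite ltnS => ls; rewrite ls.
  case: ltnP => [/sc //|ls'].
  have -> : l = size s by apply/anti_leq; rewrite ls ls'.
  rewrite ec; split=> // PQ; apply: nQx; apply: PQ; apply: sP.
  by rewrite mem_rcons mem_head.
- by rewrite ltnn.
Qed.

End PrimeChains.

(** * Zariski's lemma *)

Section MpolyMorphisms.
Variables (k : comNzRingType) (n : nat).

Lemma mpoly_rmorph_ext (R : comPzRingType) (f g : {rmorphism {mpoly k[n]} -> R}) :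
  (forall c, f c%:MP = g c%:MP) -> (forall i, f 'X_i = g 'X_i) -> f =1 g.
Proof.
move=> eC eX p; rewrite (mpolyE p) !rmorph_sum; apply: eq_bigr => m _.
rewrite -mul_mpolyC !rmorphM eC mpolyXE_id !rmorph_prod; congr (_ * _).
by apply: eq_bigr => i _; rewrite !rmorphXn eX.
Qed.

Lemma mpoly_gen_ind (P : {mpoly k[n]} -> Prop) :
  (forall c, P c%:MP) -> (forall i, P 'X_i) ->
  (forall p q, P p -> P q -> P (p + q)) -> (forall p q, P p -> P q -> P (p * q)) ->
  forall p, P p.
Proof.
move=> PC PX PD PM p; rewrite (mpolyE p).
apply: (big_ind P) => //; first by rewrite -(mpolyC0 n); exact: PC.
move=> m _; rewrite -mul_mpolyC; apply: (PM) => //.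
have P1 : P 1 by rewrite -(mpolyC1 n k).
rewrite mpolyXE_id; apply: (big_ind P) => // i _.
have PXd d : P ('X_i ^+ d) by elim: d => [|d IH]; rewrite ?expr0 ?exprS //; apply: (PM).
exact: PXd.
Qed.

End MpolyMorphisms.

Section Zariski.
Variables (k : fieldType) (n : nat).
Local Notation S := {mpoly k[n]}.

(** A retraction onto the subring [k[T]]. It is idempotent, so [mrestr T f = f] expresses that [f]
    lies in [k[T]]. *)
Definition mrestr (T : {set 'I_n}) : S -> S :=
  mmap (@mpolyC n k) (fun i => if i \in T then 'X_i else 0).

HB.instance Definition _ T := GRing.RMorphism.on (mrestr T).

Lemma mrestrC T c : mrestr T c%:MP = c%:MP.
Proof. exact: mmapC. Qed.

Lemma mrestrX T i : mrestr T 'X_i = if i \in T then 'X_i else 0.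
Proof. by rewrite /mrestr mmapX mmap1U. Qed.

Lemma mrestr_idem T f : mrestr T (mrestr T f) = mrestr T f.
Proof.
move: f; apply: (mpoly_rmorph_ext (f := mrestr T \o mrestr T) (g := mrestr T)) => [c|i] /=.
  by rewrite !mrestrC.
by rewrite !mrestrX; case: ifP => iT; rewrite ?rmorph0 // mrestrX iT.
Qed.

Lemma mrestr0 (Q : S) : exists c, mrestr finset.set0 Q = c%:MP.
Proof.
move: Q; apply: mpoly_gen_ind => [c|j|p q [c ec] [d ed]|p q [c ec] [d ed]].
- by exists c; rewrite mrestrC.
- by exists 0; rewrite mrestrX inE mpolyC0.
- by exists (c + d); rewrite rmorphD /= ec ed mpolyCD.
- by exists (c * d); rewrite rmorphM /= ec ed mpolyCM.
Qed.

Variables (K : comNzRingType) (phi : {rmorphism S -> K}).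
Hypothesis phi_surj : forall x, exists s, phi s = x.
Hypothesis K_field : forall x : K, x != 0 -> exists y, x * y = 1.

Let alg_indep (T : {set 'I_n}) := forall f, phi (mrestr T f) = 0 -> mrestr T f = 0.

(** For [i] outside [T], an element of [k[T, X_i]] becomes a univariate polynomial over [k[T]], so
    that relations for [X_i] acquire leading coefficients. *)
Definition uni_part (T : {set 'I_n}) (i : 'I_n) : S -> {poly S} :=
  mmap (polyC \o @mpolyC n k)
    (fun j => if j \in T then ('X_j)%:P else if j == i then 'X else 0).
HB.instance Definition _ T i := GRing.RMorphism.on (uni_part T i).

Lemma uni_partE T i f : (uni_part T i f).['X_i] = mrestr (i |: T) f.
Proof.
move: f; apply: (mpoly_rmorph_ext (f := horner_eval ('X_i : S) \o uni_part T i)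
  (g := mrestr (i |: T))) => [c|j] /=.
  by rewrite mrestrC /uni_part mmapC /= /horner_eval hornerC.
rewrite mrestrX /uni_part mmapX mmap1U /horner_eval !inE.
case: (j \in T); rewrite ?hornerC ?orbT ?orbF //.
by case: eqP => [->|_]; rewrite ?hornerX ?horner0.
Qed.

Lemma uni_part_fix T i f : map_poly (mrestr T) (uni_part T i f) = uni_part T i f.
Proof.
move: f; apply: (mpoly_rmorph_ext (f := map_poly (mrestr T) \o uni_part T i)
  (g := uni_part T i)) => [c|j] /=.
  by rewrite /uni_part mmapC /= map_polyC /= mrestrC.
rewrite /uni_part mmapX mmap1U; case: ifP => jT.
  by rewrite map_polyC /= mrestrX jT.
by case: eqP => _; rewrite ?map_polyX ?rmorph0.
Qed.

(** Modulo [q = 1 + 'X_t * g] one has ['X_t * g = -1]. If [q] divided [g ^+ N], it would divide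
    [(-1) ^+ N] and be constant, but its degree is positive. *)
Lemma not_dvd_unipotent (t : 'I_n) (g w : S) N : g != 0 -> g ^+ N <> (1 + 'X_t * g) * w.
Proof.
move=> g0 e; set q := 1 + 'X_t * g in e.
have X0 : 'X_t != 0 :> S by rewrite -(@msize_poly_eq0 _ _) msizeX.
have sXg : (2 <= msize ('X_t * g : S))%N.
  have := mpolySpred mdeg g0.
  by rewrite msizeM // msizeX mdeg1 => ->.
have [w' ew'] : exists w', (-1) ^+ N = q * w'.
  have [v ev] : exists v, ('X_t * g) ^+ N = (-1) ^+ N + q * v.
    elim: (N) => [|N' [v ev]]; first by exists 0; rewrite !expr0 mulr0 addr0.
    exists ((-1) ^+ N' + 'X_t * g * v); rewrite !exprS ev /q; ring.
  exists ('X_t ^+ N * w - v); rewrite mulrBr mulrCA -e -exprMn ev; ring.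
have q0 : q != 0.
  by apply/eqP => q0; move/eqP: ew'; rewrite q0 mul0r expf_eq0 oppr_eq0 oner_eq0 andbF.
have w0 : w' != 0.
  by apply/eqP => w0; move/eqP: ew'; rewrite w0 mulr0 expf_eq0 oppr_eq0 oner_eq0 andbF.
have := congr1 (@mmeasure _ _ mdeg) ew'; rewrite msizeM //.
have -> : msize ((-1) ^+ N : S) = 1%N.
  by rewrite -signr_odd; case: (odd N); rewrite ?expr0 ?expr1 ?msizeN msize1.
have sq := mpolySpred mdeg q0; have sw := mpolySpred mdeg w0.
have arith (x y : nat) : x = x.-1.+1 -> y = y.-1.+1 -> (x + y).-1 = 1%N -> (x <= 1)%N.
  by lia.
move=> /esym/(arith _ _ sq sw) sq1.
have : (msize ('X_t * g : S) <= 1)%N.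
  have -> : 'X_t * g = q + (- 1) :> S by rewrite /q; ring.
  apply: leq_trans (msizeD_le _ _) _.
  by rewrite geq_max sq1 msizeN msize1.
by rewrite leqNgt sXg.
Qed.

(* For a maximal [T] the field [K] is integral over [k[T][1 / g]], where [g] is
   the product of the leading coefficients of relations for the variables
   outside [T]; inverting [1 + 'X_t * g] there is impossible. *)
Lemma alg_indep_max_empty (T : {set 'I_n}) :
  alg_indep T -> (forall i, i \notin T -> ~ alg_indep (i |: T)) -> T = finset.set0.
Proof.
move=> indT maxT; apply/eqP; apply/contraT => /set0Pn[t tT].
have [P HP] : exists P : 'I_n -> {poly S}, forall i, i \notin T ->
    [/\ P i != 0, map_poly (mrestr T) (P i) = P i & phi (P i).['X_i] = 0].
  pose R (i : 'I_n) (P : {poly S}) := i \notin T ->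
    [/\ P != 0, map_poly (mrestr T) P = P & phi P.['X_i] = 0].
  suff /choice[P HP] : forall i, exists P, R i P by exists P.
  move=> i.
  have [iT|/maxT nind] := boolP (i \in T); first by exists 0; rewrite /R iT.
  have [f [f0 fn0]] : exists f, phi (mrestr (i |: T) f) = 0 /\ mrestr (i |: T) f != 0.
    apply: contrapT => h; apply: nind => f f0; apply/eqP/contraT => fn0.
    by case: h; exists f.
  exists (uni_part T i f) => _; rewrite uni_part_fix uni_partE; split=> //.
  by apply: contraNneq fn0 => e; rewrite -uni_partE e horner0.
pose a i := lead_coef (P i).
have aT i : i \notin T -> mrestr T (a i) = a i.
  by move=> /HP[_ /polyP/(_ (size (P i)).-1) + _]; rewrite coef_map.
have a0 i : i \notin T -> a i != 0 by move=> /HP[P0 _ _]; rewrite lead_coef_eq0.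
pose g := \prod_(i | i \notin T) a i.
have gT : mrestr T g = g by rewrite rmorph_prod; apply: eq_bigr => i /aT.
have g0 : g != 0 by apply/prodf_neq0.
have phiT f : mrestr T f = f -> f != 0 -> phi f != 0.
  by move=> fT; apply: contraNneq => e; rewrite -fT indT // fT.
have [g' gg'] := K_field (phiT _ gT g0).
(* [rho] sends ['X] to the inverse of [phi g]; its image is the subring generated by [phi (k[T])]
   and this inverse. *)
pose phiT' : {rmorphism S -> K} := phi \o mrestr T.
have cfu : commr_rmorph phiT' g' by move=> x; apply: mulrC.
pose rho : {rmorphism {poly S} -> K} := horner_morph cfu.
have rhoC f : rho f%:P = phi (mrestr T f) by rewrite /rho /= horner_morphC.
have rhoX : rho 'X = g' by rewrite /rho /= horner_morphX.
clearbody rho.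
have rho_im r : exists N s, phi g ^+ N * rho r = phi (mrestr T s).
  elim/poly_ind: r => [|r c [N [s IH]]].
    by exists 0%N, 0; rewrite !rmorph0 mulr0.
  exists N.+1, (s + g ^+ N.+1 * c).
  rewrite rmorphD rmorphM rhoX rhoC mulrDr.
  have -> : phi g ^+ N.+1 * (rho r * g') = phi g ^+ N * rho r * (phi g * g').
    by rewrite exprS; ring.
  by rewrite gg' mulr1 IH !rmorphD !rmorphM !rmorphXn /= gT.
have intX i : integralOver rho (phi 'X_i).
  have [iT|iT] := boolP (i \in T).
    have -> : phi 'X_i = rho ('X_i)%:P by rewrite rhoC mrestrX iT.
    exact: integral_id.
  have [P0 PT Pr] := HP _ iT.
  (* The inverse of the leading coefficient [a i] is [1 / g] times the product of the other ones;
     scaling by it makes the relation monic. *)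
  pose b := 'X * (\prod_(l | (l \notin T) && (l != i)) a l)%:P.
  have eb : rho b * phi (a i) = 1.
    rewrite rmorphM rhoX rhoC -{1}(aT i iT) -mulrA -!rmorphM mulrC -gg'.
    by rewrite -[in RHS]gT /g [in RHS](bigD1 i) //= [a i * _]mulrC.
  apply: (@integral_root_monic _ _ _ _ (rho b *: map_poly phi (P i))).
  - set L := _ *: _.
    have coL : L`_(size (P i)).-1 = 1 by rewrite coefZ coef_map.
    have sL : (size L <= size (P i))%N.
      exact: leq_trans (size_scale_leq _ _) (size_poly _ _).
    have sL' : ((size (P i)).-1 < size L)%N.
      by rewrite ltnNge; apply/negP => /leq_sizeP/(_ _ (leqnn _))/eqP; rewrite coL oner_eq0.
    have eL : (size L).-1 = (size (P i)).-1.
      by apply/anti_leq; rewrite -[(_ <= (size L).-1)%N]ltnS (ltn_predK sL') sL' -!subn1 leq_sub2r.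
    by rewrite monicE lead_coefE eL coL.
  - by rewrite /root hornerZ horner_map /= Pr mulr0.
  - apply/integral_poly => j; rewrite coefZ coef_map /= -PT coef_map /= -rhoC -rmorphM.
    exact: integral_id.
have intK x : integralOver rho x.
  have [s <-] := phi_surj x; move: s; apply: mpoly_gen_ind => [c|i|p q|p q].
  - have -> : phi c%:MP = rho (c%:MP)%:P by rewrite rhoC mrestrC.
    exact: integral_id.
  - exact: intX.
  - by rewrite rmorphD; apply: integral_add.
  - by rewrite rmorphM; apply: integral_mul.
set q := 1 + 'X_t * g.
have qT : mrestr T q = q by rewrite rmorphD rmorphM rmorph1 /= gT mrestrX tT.
have q0 : q != 0.
  apply/eqP => /(congr1 (meval (fun=> 0))).
  by rewrite mevalD meval1 mevalM mevalXU mul0r addr0 meval0 => /eqP; rewrite oner_eq0.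
have [u qu] := K_field (phiT _ qT q0).
have [p mp /eqP pu] := intK u.
(* A monic equation of degree m for [u], the inverse of [phi q], is multiplied by [phi q ^+ m]: the
   leading term becomes 1 and all other terms multiples of [phi q]. *)
have [c ec] : exists c, 1 + phi q * rho c = 0.
  suff clear (r : {poly {poly S}}) m : (size r <= m.+1)%N -> exists c,
      (map_poly rho r).[u] * phi q ^+ m = rho r`_m + phi q * rho c.
    have [|c] := clear p (size p).-1; first by rewrite -polySpred // monic_neq0.
    by rewrite pu mul0r -lead_coefE (monicP mp) rmorph1 => e; exists c.
  elim/poly_ind: r m => [|r b IH] m sr.
    by exists 0; rewrite coef0 !rmorph0 horner0 mul0r mulr0 addr0.
  case: m sr => [|m] sr.
    exists 0; rewrite rmorph0 mulr0 addr0 expr0 mulr1.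
    by rewrite (size1_polyC sr) map_polyC hornerC coefC.
  have [|d ed] := IH m.
    move: sr; rewrite size_MXaddC; case: ifP => [/andP[/eqP-> _]|_ //].
    by rewrite size_poly0.
  exists (d + b * (q ^+ m)%:P).
  have -> : map_poly rho (r * 'X + b%:P) = map_poly rho r * 'X + (rho b)%:P.
    by rewrite rmorphD rmorphM /= map_polyX map_polyC.
  rewrite hornerMXaddC coefD coefMX coefC /= addr0.
  rewrite rmorphD rmorphM rhoC !rmorphXn /= qT.
  have -> : ((map_poly rho r).[u] * u + rho b) * phi q ^+ m.+1 =
     ((map_poly rho r).[u] * phi q ^+ m) * (phi q * u) + rho b * phi q ^+ m.+1.
    by rewrite exprS; ring.
  by rewrite qu mulr1 ed exprS; ring.
(* Clearing the powers of [1 / g] in [rho c] gives a relation inside [k[T]], where [phi] is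
   injective: [q] would divide a power of [g]. *)
have [N [s es]] := rho_im c.
case: (@not_dvd_unipotent t g (- mrestr T s) N g0).
have := indT (g ^+ N + q * s).
rewrite !rmorphD !rmorphM !rmorphXn /= gT qT -es => h.
apply/eqP; rewrite mulrN -addr_eq0 h ?opprK //.
have -> : phi g ^+ N + phi q * (phi g ^+ N * rho c) = phi g ^+ N * (1 + phi q * rho c) by ring.
by rewrite ec mulr0.
Qed.

(** A maximal algebraically independent set of variables is empty, so no single variable is
    independent over [k]. *)
Lemma zariski_algebraic i : exists2 h : {poly k}, h != 0 &
  phi (map_poly (@mpolyC n k) h).['X_i] = 0.
Proof.
have ind0 : `[< alg_indep finset.set0 >].
  apply/asboolP => f f0.
  have [c ec] := mrestr0 f.
  move: f0; rewrite ec => e; apply/eqP; rewrite mpolyC_eq0; apply: contraT => c0.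
  have : phi c%:MP * phi (c^-1)%:MP = 1 by rewrite -rmorphM -mpolyCM divff // mpolyC1 rmorph1.
  by rewrite e mul0r => /esym/eqP; rewrite oner_eq0.
have [T /maxsetP[/asboolP indT maxT] _] := @maxset_exists _ (fun T => `[< alg_indep T >]) _ ind0.
have T0 : T = finset.set0.
  apply: alg_indep_max_empty indT _ => j jT indjT.
  have := maxT (j |: T) (asboolT indjT) (finset.subsetUr _ _) => e.
  by rewrite -e finset.setU11 in jT.
have nind : ~ alg_indep (i |: finset.set0).
  move=> ind; have := maxT (i |: finset.set0); rewrite {1}T0 => /(_ (asboolT ind) (finset.sub0set _)).
  by rewrite T0 => /setP/(_ i); rewrite !inE eqxx.
have [f [f0 fn0]] : exists f, phi (mrestr (i |: finset.set0) f) = 0 /\ mrestr (i |: finset.set0) f != 0.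
  apply: contrapT => h; apply: nind => f f0; apply/eqP/contraT => fn0.
  by case: h; exists f.
have [h eh] : exists h : {poly k}, map_poly (@mpolyC n k) h = uni_part finset.set0 i f.
  move: f {f0 fn0}; apply: mpoly_gen_ind => [c|j|p q [c ec] [d ed]|p q [c ec] [d ed]].
  - by exists c%:P; rewrite map_polyC /uni_part mmapC.
  - rewrite /uni_part mmapX mmap1U inE; case: eqP => _; last by exists 0; rewrite rmorph0.
    by exists 'X; rewrite map_polyX.
  - by exists (c + d); rewrite !rmorphD /= ec ed.
  - by exists (c * d); rewrite !rmorphM /= ec ed.
rewrite -uni_partE -eh in f0 fn0.
exists h => //; apply: contraNneq fn0 => ->; by rewrite rmorph0 horner0.
Qed.

End Zariski.

(** * Dimension of polynomial rings *)

Section Dimension.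
Variable k : fieldType.

Lemma mrestr_step n (T : {set 'I_n}) i (Q : {mpoly k[n]}) :
  exists Q', mrestr (i |: T) Q = mrestr T Q + 'X_i * Q'.
Proof.
move: Q; apply: mpoly_gen_ind => [c|j|p q [p' ep] [q' eq]|p q [p' ep] [q' eq]].
- by exists 0; rewrite !mrestrC mulr0 addr0.
- rewrite !mrestrX !inE; case: (j \in T); first by exists 0; rewrite orbT mulr0 addr0.
  case: eqP => [->|_]; [exists 1|exists 0]; by rewrite add0r ?mulr1 ?mulr0.
- by exists (p' + q'); rewrite !rmorphD /= ep eq; ring.
- exists (mrestr T p * q' + p' * mrestr T q + 'X_i * p' * q').
  by rewrite !rmorphM /= ep eq; ring.
Qed.

Lemma mrestrT n (Q : {mpoly k[n]}) : mrestr finset.setT Q = Q.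
Proof.
move: Q; apply: (mpoly_rmorph_ext (f := mrestr finset.setT) (g := idfun)) => [c|i] /=.
  by rewrite mrestrC.
by rewrite mrestrX inE.
Qed.

Lemma msupp_mrestr n (G : {set 'I_n}) (f : {mpoly k[n]}) m i :
  m \in msupp (mrestr G f) -> i \notin G -> m i = 0%N.
Proof.
move=> + iG; move: f m; apply: mpoly_gen_ind => [c|j|p q IHp IHq|p q IHp IHq] m.
- by rewrite mrestrC msuppC; case: eqP; rewrite // inE => _ /eqP->; rewrite mnm0E.
- rewrite mrestrX; case: ifP => [jG|_]; last by rewrite -mpolyC0 msupp0.
  rewrite msuppX inE => /eqP->; rewrite mnm1E; case: eqP => // e.
  by rewrite -e jG in iG.
- by rewrite rmorphD => /msuppD_le; rewrite mem_cat => /orP[/IHp|/IHq].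
- rewrite rmorphM => /msuppM_le/allpairsP[[a b] /= [/IHp pa /IHq qb ->]].
  by rewrite mnmDE pa qb.
Qed.

Definition deg_le n e (p : {mpoly k[n]}) := forall m, m \in msupp p -> (mdeg m <= e)%N.

Lemma deg_le1 n : deg_le 0 (1 : {mpoly k[n]}).
Proof. by move=> m; rewrite -mpolyC1 msupp1 inE => /eqP->; rewrite mdeg0. Qed.

Lemma deg_leM n e e' (p q : {mpoly k[n]}) : deg_le e p -> deg_le e' q -> deg_le (e + e') (p * q).
Proof.
move=> hp hq m /msuppM_le/allpairsP[[a b] /= [/hp ha /hq hb ->]].
by rewrite mdegD leq_add.
Qed.

Lemma deg_leX n e N (p : {mpoly k[n]}) : deg_le e p -> deg_le (N * e) (p ^+ N).
Proof.
move=> hp; elim: N => [|N IH]; first exact: deg_le1.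
by rewrite exprS mulSn; apply: deg_leM.
Qed.

Lemma deg_le_prod n (I : finType) (F : I -> {mpoly k[n]}) (e : I -> nat) :
  (forall i, deg_le (e i) (F i)) -> deg_le (\sum_i e i) (\prod_i F i).
Proof.
move=> h; elim/big_rec2: _ => [|i d p _ IH]; first exact: deg_le1.
exact: deg_leM.
Qed.

(* Monomials of degree less than [N] in each [f i] span a space of dimension
   growing like [N ^ d], but there are [N ^ d.+1] of them. *)
Lemma alg_dependent n d (G : {set 'I_n}) (f : 'I_d.+1 -> {mpoly k[n]}) :
    (#|G| <= d)%N -> (forall l, mrestr G (f l) = f l) ->
  exists2 Q : {mpoly k[d.+1]}, Q != 0 & mmap (@mpolyC n k) f Q = 0.
Proof.
move=> Gd fG.
pose D := (\sum_l msize (f l))%N.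
have fD l : deg_le D (f l).
  move=> m /msize_mdeg_lt/ltnW h; apply: leq_trans h _.
  by rewrite /D (bigD1 l) //= leq_addr.
(* A product of the [f l] with exponents below [N] has degree at most [d.+1 * N * D], hence below
   [E = c * N]. The available monomials number at most [E ^ d = c ^ d * N ^ d], and [N > c ^ d]
   makes this less than [N ^ d.+1]. *)
pose c := (d.+1 * D).+1.
pose N := (c ^ d).+1.
pose E := (c * N)%N.
pose row := {ffun 'I_d.+1 -> 'I_N}.
pose col := {ffun {x : 'I_n | x \in G} -> 'I_E}.
pose al (r : row) : 'X_{1..d.+1} := [multinom (r i : nat) | i < d.+1].
pose mo (g : col) : 'X_{1..n} := [multinom oapp (fun x => g x : nat) 0%N (insub i) | i < n].
pose F (r : row) := \prod_l f l ^+ r l.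
have FG r : mrestr G (F r) = F r.
  by rewrite /F rmorph_prod; apply: eq_bigr => l _; rewrite rmorphXn /= fG.
have Fdeg r m : m \in msupp (F r) -> (mdeg m < E)%N.
  move=> /(deg_le_prod (fun l => deg_leX (N := r l) (fD l))).
  rewrite -big_distrl /= => h; apply: leq_ltn_trans h _.
  apply: (@leq_ltn_trans (d.+1 * N * D)).
    rewrite leq_mul2r; apply/orP; right.
    rewrite -[X in (_ <= X * _)%N]card_ord -sum_nat_const.
    by apply: leq_sum => i _; apply: ltnW.
  by rewrite mulnAC /E /c [in ltnRHS]mulSn -add1n leq_add2r.
pose A := \matrix_(r < #|row|, g < #|col|) (F (enum_val r))@_(mo (enum_val g)).
have lt_col_row : (#|col| < #|row|)%N.
  rewrite !card_ffun !card_ord card_sig.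
  have -> : #|[pred x in G]| = #|G| by apply: eq_card.
  apply: (@leq_ltn_trans (E ^ d)).
    by rewrite leq_pexp2l // /E muln_gt0.
  by rewrite /E expnMn expnS ltn_pmul2r ?expn_gt0.
have : kermx A != 0.
  by rewrite kermx_eq0 /row_free; apply/eqP => e; have := rank_leq_col A; rewrite e leqNgt lt_col_row.
case/rowV0Pn => v /sub_kermxP vA v0.
pose Q : {mpoly k[d.+1]} := \sum_(r < #|row|) v 0 r *: 'X_[al (enum_val r)].
have al_inj : injective al.
  move=> r r' /mnmP e; apply/ffunP => i; apply: val_inj.
  by have := e i; rewrite !mnmE.
exists Q.
  case/rV0Pn: v0 => r0 vr0; apply: contraNneq vr0 => /(congr1 (mcoeff (al (enum_val r0)))).
  rewrite mcoeff0 raddf_sum (bigD1 r0) //= mcoeffZ mcoeffX eqxx mulr1 big1 ?addr0 => [->//|r rr0].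
  rewrite mcoeffZ mcoeffX (inj_eq al_inj) (inj_eq enum_val_inj) (negPf rr0) mulr0 //.
rewrite raddf_sum /=; apply/mpolyP => m; rewrite mcoeff0 raddf_sum /=.
have eF r : mmap (@mpolyC n k) f (v 0 r *: 'X_[al (enum_val r)]) = v 0 r *: F (enum_val r).
  rewrite mmapZ mmapX mul_mpolyC /mmap1 /F; congr (_ *: _).
  by apply: eq_bigr => l _; rewrite mnmE.
have [[g eg]|nm] := pselect (exists g, m = mo g).
  have := congr1 (fun B : 'rV_#|col| => B 0 (enum_rank g)) vA; rewrite !mxE => e.
  rewrite -[RHS]e; apply: eq_bigr => r _.
  by rewrite eF mcoeffZ mxE enum_rankK eg.
apply: big1 => r _; rewrite eF mcoeffZ.
apply/eqP; rewrite mulf_eq0; apply/orP; right; rewrite mcoeff_eq0; apply/negP => mF.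
apply: nm.
have mE i : (m i < E)%N.
  apply: leq_ltn_trans (Fdeg _ _ mF).
  by rewrite mdegE (bigD1 i) //= leq_addr.
exists [ffun x => Ordinal (mE (val x))]; apply/mnmP => i; rewrite mnmE.
case: insubP => [x iG ei|iG] /=; first by rewrite ffunE /= ei.
by apply: (msupp_mrestr (G := G) (f := F (enum_val r)) _ iG); rewrite FG.
Qed.

(** Choose [f l] in [P l.+1] but not in [P l], with variables in [G]. An algebraic relation among
    these [d.+1] elements loses its variables one at a time: [f l] vanishes modulo [P l.+1], so
    ['X_l] may be set to 0 there. What remains is a nonzero constant in the last prime. *)
Lemma prime_chain_bound n d (G : {set 'I_n}) (P : nat -> ideal {mpoly k[n]}) :
    (#|G| <= d)%N -> (forall l, (l <= d.+1)%N -> prime_ideal (P l)) ->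
    (forall l, (l < d.+1)%N -> (P l `<` P l.+1)%classic) ->
  ~ (forall i, i \notin G -> P 0%N 'X_i).
Proof.
move=> Gd pP sP P0.
have incP l l' : (l <= l')%N -> (l' <= d.+1)%N -> (P l `<=` P l')%classic.
  move=> /subnK <-; elim: (l' - l)%N => [_ x //|e IH] h x /(IH (ltnW h)).
  by rewrite addSn; have [] := sP _ h => + _; apply.
have congG f : P 0%N (f - mrestr G f).
  move: f; apply: mpoly_gen_ind => [c|j|p q IHp IHq|p q IHp IHq].
  - by rewrite mrestrC subrr; apply: (icl0 (idealP _)).
  - rewrite mrestrX; case: ifP => [_|/negbT/P0].
      by rewrite subrr; apply: (icl0 (idealP _)).
    by rewrite subr0.
  - rewrite rmorphD opprD addrACA; exact: (iclD (idealP _)).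
  - rewrite rmorphM /=.
    have -> : p * q - mrestr G p * mrestr G q =
       q * (p - mrestr G p) + mrestr G p * (q - mrestr G q) by ring.
    by apply: (iclD (idealP _)); apply: (iclM (idealP _)).
have : forall l : 'I_d.+1, exists f, [/\ mrestr G f = f, P l.+1 f & ~ P l f].
  move=> l; have [_ nsub] := sP l (ltn_ord l).
  have [f [Pf nPf]] : exists f, P l.+1 f /\ ~ P l f.
    apply: contrapT => h; apply: nsub => f Pf; apply: contrapT => nPf.
    by apply: h; exists f.
  have cG l' : (l' <= d.+1)%N -> P l' (f - mrestr G f).
    by move=> hl; apply: (incP 0%N l' (leq0n _) hl); exact: congG.
  exists (mrestr G f); split; first exact: mrestr_idem.
    have -> : mrestr G f = f - (f - mrestr G f) by ring.
    by apply: (iclB (idealP _)) => //; apply: cG.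
  move=> h; apply: nPf; apply: (icl_subr (idealP _)) h; apply: cG.
  exact: ltnW.
case/choice => f Hf.
pose ev : {rmorphism {mpoly k[d.+1]} -> {mpoly k[n]}} := mmap (@mpolyC n k) f.
have evX l : ev 'X_l = f l by rewrite /ev /= mmapX mmap1U.
pose T l := [set i : 'I_d.+1 | (l <= i)%N].
have [Q0 Q0n eQ0] := alg_dependent Gd (fun l => let: And3 h _ _ := Hf l in h).
have : forall l, (l <= d.+1)%N -> exists Q, [/\ Q != 0, mrestr (T l) Q = Q & P l (ev Q)].
  elim=> [_|l IH ld].
    exists Q0; split=> //; last by rewrite [ev _]eQ0; apply: (icl0 (idealP _)).
    have -> : T 0%N = finset.setT by apply/setP => i; rewrite !inE.
    exact: mrestrT.
  have {IH} [Q] := IH (ltnW ld).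
  (* Setting ['X_l] to 0 must leave a nonzero polynomial, so factors ['X_l] are cancelled first;
     this is allowed because [f l] is outside the prime [P l]. *)
  have [r] := ubnP (msize Q); elim: r Q => // r IHr Q sQ [Qn0 QT PQ].
  pose l' := Ordinal ld.
  have eT : T l = l' |: T l.+1.
    by apply/setP => i; rewrite !inE -val_eqE /= leq_eqVlt eq_sym.
  have [Q' eQ] := mrestr_step (T l.+1) l' Q.
  rewrite -eT QT in eQ.
  have [_ Pf nPf] := Hf l'.
  have [h0|hn0] := eqVneq (mrestr (T l.+1) Q) 0; last first.
    exists (mrestr (T l.+1) Q); split=> //; first exact: mrestr_idem.
    have -> : ev (mrestr (T l.+1) Q) = ev Q - f l' * ev Q'.
      by rewrite {2}eQ rmorphD rmorphM evX; ring.
    apply: (iclB (idealP _)); first by apply: (incP l).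
    exact: (iclMr (idealP _)).
  rewrite h0 add0r in eQ.
  have X0 : 'X_l' != 0 :> {mpoly k[d.+1]} by rewrite -msize_poly_eq0 msizeX.
  have Q'0 : Q' != 0 by apply: contraNneq Qn0 => e; rewrite eQ e mulr0.
  apply: (IHr Q').
    have := sQ; rewrite eQ msizeM // msizeX mdeg1 addSn add1n /= ltnS => h.
    exact: h.
  split=> //.
    apply: (mulfI X0); by rewrite -eQ -[RHS]QT [in RHS]eQ rmorphM /= mrestrX !inE /= leqnn.
  have [_ pr] := pP l (ltnW ld).
  by have := PQ; rewrite eQ rmorphM evX => /pr[].
move=> /(_ _ (leqnn _)) [Q [Qn0 QT PQ]].
have eT : T d.+1 = finset.set0.
  by apply/setP => i; rewrite !inE leqNgt ltn_ord.
have [c ec] := mrestr0 Q.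
rewrite -QT eT ec mpolyC_eq0 in Qn0.
rewrite -QT eT ec /ev /= mmapC in PQ.
have [n1 _] := pP _ (leqnn d.+1); apply: n1.
have -> : 1 = (c^-1)%:MP * c%:MP :> {mpoly k[n]}.
  by rewrite -mpolyCM mulVf // mpolyC1.
exact: (iclM (idealP _)).
Qed.

End Dimension.

(** * Noetherian rings and quotients *)

Section Noetherian.

(** The next index is taken where the minimum of the remaining tail is attained. *)
Lemma nondecreasing_subsequence (a : nat -> nat) : exists phi : nat -> nat,
  (forall i j, (i < j)%N -> (phi i < phi j)%N) /\
  (forall i j, (i <= j)%N -> (a (phi i) <= a (phi j))%N).
Proof.
have : forall N, exists i, (N <= i)%N /\ forall j, (N <= j)%N -> (a i <= a j)%N.
  move=> N; pose Q v := `[< exists2 i, (N <= i)%N & a i = v >].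
  have exQ : exists v, Q v by exists (a N); apply/asboolP; exists N.
  case: (ex_minnP exQ) => v /asboolP[i Ni ei] min.
  by exists i; split=> // j Nj; rewrite ei; apply: min; apply/asboolP; exists j.
case/choice => idx Hidx.
pose phi := fix phi i := if i is i'.+1 then idx (phi i').+1 else idx 0%N.
have phiS i : (phi i < phi i.+1)%N by have [] := Hidx (phi i).+1.
have mono i j : (i < j)%N -> (phi i < phi j)%N.
  elim: j => // j IH; rewrite ltnS leq_eqVlt => /orP[/eqP->|/IH h] //.
  exact: ltn_trans h (phiS j).
exists phi; split=> // i j; rewrite leq_eqVlt => /orP[/eqP->//|/mono ij].
case: i ij => [|i] ij; first by have [_] := Hidx 0%N; apply.
have [_] := Hidx (phi i).+1; apply.
exact: leq_trans (phiS i) (ltnW ij).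
Qed.

(** A subsequence is refined one coordinate at a time until it is nondecreasing in all of them. *)
Lemma dickson_pair n (a : nat -> 'X_{1..n}) : exists i j, (i < j)%N /\ (a i <= a j)%MM.
Proof.
suff [phi [mono h]] : exists phi : nat -> nat, (forall i j, (i < j)%N -> (phi i < phi j)%N) /\
    forall x, x \in enum 'I_n -> forall i j, (i <= j)%N -> (a (phi i) x <= a (phi j) x)%N.
  exists (phi 0%N), (phi 1%N); split; first exact: mono.
  by apply/mnm_lepP => x; apply: h; rewrite ?mem_enum.
elim: (enum 'I_n) => [|x s [phi [mono h]]]; first by exists id; split.
have [psi [mono' h']] := nondecreasing_subsequence (fun i => a (phi i) x).
exists (phi \o psi); split=> [i j /mono'/mono //|y].
rewrite inE => /orP[/eqP->|ys] i j ij; first exact: h'.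
apply: h => //; move: ij; rewrite leq_eqVlt => /orP[/eqP->//|/mono' ij].
exact: ltnW.
Qed.

Lemma dickson n (U : 'X_{1..n} -> Prop) : exists s : seq 'X_{1..n},
  (forall m, m \in s -> U m) /\ forall m, U m -> exists2 m', m' \in s & (m' <= m)%MM.
Proof.
apply: contrapT => nex.
(* Without a finite basis, every finite part of [U] misses some element of [U]; iterating this
   choice contradicts [dickson_pair]. *)
have : forall s : seq 'X_{1..n}, exists m, (forall x, x \in s -> U x) ->
    U m /\ forall x, x \in s -> ~~ (x <= m)%MM.
  move=> s; have [sU|nsU] := pselect (forall x, x \in s -> U x); last by exists 0%MM.
  apply: contrapT => nm; apply: nex; exists s; split=> // m Um.
  apply: contrapT => h; apply: nm; exists m => _; split=> // x xs.
  by apply/negP => xm; apply: h; exists x.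
case/choice => g Hg.
pose st := fix st i := if i is i'.+1 then g (st i') :: st i' else [::].
have stU i : forall x, x \in st i -> U x.
  elim: i => [//|i IH] x; rewrite /= inE => /orP[/eqP->|/IH //].
  by have [] := Hg _ IH.
have memst i j : (i < j)%N -> g (st i) \in st j.
  elim: j => // j IH; rewrite ltnS leq_eqVlt /= inE => /orP[/eqP->|/IH ->].
    by rewrite eqxx.
  by rewrite orbT.
have [i [j [ij le]]] := dickson_pair (g \o st).
have [_ /(_ _ (memst _ _ ij))] := Hg _ (stU j).
by rewrite le.
Qed.

(** The leading monomials of [I] have a finite basis by Dickson's lemma. Polynomials of [I]
    realizing it generate [I], since cancelling a leading term lowers the leading monomial and this
    order is well-founded. *)
Lemma mpoly_noetherian (k : fieldType) n : noetherian {mpoly k[n]}.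
Proof.
move=> I.
have [s [sU Us]] := dickson (fun m => exists f, [/\ I f, f != 0 & mlead f = m]).
have : forall m, exists f, m \in s -> [/\ I f, f != 0 & mlead f = m].
  move=> m; have [/sU[f hf]|_] := boolP (m \in s); first by exists f.
  by exists 0.
case/choice => F HF.
exists [seq F m | m <- s]; apply/seteqP; split; last first.
  apply: ideal_gen_min; first exact: idealP.
  by move=> _ /= /mapP[m ms ->]; have [] := HF _ ms.
move=> f; elim/mleadrect: f => f IH If.
have [->|f0] := eqVneq f 0; first exact: (icl0 (idealP _)).
have [|m ms mf] := Us (mlead f); first by exists f.
have [Ig g0 eg] := HF _ ms; set g := F m in Ig g0 eg.
pose c := mleadc f / mleadc g.
pose h := c *: 'X_[mlead f - m] * g.
have c0 : c != 0 by rewrite mulf_neq0 ?invr_eq0 ?mleadc_eq0.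
have X0 : c *: 'X_[mlead f - m] != 0 :> {mpoly k[n]}.
  by rewrite mscalerI negb_or c0 -msize_poly_eq0 msizeX.
have eh : mlead h = mlead f.
  by rewrite mleadM // mleadZ // mleadXm eg submK.
have ch : mleadc h = mleadc f.
  rewrite /h mleadM // mleadcM mleadZ // mleadcZ mleadXm mcoeffX eqxx mulr1 /c divfK //.
  by rewrite mleadc_eq0.
have Gh : ideal_gen [set` [seq F m | m <- s]] h.
  apply: (iclM (idealP _)); apply: ideal_gen_sub; exact: map_f.
apply: (icl_subr (idealP _)) Gh.
have [->|fh0] := eqVneq (f - h) 0; first exact: (icl0 (idealP _)).
apply: IH; last by apply: (iclB (idealP _)) => //; apply: (iclM (idealP _)).
rewrite Order.POrderTheory.lt_neqAle; apply/andP; split.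
  apply: contraNneq fh0 => e.
  by rewrite -mleadc_eq0 e mcoeffB -{2}eh ch subrr.
by have := mleadB_le f h; rewrite eh Order.JoinTheory.joinxx.
Qed.

End Noetherian.

Section Quotient.
Variables (R : comPzRingType) (I : ideal R).
Implicit Types (J M : ideal (qring I)).

Lemma qpreim_closed J : ideal_closed [set s : R | J (qproj I s)]%classic.
Proof.
split=> /= [|a u v Ju Jv]; first by rewrite rmorph0; apply: (icl0 (idealP _)).
by rewrite rmorphD rmorphM; apply: (iclD (idealP _)) => //; apply: (iclM (idealP _)).
Qed.

Definition qpreim J : ideal R := Ideal (qpreim_closed J).

Lemma qproj_surj (x : qring I) : exists s, qproj I s = x.
Proof. by exists (qrepr x); rewrite qreprK. Qed.

Lemma qproj_eq0 s : qproj I s = 0 <-> I s.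
Proof.
rewrite -(rmorph0 (qproj I)); split=> [/eqP/qproj_eqP|Is]; first by rewrite subr0.
by apply/eqP/qproj_eqP; rewrite subr0.
Qed.

Lemma qring_noetherian : noetherian R -> noetherian (qring I).
Proof.
move=> noethR J; have [s es] := noethR (qpreim J).
exists [seq qproj I x | x <- s]; apply/seteqP; split; last first.
  apply: ideal_gen_min; first exact: idealP.
  move=> _ /= /mapP[x xs ->].
  suff : (qpreim J : set R) x by [].
  by rewrite es; apply: ideal_gen_sub.
move=> y; have [x <-] := qproj_surj y => Jx.
have : (qpreim J : set R) x by [].
rewrite es; pose K := [set z : R | ideal_gen [set` [seq qproj I x | x <- s]] (qproj I z)]%classic.
suff : (ideal_gen [set` s] `<=` K)%classic by apply.
apply: ideal_gen_min; first exact: (idealP (qpreim (ideal_gen _))).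
by move=> z zs; apply: ideal_gen_sub; apply: map_f.
Qed.

Lemma qpreim_prime J : prime_ideal J -> prime_ideal (qpreim J).
Proof.
move=> [J1 pJ]; split=> [|a b] /=; first by rewrite rmorph1.
by rewrite rmorphM => /pJ.
Qed.

Lemma qpreim_ideal J s : I s -> qpreim J s.
Proof. by move=> /qproj_eq0 e; rewrite /= e; apply: (icl0 (idealP _)). Qed.

Lemma qpreim_proper J J' : (J `<` J')%classic -> (qpreim J `<` qpreim J')%classic.
Proof.
move=> [s ns]; split=> [x /s //|h]; apply: ns => y.
have [x <-] := qproj_surj y; exact: h.
Qed.

(** Passes from the recursive form over [R] to the indexed one over the quotient. In the generalized
    claim [t] collects the terms already divided out, their ideal being pulled back to [R]. *)
Lemma wreg_qring (s : seq R) : wreg s I setT ->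
  forall l, (l < size s)%N -> forall y,
    ideal_gen [set` take l (map (qproj I) s)] ((map (qproj I) s)`_l * y) ->
    ideal_gen [set` take l (map (qproj I) s)] y.
Proof.
suff H t : wreg s (qpreim (ideal_gen [set` map (qproj I) t])) setT ->
  forall l, (l < size s)%N -> forall y,
    ideal_gen [set` map (qproj I) (t ++ take l s)] (qproj I s`_l * qproj I y) ->
    ideal_gen [set` map (qproj I) (t ++ take l s)] (qproj I y).
  move=> w l ls y; have [x <-] := qproj_surj y.
  rewrite (nth_map 0) // -map_take; apply: (H [::]) => //.
  have -> // : (qpreim (ideal_gen [set` map (qproj I) [::]]) : set R) = I.
  apply/seteqP; split=> [z|z /qproj_eq0 e] /=.
    move=> h; apply/qproj_eq0.
    suff : [set 0 : qring I]%classic (qproj I z) by [].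
    apply: h; split; last by [].
    by split=> // a u v -> ->; rewrite /= mulr0 addr0.
  by rewrite e; apply: (icl0 (idealP (ideal_gen _))).
elim: s t => [//|g s IH] t [reg w] [|l] ls y.
  by rewrite take0 cats0 -rmorphM => h; apply: (reg y).
rewrite /= -cat_rcons; apply: IH => //.
have -> // : (qpreim (ideal_gen [set` map (qproj I) (rcons t g)]) : set R) =
   addmul (qpreim (ideal_gen [set` map (qproj I) t])) g setT.
rewrite map_rcons; apply/seteqP; split=> z /=.
  rewrite -[X in X (qproj I z)]/(ideal_set (ideal_gen _)) -addmul_gen.
  move=> [a [b [Ha _ e]]]; have [x ex] := qproj_surj b.
  exists (z - g * x), x; split=> //; last by rewrite subrK.
  by move: Ha; have <- : qproj I (z - g * x) = a by rewrite rmorphB rmorphM /= e ex addrK.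
move=> [a [b [Ha _ ->]]]; rewrite rmorphD rmorphM.
suff : (ideal_gen [set` rcons [seq qproj I i | i <- t] (qproj I g)] : set _)
   (qproj I a + qproj I g * qproj I b) by [].
by rewrite -addmul_gen; exists (qproj I a), (qproj I b).
Qed.

End Quotient.

(** * Symmetric functions of univariate polynomials *)

Section MaximalIdeals.

Lemma maximal_unit (A : comPzRingType) (M : ideal A) x :
  maximal_ideal M -> ~ M x -> exists y, M (x * y - 1).
Proof.
move=> [M1 maxM] nMx.
have cJ := addmul_closed x (idealP M) (@closed_setT A).
have MJ : (M `<=` addmul M x setT)%classic by apply: addmul_subl.
have : addmul M x setT 1.
  apply: contrapT => J1; apply: nMx; apply: (maxM (Ideal cJ)) => //=.
  rewrite -[X in addmul _ _ _ X]mulr1; apply: addmul_mem => //.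
  exact: (icl0 (idealP _)).
move=> [a [b [Ma _ e]]]; exists b; rewrite e opprD addrCA subrr addr0.
exact: (iclN (idealP _)).
Qed.

Lemma maximal_prime (A : comPzRingType) (M : ideal A) : maximal_ideal M -> prime_ideal M.
Proof.
move=> maxM; split=> [|a b Mab]; first by case: maxM.
have [Ma|nMa] := pselect (M a); [by left | right].
have [y My] := maximal_unit maxM nMa.
have -> : b = y * (a * b) - b * (a * y - 1) by ring.
by apply: (iclB (idealP _)); apply: (iclM (idealP _)).
Qed.

Lemma zariski_ideal (k : fieldType) n (M : ideal {mpoly k[n]}) i :
    ~ M 1 -> (forall x, ~ M x -> exists y, M (x * y - 1)) ->
  exists2 h : {poly k}, h != 0 & M (map_poly (@mpolyC n k) h).['X_i].
Proof.
move=> M1 Mu.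
(* A quotient [qring] may be zero, so the target of Zariski's lemma has to be packed with a proof
   that it is not. *)
have n01 : (1 : qring M) != 0.
  by apply/eqP => e; apply: M1; apply/qproj_eq0; rewrite rmorph1.
pose K : comNzRingType := HB.pack (qring M) (GRing.PzSemiRing_isNonZero.Build (qring M) n01).
have [|x x0|h h0 e] := @zariski_algebraic k n K (qproj M : {rmorphism {mpoly k[n]} -> K}) _ _ i.
- exact: qproj_surj.
- have [s es] := qproj_surj (x : qring M).
  have [|y My] := Mu s.
    by move=> /qproj_eq0 e; move/eqP: x0; rewrite -es e.
  exists (qproj M y); rewrite -es.
  by apply/eqP; rewrite -subr_eq0; apply/eqP; move/qproj_eq0: My; rewrite rmorphB rmorphM rmorph1.
by exists h => //; apply/qproj_eq0.
Qed.

End MaximalIdeals.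

Section ElementarySymmetric.
Variables (k : fieldType) (n : nat).
Local Notation S := {mpoly k[n]}.

(** Descending induction on [j]: with [e] the degree of [p], the coefficient of degree [e + j] in
    [p * s] is the leading coefficient of [p] times the j-th coefficient of [s], plus multiples of
    higher coefficients of [s], which are already in [P]. *)
Lemma coef_unit_lead (P : set S) (p s : {poly S}) :
    ideal_closed P -> (exists v, v * lead_coef p = 1) ->
  (forall j, P (p * s)`_j) -> forall j, P s`_j.
Proof.
move=> cP [v ev] Pps j.
have [d] := ubnP (size s - j); elim: d j => // d IH j sj.
have [le|lt] := leqP (size s) j; first by rewrite nth_default //; apply: icl0.
set e := (size p).-1.
have He : (e < (e + j).+1)%N by rewrite ltnS leq_addr.
have := Pps (e + j)%N; rewrite coefM (bigD1 (Ordinal He)) //= addKn => H.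
have : P (p`_e * s`_j).
  move: H; set R := \sum_(_ < _ | _) _ => H.
  rewrite -[_ * _](addrK R); apply: (iclB cP) => //.
  apply: (icl_sum cP) => i ie; have [ei|ei] := ltnP e i.
    rewrite [p`_i]nth_default ?mul0r; first exact: icl0.
    exact: leq_trans (leqSpred _) ei.
  have lt_ie : (i < e)%N.
    by rewrite ltn_neqAle ei andbT; apply: contraNneq ie => ie; apply/eqP/val_inj.
  apply: (iclM cP); apply: IH; lia.
rewrite -/(lead_coef p) => /(iclM cP v); by rewrite mulrA ev mul1r.
Qed.

Definition uni (i : 'I_n) (p : {poly k}) : S := (map_poly (@mpolyC n k) p).['X_i].

Lemma uniM i p q : uni i (p * q) = uni i p * uni i q.
Proof. by rewrite /uni rmorphM hornerM. Qed.

Lemma uniX i : uni i 'X = 'X_i.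
Proof. by rewrite /uni map_polyX hornerX. Qed.

Lemma uni_part_uni (i j : 'I_n) p : uni_part (~: [set i]) i (uni j p) =
  if j == i then map_poly (@mpolyC n k) p else (uni j p)%:P.
Proof.
have uC c : uni_part (~: [set i]) i c%:MP = (c%:MP)%:P by rewrite /uni_part mmapC.
rewrite /uni; elim/poly_ind: p => [|p c IH].
  by rewrite !rmorph0 horner0 rmorph0 if_same.
rewrite rmorphD rmorphM /= map_polyX map_polyC hornerMXaddC rmorphD rmorphM /= IH uC.
rewrite /uni_part mmapX mmap1U !inE.
by case: eqP => [->|_] //=; rewrite rmorphD rmorphM.
Qed.

(** Generators of arbitrary degree instead of variables: the induction on the symmetric functions
    leaves the ideals generated by variables as soon as it divides by some [uni w (h w)]. *)
Definition uni_ideal (q : 'I_n -> {poly k}) (W : {set 'I_n}) : ideal S :=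
  ideal_gen [set f | exists2 w, w \in W & f = uni w (q w)]%classic.

(* Expand along [x_w]: the generators of the ideal are constants in [x_w], while
   [h] has an invertible leading coefficient. *)
Lemma uni_ideal_regular (q : 'I_n -> {poly k}) (W : {set 'I_n}) (w : 'I_n) (h : {poly k})
    (y : S) : w \notin W -> h != 0 ->
  uni_ideal q W (uni w h * y) -> uni_ideal q W y.
Proof.
move=> wW h0; set P := uni_ideal q W.
pose psi : {rmorphism S -> {poly S}} := uni_part (~: [set w]) w.
have cP : ideal_closed P := idealP P.
have psiP f : P f -> forall j, P (psi f)`_j.
  apply: (ideal_gen_min (I := [set f | forall j, P (psi f)`_j]%classic)).
    split=> [j|a u v Pu Pv j]; first by rewrite rmorph0 coef0; apply: icl0.
    rewrite rmorphD rmorphM coefD coefM; apply: (iclD cP); last exact: Pv.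
    by apply: (icl_sum cP) => l _; apply: (iclM cP); exact: Pu.
  move=> _ [w' w'W ->] j; rewrite /= /psi uni_part_uni.
  have /negPf -> : w' != w by apply: contraNneq wW => <-.
  rewrite coefC; case: ifP => _; last exact: icl0.
  by apply: ideal_gen_sub; exists w'.
have Ppsi f : (forall j, P (psi f)`_j) -> P f.
  move=> h'; have -> : f = (psi f).['X_w].
    by rewrite uni_partE finset.setUCr mrestrT.
  by rewrite horner_coef; apply: (icl_sum cP) => j _; apply: (iclMr cP); exact: h'.
move=> /psiP Ph; apply: Ppsi.
apply: (coef_unit_lead (p := map_poly (@mpolyC n k) h) cP).
  exists (lead_coef h)^-1%:MP; rewrite lead_coef_map_id0 ?mpolyC0 //.
    by rewrite -mpolyCM mulVf ?mpolyC1 // lead_coef_eq0.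
  by rewrite mpolyC_eq0 lead_coef_eq0.
by move=> j; have := Ph j; rewrite /psi rmorphM /= uni_part_uni eqxx.
Qed.

Lemma uni_ideal_add (q : 'I_n -> {poly k}) (W : {set 'I_n}) w p : w \notin W ->
  addmul (uni_ideal q W) (uni w p) setT =
  uni_ideal (fun i => if i == w then p else q i) (w |: W) :> set S.
Proof.
move=> wW; set q' := fun i => _.
have q'W i : i \in W -> q' i = q i.
  by move=> iW; rewrite /q'; case: eqP => // e; rewrite -e iW in wW.
apply/seteqP; split.
  move=> _ [a [b [Pa _ ->]]]; apply: (iclD (idealP _)).
    apply: (ideal_gen_min _ _ Pa); first exact: idealP.
    by move=> _ [i iW ->]; apply: ideal_gen_sub; exists i; rewrite ?q'W // !inE iW orbT.
  apply: (iclMr (idealP _)); apply: ideal_gen_sub.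
  by exists w; rewrite ?setU11 /q' ?eqxx // finset.setU11.
apply: ideal_gen_min.
  by apply: addmul_closed; [exact: idealP | exact: closed_setT].
move=> _ [i + ->]; rewrite !inE => /orP[/eqP->|iW].
  rewrite /q' eqxx -[X in addmul _ _ _ X]mulr1; apply: addmul_mem => //.
  exact: (icl0 (idealP (ideal_gen _))).
by rewrite q'W //; apply: addmul_subl => //; apply: ideal_gen_sub; exists i.
Qed.

Variable h : 'I_n -> {poly k}.

Definition esym m : S := \sum_(A : {set 'I_n} | #|A| == m) \prod_(w in A) uni w (h w).

(** The descending order matters: the m-th function is a single product modulo the ideal when
    exactly m variables remain, and dividing by a factor of it leaves m - 1 of them. *)
Fixpoint esym_seq m : seq S := if m is m'.+1 then esym m :: esym_seq m' else [::].

Lemma size_esym_seq m : size (esym_seq m) = m.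
Proof. by elim: m => //= m ->. Qed.

Hypothesis h_neq0 : forall w, h w != 0.

(* Modulo the ideal, the top function of the sequence is the product of the
   [uni w (h w)] over the [m] remaining variables, so that its quotient is
   filtered by quotients of the same kind with one variable less. *)
Lemma esym_seq_wreg m (q : 'I_n -> {poly k}) (W : {set 'I_n}) : #|~: W| = m ->
  (forall w, w \in W -> q w %| h w) -> wreg (esym_seq m) (uni_ideal q W) setT.
Proof.
elim: m q W => [//|m IH] q W Wm qh.
set P := uni_ideal q W; have cP : ideal_closed P := idealP P.
pose X w := uni w (h w).
have PX w : w \in W -> P (X w).
  move=> wW; have /dvdpP[r er] := qh w wW.
  rewrite /X er uniM; apply: (iclM cP); apply: ideal_gen_sub; by exists w.
(* A set of the same size as the complement of [W], but different from it, meets [W], and there the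
   factor [X w] lies in [P]. *)
have eE : P (esym m.+1 - \prod_(w in ~: W) X w).
  rewrite /esym (bigD1 (~: W)) ?Wm //= addrAC subrr add0r.
  apply: (icl_sum cP) => A /andP[/eqP Am neq].
  have [w wA wW] : exists2 w, w \in A & w \in W.
    apply: contrapT => nw; move/eqP: neq; apply.
    apply/eqP; rewrite eqEcard Am Wm leqnn andbT; apply/fintype.subsetP => w wA.
    by rewrite inE; apply/negP => wW; apply: nw; exists w.
  by rewrite (bigD1 w) //=; apply: (iclMr cP); apply: PX.
have regX w y : w \in ~: W -> P (X w * y) -> P y.
  by rewrite inE => wW; apply: uni_ideal_regular.
rewrite /=; split=> [y _ Pey|].
  have : P (\prod_(w in ~: W) X w * y).
    apply: (icl_subr cP) Pey; rewrite -mulrBl; apply: (iclMr cP).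
    rewrite -opprB; exact: (iclN cP).
  elim/big_rec: _ => [|w p wW IHp]; first by rewrite mul1r.
  by rewrite -mulrA => /(regX _ _ wW)/IHp.
have -> : addmul P (esym m.+1) setT = addmul P (\prod_(w in ~: W) X w) setT.
  set e := esym _ in eE *; set p := \prod_(w in _) _ in eE *.
  apply/seteqP; split=> _ [a [b [Pa _ ->]]].
    exists (a + (e - p) * b), b; split=> //; last by ring.
    by apply: (iclD cP) => //; apply: (iclMr cP).
  exists (a - (e - p) * b), b; split=> //; last by ring.
  by apply: (iclB cP) => //; apply: (iclMr cP).
apply: wreg_prod => // w wW.
have wW' : w \notin W by move: wW; rewrite inE.
rewrite uni_ideal_add //; apply: IH.
  by apply/eqP; rewrite -eqSS -Wm (cardsD1 w (~: W)) wW finset.setCU finset.setDE finset.setIC.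
move=> i; rewrite !inE; case: eqP => [-> _|_ /=]; first exact: dvdpp.
exact: qh.
Qed.

Lemma esym_seq_wreg_vars (W : {set 'I_n}) : (forall w, 'X %| h w) ->
  wreg (esym_seq #|~: W|)
    (ideal_gen [set f : S | exists2 w, w \in W & f = 'X_w]%classic) setT.
Proof.
move=> Xh; have := @esym_seq_wreg _ (fun=> 'X) W erefl (fun w _ => Xh w).
congr wreg; congr (ideal_set (ideal_gen _)); apply/seteqP; split=> _ [w wW ->];
  by exists w; rewrite ?uniX.
Qed.

Lemma esym_seq_mem (M : ideal S) m f : (forall w, M (uni w (h w))) ->
  f \in esym_seq m -> M f.
Proof.
move=> Mh; elim: m => //= m IH; rewrite inE => /orP[/eqP->|/IH //].
apply: (icl_sum (idealP _)) => A /eqP Am.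
have /card_gt0P[w wA] : (0 < #|A|)%N by rewrite Am.
by rewrite (bigD1 w) //=; apply: (iclMr (idealP _)).
Qed.

End ElementarySymmetric.

(** * Quotients of monomial ideals *)

Section MonomialIdeals.
Variables (k : fieldType) (n : nat).
Local Notation S := {mpoly k[n]}.
Local Notation mon := ('X_{1..n}).
Implicit Types (U V : mon -> Prop) (m : mon).

Definition upset U := forall m m', U m -> U (m + m')%MM.

Definition mono_ideal U : set S := [set s | forall m, m \in msupp s -> U m]%classic.

Lemma upset_le U m m' : upset U -> (m <= m')%MM -> U m -> U m'.
Proof. by move=> uU /submK <- Um; rewrite addmC; apply: uU. Qed.

Lemma mono_idealX U m : mono_ideal U 'X_[m] <-> U m.
Proof.
split=> [|Um m']; first by apply; rewrite msuppX mem_head.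
by rewrite msuppX inE => /eqP->.
Qed.

Lemma mono_ideal_closed U : upset U -> ideal_closed (mono_ideal U).
Proof.
move=> uU; split=> [m|a u v Uu Uv m]; first by rewrite -mpolyC0 msupp0.
move=> /msuppD_le; rewrite mem_cat => /orP[|/Uv//].
by move=> /msuppM_le/allpairsP[[b c] /= [_ /Uu Uc ->]]; rewrite addmC; apply: uU.
Qed.

Lemma mono_idealS U V : (forall m, U m -> V m) -> (mono_ideal U `<=` mono_ideal V)%classic.
Proof. by move=> UV s Us m /Us/UV. Qed.

Lemma mono_idealT : mono_ideal (fun=> True) = setT.
Proof. by apply/seteqP; split. Qed.

Lemma mono_ideal_ind U (I : set S) : ideal_closed I -> (forall m, U m -> I 'X_[m]) ->
  (mono_ideal U `<=` I)%classic.
Proof.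
move=> cI UI s Us; rewrite (mpolyE s) big_seq; apply: (icl_sum cI) => m /Us/UI.
by rewrite -mul_mpolyC; apply: (iclM cI).
Qed.

Lemma ideal_gen_mono (G : mon -> Prop) :
  ideal_gen [set g : S | exists2 m, G m & g = 'X_[m]]%classic =
  mono_ideal (fun m => exists2 m', G m' & (m' <= m)%MM) :> set S.
Proof.
apply/seteqP; split.
  apply: ideal_gen_min.
    apply: mono_ideal_closed => m m' [a Ga am]; exists a => //.
    exact: lepm_trans am (lem_addr _ _).
  by move=> _ [m Gm ->]; apply/mono_idealX; exists m => //; apply: lepm_refl.
apply: mono_ideal_ind; first exact: idealP.
move=> m [a Ga am]; rewrite -(submK am) mpolyXD; apply: (iclM (idealP _)).
by apply: ideal_gen_sub; exists a.
Qed.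

Lemma msuppXM u (s : S) m : m \in msupp ('X_[u] * s) ->
  exists2 m', m' \in msupp s & m = (u + m')%MM.
Proof.
rewrite mulrC (perm_mem (msuppMX s u)) => /mapP[m' m's ->].
by exists m'.
Qed.

(** Multiplication by ['X_[u]] carries the monomials of [V'] outside [V] bijectively onto those of
    [U'] outside [U]. *)
Lemma wreg_mono_shift sq u U U' V V' :
    upset U -> upset U' -> upset V -> upset V' ->
    (forall m, U m -> U' m) -> (forall m, V m -> V' m) ->
    (forall m, V' m -> U (u + m)%MM <-> V m) -> (forall m, V' m -> U' (u + m)%MM) ->
    (forall m, U' m -> U m \/ exists2 m', V' m' & m = (u + m')%MM) ->
  wreg sq (mono_ideal V) (mono_ideal V') -> wreg sq (mono_ideal U) (mono_ideal U').
Proof.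
move=> uU uU' uV uV' UU' VV' UV U'V' dec.
have cU := mono_ideal_closed uU; have cV' := mono_ideal_closed uV'.
have cU' := mono_ideal_closed uU'.
apply: (wreg_iso (u := 'X_[u])) => //.
- exact: mono_ideal_closed.
- exact: mono_idealS.
- apply/seteqP; split.
    apply: mono_ideal_ind; first exact: addmul_closed.
    move=> m /dec[Um|[m' V'm' ->]].
      by apply: addmul_subl; [exact: icl0 | apply/mono_idealX].
    by rewrite mpolyXD; apply: addmul_mem; [exact: icl0 | apply/mono_idealX].
  move=> _ [a [b [Ua V'b ->]]]; apply: (iclD cU'); first exact: mono_idealS Ua.
  by move=> m /msuppXM[m' /V'b/U'V' h ->].
move=> b V'b; split=> [Ub m mb|Vb m /msuppXM[m' mb ->]].
  apply/UV; first exact: V'b.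
  by apply: Ub; rewrite mulrC (perm_mem (msuppMX b u)) map_f.
by apply/UV; [exact: V'b | exact: Vb].
Qed.

(** * Differences of monomial ideals and their filtrations *)

Section Good.
Variable sq : seq S.

(* For a difference [D] of two monomial ideals the module structure of their
   quotient depends on [D] only. *)
Definition good (D : mon -> Prop) := forall U U', upset U -> upset U' ->
  (forall m, U m -> U' m) -> (forall m, D m <-> U' m /\ ~ U m) ->
  wreg sq (mono_ideal U) (mono_ideal U').

Lemma good_ext D D' : (forall m, D m <-> D' m) -> good D -> good D'.
Proof. by move=> e gD U U' uU uU' UU' eD; apply: gD => // m; rewrite e. Qed.

Lemma good_empty D : (forall m, ~ D m) -> good D.
Proof.
move=> D0 U U' uU uU' UU' eD.
have -> : U' = U.
  apply/funext => m; apply/propext; split=> [U'm|/UU'//].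
  by apply: contrapT => nUm; apply: (D0 m); apply/eD.
exact/wreg_refl/mono_ideal_closed.
Qed.

(** [D2] is closed under multiplication inside [D], so it spans a submodule, and [D1] spans the
    quotient. The ideal between [U] and [U'] is [U] together with [D2]. *)
Lemma good_union D D1 D2 : (forall m, D m <-> D1 m \/ D2 m) -> (forall m, D1 m -> ~ D2 m) ->
  (forall m a, D2 m -> D (m + a)%MM -> D2 (m + a)%MM) -> good D1 -> good D2 -> good D.
Proof.
move=> eD D12 up2 g1 g2 U U' uU uU' UU' eUD.
pose V m := U m \/ D2 m.
have DU' m : D m -> U' m by move=> /eUD[].
have uV : upset V.
  move=> m a [Um|D2m]; first by left; apply: uU.
  have [Uma|nU] := pselect (U (m + a)%MM); [by left | right].
  by apply: up2 => //; apply/eUD; split=> //; apply: uU'; apply: DU'; apply/eD; right.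
have VU' m : V m -> U' m by case=> [/UU'//|D2m]; apply: DU'; apply/eD; right.
apply: (wreg_trans (B := mono_ideal V)); try exact: mono_ideal_closed.
- by apply: mono_idealS => m; left.
- exact: mono_idealS.
- apply: g2 => // [m Um|m]; first by left.
  split=> [D2m|[[//|//]]]; split; first by right.
  by have /eUD[] : D m by apply/eD; right.
apply: g1 => // m; split=> [D1m|[U'm nV]].
  have Dm : D m by apply/eD; left.
  split; first exact: DU'.
  by case=> [Um|/D12]; [have /eUD[] := Dm | apply].
have : D m by apply/eUD; split=> // Um; apply: nV; left.
by move=> /eD[//|D2m]; case: nV; right.
Qed.

(** Multiplication cannot lower [f], so the monomials of rank at least [i] span submodules whose
    successive quotients are spanned by the fibres. *)
Lemma good_rank D (f : mon -> nat) r : (forall m, D m -> (f m < r)%N) ->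
  (forall m a, D m -> D (m + a)%MM -> (f m <= f (m + a)%MM)%N) ->
  (forall i, (i < r)%N -> good (fun m => D m /\ f m = i)) -> good D.
Proof.
elim: r D => [|r IH] D fr fmono gf.
  by apply: good_empty => m /fr.
apply: (@good_union D (fun m => D m /\ (f m < r)%N) (fun m => D m /\ f m = r)).
- move=> m; split=> [Dm|[[]|[]] //].
  have := fr m Dm; rewrite ltnS leq_eqVlt => /orP[/eqP|]; by [right | left].
- by move=> m [_ lt] [_ e]; rewrite e ltnn in lt.
- move=> m a [Dm e] Dma; split=> //; apply/anti_leq.
  by rewrite -ltnS fr //= -e fmono.
- apply: IH => [m [] //|m a [Dm _] [Dma _]|i ir]; first exact: fmono.
  apply: good_ext (gf i (ltnW ir)) => m; split=> [[Dm e]|[[Dm _] e]] //.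
  by rewrite e.
- exact: gf.
Qed.

Lemma good_shift u D D' : (forall m, D' m <-> (u <= m)%MM /\ D (m - u)%MM) ->
  good D -> good D'.
Proof.
move=> eD' gD U U' uU uU' UU' eUD.
have D'u m : D m -> D' (u + m)%MM.
  by move=> Dm; apply/eD'; rewrite lem_addr addmC addmK.
(* The given ideals surround the translate only, so a pair around [D] is needed: [V'] is generated
   by [D], and [V] is the part of it that multiplication by [u] sends into [U]. *)
pose V' m := exists2 d, D d & (d <= m)%MM.
pose V m := V' m /\ U (u + m)%MM.
have uV' : upset V'.
  by move=> m a [d Dd dm]; exists d => //; apply: lepm_trans dm (lem_addr _ _).
have V'U' m : V' m -> U' (u + m)%MM.
  move=> [d /D'u/eUD[U'd _] dm]; apply: upset_le uU' _ U'd.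
  by apply/mnm_lepP => i; rewrite !mnmDE leq_add2l; move/mnm_lepP: dm.
apply: (@wreg_mono_shift sq u U U' V V') => //.
- by move=> m a [V'm Um]; split; [exact: uV' | rewrite addmA; exact: uU].
- by move=> m [].
- by move=> m V'm; split=> [|[]].
- move=> m U'm; have [Um|nUm] := pselect (U m); [by left | right].
  have /eD'[um Dm] : D' m by apply/eUD.
  exists (m - u)%MM; last by rewrite addmC submK.
  by exists (m - u)%MM => //; apply: lepm_refl.
apply: gD => // [m a [V'm Um]|m [] //|m].
  by split; [exact: uV' | rewrite addmA; exact: uU].
split=> [Dm|[V'm nV]].
  have V'm : V' m by exists m => //; apply: lepm_refl.
  by split=> // -[_]; have /eUD[] := D'u m Dm.
have : D' (u + m)%MM.
  by apply/eUD; split; [exact: V'U' | move=> Um; apply: nV; split].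
by move=> /eD'[_]; rewrite addmC addmK.
Qed.

End Good.

(** * Monomial complete intersections *)

Section Base.
Variables (h : 'I_n -> {poly k}).
Hypothesis h_neq0 : forall w, h w != 0.
Hypothesis Xh : forall w, 'X %| h w.

(** For disjoint [C i], these are the monomials of the complete intersection generated by the
    products of the variables in each [C i]. *)
Definition hits (I : finType) (C : I -> {set 'I_n}) m :=
  exists i, forall w, w \in C i -> m w != 0%N.

Lemma upset_hits (I : finType) (C : I -> {set 'I_n}) : upset (hits C).
Proof.
by move=> m a [i hi]; exists i => w /hi; rewrite mnmDE addn_eq0 negb_and => ->.
Qed.

(** For [w] in [C i0], adding [x_w] to the ideal or taking its colon by [x_w] replaces [C i0] by
    [[set w]] or by [C i0] without [w]. Both results have the same number of generators, so the same
    sequence applies, and smaller total degree. When all [C i] are singletons the ideal is generated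
    by variables. *)
Lemma wreg_hits (I : finType) (C : I -> {set 'I_n}) :
    (forall i, C i != finset.set0) -> (forall i i', i != i' -> [disjoint C i & C i']) ->
  wreg (esym_seq h (n - #|I|)) (mono_ideal (hits C)) setT.
Proof.
have [r] := ubnP (\sum_i #|C i|); elim: r C => // r IH C; rewrite ltnS => sC C0 Cd.
have [[i0 Ci0]|small] := pselect (exists i, (1 < #|C i|)%N); last first.
  have {}small i : exists w, C i = [set w].
    apply/cards1P; rewrite eqn_leq card_gt0 C0 andbT leqNgt.
    by apply/negP => lt; apply: small; exists i.
  case/choice: small => c Hc.
  have c_inj : injective c.
    move=> i i' e; apply/eqP; apply: contraT => /Cd.
    by rewrite !Hc e -finset.setI_eq0 finset.setIid => /eqP/setP/(_ (c i')); rewrite !inE eqxx.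
  pose W := c @: finset.setT.
  have <- : #|~: W| = (n - #|I|)%N.
    by rewrite cardsCs finset.setCK card_ord card_imset // cardsT.
  have := esym_seq_wreg_vars h_neq0 W Xh; congr wreg.
  pose G m := exists2 w, w \in W & m = U_(w)%MM.
  transitivity (ideal_gen [set g : S | exists2 m, G m & g = 'X_[m]]%classic : set S).
    congr (ideal_set (ideal_gen _)); apply/seteqP; split=> f.
      by move=> [w wW ->]; exists U_(w)%MM => //; exists w.
    by move=> [m [w wW ->] ->]; exists w.
  rewrite ideal_gen_mono; congr mono_ideal; apply/funext => m; apply/propext; split.
    move=> [_ [_ /imsetP[i _ ->] ->]]; rewrite lep1mP => mi.
    by exists i => w; rewrite Hc inE => /eqP->.
  move=> [i hi]; exists U_(c i)%MM; last by rewrite lep1mP hi // Hc inE.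
  by exists (c i) => //; apply: imset_f.
have /card_gt0P[w wC] : (0 < #|C i0|)%N by apply: ltnW.
pose upd B i := if i == i0 then B else C i.
have upd_ok B : B != finset.set0 -> B \proper C i0 ->
    wreg (esym_seq h (n - #|I|)) (mono_ideal (hits (upd B))) setT.
  move=> B0 BC; have BsC := proper_sub BC; apply: IH.
  - apply: leq_trans sC; rewrite (bigD1 i0) //= [X in (_ < X)%N](bigD1 i0) //= /upd eqxx.
    rewrite -addSn leq_add ?proper_card //.
    by apply: leq_sum => i /negPf->.
  - by move=> i; rewrite /upd; case: (i =P i0) => _ //; apply: C0.
  move=> i i' ii'; rewrite /upd; case: eqP => [ei|_]; case: eqP => [ei'|_].
  - by rewrite ei ei' eqxx in ii'.
  - by apply: disjointWl BsC _; rewrite -ei Cd.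
  - by apply: disjointWr BsC _; rewrite -ei' Cd.
  - exact: Cd.
have wP : [set w] \proper C i0 by rewrite properEcard finset.sub1set wC cards1.
have cP : C i0 :\ w \proper C i0 by rewrite properD1.
have c0 : C i0 :\ w != finset.set0 by rewrite -card_gt0; move: Ci0; rewrite (cardsD1 w) wC.
apply: (wreg_trans (B := mono_ideal (hits (upd [set w])))).
- exact/mono_ideal_closed/upset_hits.
- exact/mono_ideal_closed/upset_hits.
- exact: closed_setT.
- apply: mono_idealS => m [i hi]; exists i => w'; rewrite /upd; case: eqP => [ei|_] //.
    by rewrite inE => /eqP->; apply: hi; rewrite ei.
  exact: hi.
- by [].
- apply: (@wreg_mono_shift _ U_(w)%MM _ _ (hits (upd (C i0 :\ w))) (fun=> True)) => //;
    try exact: upset_hits.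
  + move=> m [i hi]; exists i => w'; rewrite /upd; case: eqP => [ei|_] //.
      by rewrite inE => /eqP->; apply: hi; rewrite ei.
    exact: hi.
  + move=> m _; split=> -[i hi]; exists i => w'.
      rewrite /upd; case: eqP => [ei|/eqP nei] hw'.
        move: hw'; rewrite !inE => /andP[w'w w'C].
        have := hi w'; rewrite mnmDE mnm1E ei [w == w']eq_sym (negPf w'w) add0n; exact.
      have := hi w' hw'; rewrite mnmDE mnm1E; case: (w =P w') => [e _|_]; last by rewrite add0n.
      have := Cd _ _ nei; rewrite disjoint_sym => /disjointFr/(_ wC).
      by rewrite e hw'.
    move=> w'C; rewrite mnmDE mnm1E; case: (w =P w') => [//|/eqP ww'].
    rewrite add0n; apply: hi; rewrite /upd; case: eqP => [ei|//].
    by rewrite !inE [w' == w]eq_sym ww' -ei.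
  + move=> m _; exists i0 => w'; rewrite /upd eqxx inE => /eqP->.
    by rewrite mnmDE mnm1E eqxx.
  + move=> m [i]; rewrite /upd; case: eqP => [ei hi|_ hi]; last by left; exists i.
    right; exists (m - U_(w))%MM => //; rewrite addmC submK // lep1mP.
    by apply: hi; rewrite inE.
  rewrite mono_idealT; exact: upd_ok.
by apply: upd_ok => //; rewrite -card_gt0 cards1.
Qed.

(** [D] contains the monomial 1, so the larger ideal is the whole ring and the smaller one is forced
    to be that of [hits C]. *)
Lemma good_hits (I : finType) (C : I -> {set 'I_n}) D :
    (forall i, C i != finset.set0) -> (forall i i', i != i' -> [disjoint C i & C i']) ->
    (forall m, D m <-> forall i, exists2 w, w \in C i & m w = 0%N) ->
  good (esym_seq h (n - #|I|)) D.
Proof.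
move=> C0 Cd eD U U' uU uU' UU' eUD.
have D0 : D 0%MM.
  by apply/eD => i; have /set0Pn[w wC] := C0 i; exists w => //; rewrite mnm0E.
have U'T m : U' m by have /eUD[/uU' h0 _] := D0; have := h0 m; rewrite add0m.
have -> : U' = fun=> True by apply/funext => m; apply/propext; split.
have -> : U = hits C.
  apply/funext => m; apply/propext; split=> [Um|[i hi]].
    apply: contrapT => nh; have /eUD[_] : D m; last by apply.
    apply/eD => i; apply: contrapT => ni; apply: nh; exists i => w wC.
    by apply/eqP => mw; apply: ni; exists w.
  apply: contrapT => nU; have /eD/(_ i)[w /hi/eqP mw mw'] : D m by apply/eUD.
  by [].
by rewrite mono_idealT; apply: wreg_hits.
Qed.

End Base.
End MonomialIdeals.

(** * Cells of the complement of the square *)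

Section Cells.
Variables (p : nat) (T : finType).

(* Exponents of the products [y_a] of the variables of block [a] in the face [F],
   [z_a] of the other variables of block [a], [v], and [t_c] of all the variables
   of a block [c] disjoint from [F]. *)
Record expo := Expo { yexp : 'I_p -> nat; zexp : 'I_p -> nat; vexp : nat; texp : T -> nat }.

Implicit Types (x u : expo) (D : expo -> Prop) (a b : 'I_p).

Definition ele x x' := [/\ forall a, (yexp x a <= yexp x' a)%N, forall a, (zexp x a <= zexp x' a)%N,
  (vexp x <= vexp x')%N & forall c, (texp x c <= texp x' c)%N].

Definition esub x u := Expo (fun a => yexp x a - yexp u a)%N (fun a => zexp x a - zexp u a)%N
  (vexp x - vexp u)%N (fun c => texp x c - texp u c)%N.

(* The monomials of the ideal [(y_a z_a, \prod_a y_a, v z_a, t_c)], which is the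
   Stanley-Reisner ideal of the subdivision, and those of its square. *)
Definition inJ x := [\/ exists a, (0 < yexp x a)%N /\ (0 < zexp x a)%N, forall a, (0 < yexp x a)%N,
  (0 < vexp x)%N /\ (exists a, 0 < zexp x a)%N | exists c, (0 < texp x c)%N].

Definition inJ2 x := exists x1, [/\ ele x1 x, inJ x1 & inJ (esub x x1)].

Definition no_t x := forall c, texp x c = 0%N.

Definition yz0 x := forall a, yexp x a = 0%N \/ zexp x a = 0%N.

Definition two_z x := (exists a, (1 < zexp x a)%N) \/
  exists a b, [/\ a != b, (0 < zexp x a)%N & (0 < zexp x b)%N].

(* [inQ2] is the square of the ideal [(z_a, \prod_a y_a)]. *)
Definition inQ2 x := [\/ two_z x, (exists a, 0 < zexp x a)%N /\ (forall a, 0 < yexp x a)%N |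
  forall a, (1 < yexp x a)%N].

(** The square for monomials without [t_c], one clause per pair of generators: [y_a z_a] with
    [y_b z_b] (for distinct and for equal blocks), [\prod_a y_a] with [y_a z_a], [\prod_a y_a]
    twice, and [v z_a] with [y_b z_b], with [\prod_a y_a] and with [v z_b]. *)
Definition sqJ x :=
  [\/ exists a b, [/\ a != b, (0 < yexp x a)%N, (0 < zexp x a)%N &
        (0 < yexp x b)%N /\ (0 < zexp x b)%N],
    exists a, (1 < yexp x a)%N /\ (1 < zexp x a)%N,
    (forall a, 0 < yexp x a)%N /\ (exists a, (1 < yexp x a)%N /\ (0 < zexp x a)%N) |
    [\/ (forall a, 1 < yexp x a)%N,
        (0 < vexp x)%N /\ (exists2 b, (0 < yexp x b)%N & (0 < zexp x b)%N /\ two_z x),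
        [/\ (0 < vexp x)%N, (forall a, 0 < yexp x a)%N & (exists a, 0 < zexp x a)%N] |
        (1 < vexp x)%N /\ two_z x]].

Lemma inJ_le x x' : ele x x' -> inJ x -> inJ x'.
Proof.
move=> [hy hz hv ht] [[a [ya za]]|y|[v [a za]]|[c tc]].
- by constructor 1; exists a; split; [apply: leq_trans ya _ | apply: leq_trans za _].
- by constructor 2 => a; apply: leq_trans (y a) _.
- constructor 3; split; [exact: leq_trans v _ | exists a; exact: leq_trans za _].
- constructor 4; exists c; exact: leq_trans tc _.
Qed.

Lemma two_zP x a b : (0 < zexp x a)%N -> (0 < zexp x b)%N -> (a = b -> 1 < zexp x a)%N -> two_z x.
Proof.
by move=> za zb ab; case: (eqVneq a b) => [/ab ?|nab]; [left; exists a | right; exists a, b].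
Qed.

Lemma inJ2_sqJ x : no_t x -> inJ2 x -> sqJ x.
Proof.
move=> tx [x1 [[hy hz hv ht] J1 J2]]; set x2 := esub x x1 in J2.
have ey a : yexp x a = (yexp x1 a + yexp x2 a)%N by rewrite /= subnKC.
have ez a : zexp x a = (zexp x1 a + zexp x2 a)%N by rewrite /= subnKC.
have ev : vexp x = (vexp x1 + vexp x2)%N by rewrite /= subnKC.
have t1 c : (texp x1 c = 0)%N by apply/eqP; rewrite -leqn0 -(tx c).
have t2 c : (texp x2 c = 0)%N by rewrite /= tx.
clearbody x2; clear hy hz hv ht tx.
have C4 : (exists c, (0 < texp x1 c)%N) -> sqJ x by move=> [c]; rewrite t1.
have C4' : (exists c, (0 < texp x2 c)%N) -> sqJ x by move=> [c]; rewrite t2.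
case: J1 => [[a [ya za]]|y|[v [a za]]|/C4//]; case: J2 => [[b [yb zb]]|y'|[v' [b zb]]|/C4'//].
- case: (eqVneq a b) => [eab|nab]; last first.
    constructor 1; exists a, b; rewrite !ey !ez; split=> //; lia.
  by subst b; constructor 2; exists a; rewrite ey ez; lia.
- constructor 3; split=> [c|]; first by have := y' c; rewrite ey; lia.
  by exists a; have := y' a; rewrite ey ez; lia.
- constructor 4; constructor 2; split; first by lia.
  exists a; rewrite ?ey ?ez; first by lia.
  by split; [lia | apply: (@two_zP x a b); rewrite ?ez => *; subst; lia].
- constructor 3; split=> [c|]; first by have := y c; rewrite ey; lia.
  by exists b; have := y b; rewrite ey ez; lia.
- by constructor 4; constructor 1 => a; have := y a; have := y' a; rewrite ey; lia.
- constructor 4; constructor 3; split; first by lia.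
    by move=> c; have := y c; rewrite ey; lia.
  by exists b; rewrite ez; lia.
- constructor 4; constructor 2; split; first by lia.
  exists b; rewrite ?ey ?ez; first by lia.
  by split; [lia | apply: (@two_zP x a b); rewrite ?ez => *; subst; lia].
- constructor 4; constructor 3; split; first by lia.
    by move=> c; have := y' c; rewrite ey; lia.
  by exists a; rewrite ez; lia.
- constructor 4; constructor 4; split; first by lia.
  by apply: (@two_zP x a b); rewrite ?ez => *; subst; lia.
Qed.

Definition eZ a := Expo (fun=> 0%N) (fun a' => a' == a : nat) 0 (fun=> 0%N).

Lemma inJ2_intro x x1 : ele x1 x -> inJ x1 -> inJ (esub x x1) -> inJ2 x.
Proof. by exists x1. Qed.

Lemma sqJ_inJ2 x : sqJ x -> inJ2 x.
Proof.
have yzJ a : inJ (Expo (fun a' => a' == a : nat) (fun a' => a' == a : nat) 0 (fun=> 0%N)).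
  by constructor 1; exists a; rewrite /= eqxx.
have vzJ a : inJ (Expo (fun=> 0%N) (fun a' => a' == a : nat) 1 (fun=> 0%N)).
  by constructor 3; split => //; exists a; rewrite /= eqxx.
have YJ : inJ (Expo (fun=> 1%N) (fun=> 0%N) 0 (fun=> 0%N)) by constructor 2.
have two_zE : two_z x -> exists a, (0 < zexp x a)%N /\ exists b, (0 < zexp x b - (b == a))%N.
  move=> [[a za]|[a [b [ab za zb]]]].
    by exists a; split; [lia | exists a; rewrite eqxx; lia].
  by exists a; split => //; exists b; rewrite eq_sym (negPf ab) subn0.
case=> [[a [b [ab ya za [yb zb]]]]|[a [ya za]]|[y [a [ya za]]]|].
- apply: (inJ2_intro _ (yzJ a)).
    by split=> // c /=; case: eqP => // ->.
  by constructor 1; exists b; rewrite /= eq_sym (negPf ab) !subn0.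
- apply: (inJ2_intro _ (yzJ a)).
    by split=> // c /=; case: eqP => // ->; lia.
  by constructor 1; exists a; rewrite /= eqxx; lia.
- apply: (inJ2_intro _ YJ); first by split.
  by constructor 1; exists a; rewrite /=; lia.
case=> [y|[v [b yb [zb /two_zE[a [za [a' za']]]]]]|[v y [a za]]|[v /two_zE[a [za [a' za']]]]].
- apply: (inJ2_intro _ YJ); first by split=> // a; apply: ltnW.
  by constructor 2 => a; rewrite /= subn_gt0.
- apply: (inJ2_intro _ (yzJ b)).
    by split=> // c /=; case: eqP => // ->.
  constructor 3; split; first by rewrite /= subn0.
  (* After removal of [y_b z_b] a [z] must be left to accompany [v]: it is [z_a] if [a != b], and
     otherwise the one that survives the removal of [z_a]. *)
  case: (eqVneq a b) => [e|ab]; first by subst b; exists a'.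
  by exists a; rewrite /= (negPf ab) subn0.
- apply: (inJ2_intro _ YJ); first by split.
  by constructor 3; rewrite /= subn0; split=> //; exists a; rewrite subn0.
- apply: (inJ2_intro _ (vzJ a)).
    by split=> // [c /=|]; [case: eqP => // -> | apply: ltnW].
  by constructor 3; split; [rewrite /= subn_gt0 | exists a'].
Qed.

(** * Filtration of the complement of the square by cells *)

Section Shelling.
(* [G D] stands for: the quotient of monomial ideals spanned by the monomials
   with exponents in [D] is Cohen-Macaulay of the expected dimension. The rank
   function of [G_rank] provides a filtration, whose factors are the fibers. *)
Variable G : (expo -> Prop) -> Prop.

(** The generator chosen in a block is [y_a] for [Some true], [z_a] for [Some false] and [y_a z_a]
    for [None]; the condition says that it does not divide the monomial. *)
Definition cond (o : option bool) (y z : nat) :=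
  match o with Some true => y = 0%N | Some false => z = 0%N | None => y = 0%N \/ z = 0%N end.

Hypothesis G_ext : forall D D', (forall x, D x <-> D' x) -> G D -> G D'.
Hypothesis G_rank : forall D (f : expo -> nat) r, (forall x, D x -> (f x < r)%N) ->
  (forall x x', D x -> D x' -> ele x x' -> (f x <= f x')%N) ->
  (forall i, (i < r)%N -> G (fun x => D x /\ f x = i)) -> G D.
Hypothesis G_shift : forall u D D', (forall x, D' x <-> ele u x /\ D (esub x u)) -> G D -> G D'.
Hypothesis G_baseV : forall b : 'I_p -> option bool,
  G (fun x => [/\ forall a, cond (b a) (yexp x a) (zexp x a), vexp x = 0%N & no_t x]).
Hypothesis G_baseY :
  G (fun x => [/\ forall a, zexp x a = 0%N, exists a, yexp x a = 0%N & no_t x]).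

Lemma G_empty D : (forall x, ~ D x) -> G D.
Proof. by move=> D0; apply: (@G_rank D (fun=> 0%N) 0%N) => // x /D0. Qed.

Lemma G_cellV uy uz (o : 'I_p -> option bool) D :
  (forall x, D x <-> [/\ forall a, [/\ uy a <= yexp x a, uz a <= zexp x a &
     cond (o a) (yexp x a - uy a) (zexp x a - uz a)]%N, vexp x = 0%N & no_t x]) -> G D.
Proof.
move=> eD; apply: (G_shift (u := Expo uy uz 0 (fun=> 0%N)) _ (G_baseV o)) => x.
rewrite eD; split.
  move=> [h v t]; split; split=> //=; try by move=> a; have [] := h a.
    by rewrite v.
  by move=> c /=; rewrite t.
move=> [[hy hz _ _] [/= h v t]]; split=> [a||c]; first by split.
  by rewrite -v subn0.
by have := t c; rewrite /= subn0.
Qed.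

(** Translates of the complement of [(z_a, \prod_a y_a, t_c)]; unlike in [G_cellV], the exponent of
    [v] is free. *)
Lemma G_cellY uy uz D :
  (forall x, D x <-> [/\ forall a, [/\ uy a <= yexp x a, uz a <= zexp x a & zexp x a - uz a = 0]%N,
     exists a, (yexp x a - uy a = 0)%N & no_t x]) -> G D.
Proof.
move=> eD; apply: (G_shift (u := Expo uy uz 0 (fun=> 0%N)) _ G_baseY) => x.
rewrite eD; split.
  move=> [h v t]; split; split=> //=; try by move=> a; have [] := h a.
  by move=> c /=; rewrite t.
move=> [[hy hz _ _] [/= h v t]]; split=> [a||c] //.
by have := t c; rewrite /= subn0.
Qed.

(** Positions are counted from 1, so that 0 means none. Raising exponents can only move the last
    positive one up, which makes this a rank function. *)
Definition last_pos (P : pred 'I_p) (z : 'I_p -> nat) := \max_(a < p | P a && (0 < z a)%N) a.+1.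

Lemma last_pos_le P z : (last_pos P z < p.+1)%N.
Proof. by rewrite ltnS; apply/bigmax_leqP => a _. Qed.

Lemma last_pos_geq (P : pred 'I_p) z a : P a -> (0 < z a)%N -> (a < last_pos P z)%N.
Proof.
move=> Pa za; rewrite /last_pos.
by apply: (@leq_bigmax_cond _ _ (fun a : 'I_p => a.+1) a); rewrite Pa.
Qed.

Lemma last_pos_mono P z z' : (forall a, z a <= z' a)%N -> (last_pos P z <= last_pos P z')%N.
Proof.
move=> h; apply/bigmax_leqP => a /andP[Pa za].
by apply: last_pos_geq => //; apply: leq_trans za (h a).
Qed.

Lemma last_pos_mono2 (P P' : pred 'I_p) z z' : (forall a, P a -> P' a) ->
  (forall a, z a <= z' a)%N -> (last_pos P z <= last_pos P' z')%N.
Proof.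
move=> hP h; apply/bigmax_leqP => a /andP[Pa za].
by apply: last_pos_geq; [exact: hP | apply: leq_trans za (h a)].
Qed.

Lemma last_pos0 P z : last_pos P z = 0%N <-> forall a, P a -> z a = 0%N.
Proof.
split=> [h a Pa|h].
  apply/eqP; rewrite -leqn0 leqNgt; apply/negP => za.
  by have := last_pos_geq Pa za; rewrite h.
by apply/eqP; rewrite -leqn0; apply/bigmax_leqP => a /andP[/h->].
Qed.

Lemma last_posS P z i : last_pos P z = i.+1 ->
  exists a : 'I_p, [/\ a = i :> nat, P a, (0 < z a)%N &
    forall b : 'I_p, P b -> (a < b)%N -> z b = 0%N].
Proof.
move=> h; have [a0 Pa0] : exists a, P a && (0 < z a)%N.
  apply: contrapT => n; have : last_pos P z = 0%N; last by rewrite h.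
  apply/last_pos0 => a Pa; apply/eqP; rewrite -leqn0 leqNgt; apply/negP => za; apply: n.
  by exists a; rewrite Pa.
have [|a /andP[Pa za] e] := @eq_bigmax_cond _ (fun a => P a && (0 < z a)%N) (fun a : 'I_p => a.+1).
  by apply/card_gt0P; exists a0.
exists a; split=> //; first by move: h; rewrite /last_pos e => -[].
move=> b Pb ab; apply/eqP; rewrite -leqn0 leqNgt; apply/negP => zb.
by have := last_pos_geq Pb zb; rewrite /last_pos e ltnS leqNgt ab.
Qed.

Lemma last_posE (P : pred 'I_p) z (a : 'I_p) : P a -> (0 < z a)%N ->
  (forall b : 'I_p, P b -> (a < b)%N -> z b = 0%N) -> last_pos P z = a.+1.
Proof.
move=> Pa za h; apply/anti_leq/andP; split; last first.
  exact: last_pos_geq.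
apply/bigmax_leqP => b /andP[Pb zb]; rewrite ltnS leqNgt; apply/negP => /(h b Pb) e.
by rewrite e in zb.
Qed.

Lemma ord_cases (a c : 'I_p) : [\/ (a < c)%N /\ a != c, a = c | (c < a)%N /\ a != c].
Proof.
case: (ltngtP a c) => h; last by constructor 2; apply: val_inj.
  by constructor 1; split=> //; apply/eqP => e; rewrite e ltnn in h.
by constructor 3; split=> //; apply/eqP => e; rewrite e ltnn in h.
Qed.

Definition linear_cell (B : pred 'I_p) x :=
  [/\ forall a, B a -> zexp x a = 0%N, yz0 x, vexp x = 0%N, no_t x &
  exists a, (0 < zexp x a)%N].

(** If the last [z] is in block [c], the monomial is [z_c] times one that avoids [y_c], the [z_a]
    with [c < a] or [B a], and [y_a z_a] in the other blocks. These are the colon ideals of linear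
    quotients. *)
Lemma G_linear B : G (linear_cell B).
Proof.
apply: (G_rank (f := fun x => last_pos predT (zexp x)) (r := p.+1)) => [x _|x x' _ _ [_ h _ _]|i ip].
- exact: last_pos_le.
- exact: last_pos_mono.
case: i ip => [|i] ip.
  by apply: G_empty => x [[_ _ _ _ [a za]] /last_pos0/(_ a isT) e]; rewrite e in za.
pose c := Ordinal (ip : (i < p)%N).
have [Bc|nBc] := boolP (B c).
  apply: G_empty => x [[hB _ _ _ _] /last_posS[a [ea _ za _]]].
  have ac : a = c by apply: val_inj.
  by rewrite ac hB in za.
apply: (@G_cellV (fun=> 0%N) (fun a => a == c) (fun a => if a == c then Some true
  else if (c < a)%N || B a then Some false else None)) => x; split.
  move=> [[hB hyz v t _] /last_posS[c' [ec' _ zc h]]]; split=> // a.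
  have {c' ec' zc h} [zc h] : (0 < zexp x c)%N /\ forall b, (c < b)%N -> zexp x b = 0%N.
    have <- : c' = c by exact: val_inj.
    by split=> // b; apply: h.
  have := hyz a; rewrite !subn0; case: (eqVneq a c) => [->|ac] yz; first by split=> //=; lia.
  split=> //; case: ltnP => [/h -> //|_] /=.
  by case: ifP => [/hB -> //|_] /=; rewrite subn0.
move=> [h v t]; split; last first.
  apply: (last_posE (a := c)) => // [|b _ cb].
    by have [_ + _] := h c; rewrite eqxx.
  have [_ _] := h b; case: (eqVneq b c) => [e|_]; first by rewrite e ltnn in cb.
  by rewrite cb /= subn0.
split=> // [a Ba|a|].
- have [_ _] := h a; case: (eqVneq a c) => [e|_]; first by rewrite -e Ba in nBc.
  by rewrite Ba orbT /= subn0.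
- have [_ _] := h a; case: (eqVneq a c) => _ /=; first by left; lia.
  by case: ifP => _ /=; rewrite !subn0; [right|].
- by exists c; have [_ + _] := h c; rewrite eqxx.
Qed.

Definition quadratic_cell x := [/\ yz0 x, vexp x = 0%N, no_t x & two_z x].

(** Let [c] be the last block containing a [z] and [d] the last such block before it. The cell
    consists of multiples of [z_c z_d], or of the square of [z_c] if there is no [d]. *)
Lemma G_quadratic : G quadratic_cell.
Proof.
apply: (G_rank (f := fun x => last_pos predT (zexp x)) (r := p.+1)) => [x _|x x' _ _ [_ h _ _]|i ip].
- exact: last_pos_le.
- exact: last_pos_mono.
case: i ip => [|i] ip.
  apply: G_empty => x [[_ _ _ two] /last_pos0 z0].
  by case: two => [[a]|[a [b [_]]]]; rewrite z0.
pose c := Ordinal (ip : (i < p)%N).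
apply: (G_rank (f := fun x => last_pos (fun a => a < c)%N (zexp x)) (r := p.+1)) =>
    [x _|x x' _ _ [_ h _ _]|l lp].
- exact: last_pos_le.
- exact: last_pos_mono.
have lastc x : last_pos predT (zexp x) = i.+1 ->
    (0 < zexp x c)%N /\ forall b : 'I_p, (c < b)%N -> zexp x b = 0%N.
  move=> /last_posS[c' [ec' _ zc h]]; have ec : c' = c by exact: val_inj.
  by rewrite -ec; split=> // b; apply: h.
case: l lp => [|l] lp.
  apply: (@G_cellV (fun=> 0%N) (fun a => 2 * (a == c))%N (fun a => if a == c then Some true
    else Some false)) => x; split.
    move=> [[[hyz v t two] /lastc[zc h] /last_pos0 h']]; split=> // a.
    have zc2 : (1 < zexp x c)%N.
      case: two => [[b zb]|[b [d [bd zb zd]]]].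
        by case: (ord_cases b c) => [[/h' e _]|<-//|[/h e _]]; rewrite e in zb.
      case: (ord_cases b c) => [[/h' e _]|eb|[/h e _]]; [by rewrite e in zb| |by rewrite e in zb].
      case: (ord_cases d c) => [[/h' e _]|ed|[/h e _]]; [by rewrite e in zd| |by rewrite e in zd].
      by rewrite eb ed eqxx in bd.
    have := hyz a; case: (ord_cases a c) => [[/h' e ac]|->|[/h e ac]] yz.
    - by rewrite (negPf ac) /=; split=> //; lia.
    - by rewrite eqxx /=; split=> //; lia.
    - by rewrite (negPf ac) /=; split=> //; lia.
  move=> [h v t].
  have zc : (1 < zexp x c)%N by have [_ + _] := h c; rewrite eqxx muln1.
  have z0 a : a != c -> zexp x a = 0%N.
    by move=> ac; have [_ _] := h a; rewrite (negPf ac) /= subn0.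
  split; first split; first split=> //.
  - move=> a; have [_ _] := h a; case: (eqVneq a c) => [_|/z0 e _] /=; first by left; lia.
    by right.
  - by left; exists c.
  - apply: (last_posE (a := c)) => // [|b _ cb]; first exact: ltnW.
    by apply: z0; apply: contraTneq cb => ->; rewrite ltnn.
  - by apply/last_pos0 => a ac; apply: z0; apply: contraTneq ac => ->; rewrite ltnn.
pose d := Ordinal (lp : (l < p)%N).
have [dc|ndc] := boolP (d < c)%N; last first.
  apply: G_empty => x [_ /last_posS[d' [ed dc _ _]]].
  have e : d' = d by exact: val_inj.
  by rewrite e (negPf ndc) in dc.
have d_neq_c : d != c by apply: contraTneq dc => ->; rewrite ltnn.
apply: (@G_cellV (fun=> 0%N) (fun a => (a == c) + (a == d))%N (fun a => if (a == c) || (a == d) then Some true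
    else if (d < a)%N then Some false else None)) => x; split.
  move=> [[[hyz v t two] /lastc[zc h] /last_posS[d' [ed _ zd hd]]]]; split=> // a.
  have {}ed : d' = d by exact: val_inj.
  rewrite {}ed in zd hd; have := hyz a.
  case: (eqVneq a c) => [->|ac]; first by rewrite eq_sym (negPf d_neq_c) /=; split=> //; lia.
  case: (eqVneq a d) => [->|ad] /=; first by split=> //; lia.
  case: ltnP => [da|_] /= yz; last by rewrite !subn0; split.
  split=> //; rewrite subn0; case: (ord_cases a c) => [[/hd e _]|e|[/h e _]] //.
    exact: e da.
  by rewrite e eqxx in ac.
move=> [h v t].
have zc : (0 < zexp x c)%N by have [_ + _] := h c; rewrite eqxx eq_sym (negPf d_neq_c).
have zd : (0 < zexp x d)%N by have [_ + _] := h d; rewrite eqxx (negPf d_neq_c).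
have z0 a : a != c -> (d < a)%N -> zexp x a = 0%N.
  move=> ac da; have [_ _] := h a; rewrite (negPf ac) /= da.
  case: (eqVneq a d) => [e|_]; last by rewrite /= subn0.
  by rewrite e ltnn in da.
split; first split; first split=> //.
- move=> a; have [_ _] := h a.
  case: (eqVneq a c) => _; case: (eqVneq a d) => _ /=; try by left; lia.
  by case: ifP => _ /=; lia.
- by right; exists c, d; rewrite eq_sym.
- apply: (last_posE (a := c)) => // b _ cb; apply: z0; last exact: ltn_trans cb.
  by apply: contraTneq cb => ->; rewrite ltnn.
- apply: (last_posE (a := d)) => // b bc; apply: z0.
  by apply: contraTneq bc => ->; rewrite ltnn.
Qed.

Lemma sqJ_Q2 x : sqJ x -> inQ2 x.
Proof.
case=> [[a [b [ab ya za [yb zb]]]]|[a [ya za]]|[y [a [ya za]]]|].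
- by constructor 1; right; exists a, b.
- by constructor 1; left; exists a.
- by constructor 2; split=> //; exists a.
case=> [y|[v [b yb [zb tz]]]|[v y z]|[v tz]].
- by constructor 3.
- by constructor 1.
- by constructor 2.
- by constructor 1.
Qed.

Lemma inQ2_le x x' : ele x x' -> inQ2 x -> inQ2 x'.
Proof.
move=> [hy hz hv ht] [[[a za]|[a [b [ab za zb]]]]|[[a za] y]|y].
- by constructor 1; left; exists a; apply: leq_trans za _.
- by constructor 1; right; exists a, b; split=> //; [apply: leq_trans za _ | apply: leq_trans zb _].
- constructor 2; split=> [|b]; last exact: leq_trans (y b) _.
  by exists a; apply: leq_trans za _.
- by constructor 3 => a; apply: leq_trans (y a) _.
Qed.

Lemma no_z x : ~ (exists a, (0 < zexp x a)%N) -> forall a, zexp x a = 0%N.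
Proof. by move=> h a; apply/eqP; rewrite -leqn0 leqNgt; apply/negP => za; apply: h; exists a. Qed.

Lemma no_y x : ~ (forall a, (0 < yexp x a)%N) -> exists a, yexp x a = 0%N.
Proof.
move=> h; apply: contrapT => n; apply: h => a; rewrite lt0n.
by apply/eqP => e; apply: n; exists a.
Qed.

(** [Q = (z_a, \prod_a y_a)] is a complete intersection, so [Q / Q^2] is free over [S / Q]. The
    fibres of rank 0, 1 and [c + 2] are the translates of the complement of [Q] by 1, [\prod_a y_a]
    and [z_c]. *)
Lemma G_P1 : G (fun x => no_t x /\ ~ inQ2 x).
Proof.
apply: (G_rank (f := fun x => if `[< exists a, (0 < zexp x a)%N >] then
   (last_pos predT (zexp x)).+1 else `[< forall a, (0 < yexp x a)%N >] : nat) (r := p.+2)).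
- by move=> x _; case: asboolP => _; [rewrite ltnS last_pos_le | case: asboolP].
- move=> x x' _ _ [hy hz _ _]; case: (asboolP (exists a, (0 < zexp x a)%N)) => [[a za]|nz].
    have -> : `[< exists a, (0 < zexp x' a)%N >].
      by apply/asboolP; exists a; apply: leq_trans za _.
    by rewrite ltnS last_pos_mono.
  case: (asboolP (forall a, (0 < yexp x a)%N)) => // y.
  case: asboolP => // _; have -> // : `[< forall a, (0 < yexp x' a)%N >].
  by apply/asboolP => a; apply: leq_trans (y a) _.
move=> [|[|i]] ip.
- apply: (@G_cellY (fun=> 0%N) (fun=> 0%N)) => x; split.
    move=> [[tx nQ]]; case: asboolP => // /no_z z0; case: asboolP => // /no_y[b yb] _.
    by split=> // [a|]; [rewrite z0 | exists b; rewrite yb].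
  move=> [h [b yb] tx]; rewrite subn0 in yb.
  have z0 a : zexp x a = 0%N by have [_ _] := h a; rewrite subn0.
  split; first split=> // -[[[a]|[a [c [_]]]]|[[a]]|y]; rewrite ?z0 //.
    by have := y b; rewrite yb.
  case: asboolP => [[a]|_]; first by rewrite z0.
  by case: asboolP => // y; have := y b; rewrite yb.
- apply: (@G_cellY (fun=> 1%N) (fun=> 0%N)) => x; split.
    move=> [[tx nQ]]; case: asboolP => [[a za] [/last_pos0/(_ a isT) e]|/no_z z0].
      by rewrite e in za.
    case: asboolP => // y _; split=> // [a|]; first by rewrite z0 y.
    apply: contrapT => n; apply: nQ; constructor 3 => a.
    by rewrite ltn_neqAle y andbT; apply/eqP => e; apply: n; exists a; rewrite -e.
  move=> [h [b yb] tx].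
  have y a : (0 < yexp x a)%N by have [] := h a.
  have z0 a : zexp x a = 0%N by have [_ _] := h a; rewrite subn0.
  split; first split=> // -[[[a]|[a [c [_]]]]|[[a]]|y2]; rewrite ?z0 //.
    by have := y2 b; lia.
  case: asboolP => [[a]|_]; first by rewrite z0.
  by case: asboolP.
pose c := Ordinal (ip : (i < p)%N).
apply: (@G_cellY (fun=> 0%N) (fun a => a == c)) => x; split.
  move=> [[tx nQ]]; case: asboolP => [_ [/last_posS[c' [ec _ zc _]]]|_]; last by case: asboolP.
  have {}ec : c' = c by exact: val_inj.
  rewrite ec {c' ec} in zc; split=> // [a|].
    split=> //; first by case: eqVneq => [->|].
    case: (eqVneq a c) => [->|ac] /=.
      apply/eqP; rewrite subn_eq0 leqNgt; apply/negP => zc2.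
      by apply: nQ; constructor 1; left; exists c.
    rewrite subn0; apply/eqP; rewrite -leqn0 leqNgt; apply/negP => za.
    by apply: nQ; constructor 1; right; exists a, c.
  have [a ya] : exists a, yexp x a = 0%N.
    by apply: no_y => y; apply: nQ; constructor 2; split=> //; exists c.
  by exists a; rewrite ya.
move=> [h [b yb] tx]; rewrite subn0 in yb.
have zc : zexp x c = 1%N by have [_ + +] := h c; rewrite eqxx /=; lia.
have z0 a : a != c -> zexp x a = 0%N.
  by move=> /negPf ac; have [_ _] := h a; rewrite ac subn0.
split; first split=> //.
  case=> [[[a]|[a [d [ad za zd]]]]|[_ y]|y]; last by have := y b; rewrite yb.
  - by case: (eqVneq a c) => [->|/z0->]; rewrite ?zc.
  - case: (eqVneq a c) => [ea|/z0 e]; last by rewrite e in za.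
    case: (eqVneq d c) => [ed|/z0 e]; last by rewrite e in zd.
    by rewrite ea ed eqxx in ad.
  - by have := y b; rewrite yb.
case: asboolP => [_|[]]; last by exists c; rewrite zc.
congr S; apply: (last_posE (a := c)) => // [|a _ ca]; first by rewrite zc.
by apply: z0; apply: contraTneq ca => ->; rewrite ltnn.
Qed.

(** Equal to [p] if there is no such block. It serves for conditions [y_a = 0]: multiplication can
    only destroy them, so the first one can only move up. *)
Definition first_pos (P : pred 'I_p) := find P (enum 'I_p).

Lemma first_posP (P : pred 'I_p) a0 : P a0 -> exists a : 'I_p,
  [/\ a = first_pos P :> nat, P a & forall c : 'I_p, (c < a)%N -> ~~ P c].
Proof.
move=> Pa0; have hP : has P (enum 'I_p) by apply/hasP; exists a0; rewrite ?mem_enum.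
have lt : (first_pos P < p)%N by rewrite -[X in (_ < X)%N]size_enum_ord -has_find.
exists (Ordinal lt); split=> //.
  by have := nth_find a0 hP; rewrite -/(first_pos P) -[first_pos P]/(nat_of_ord (Ordinal lt)) nth_ord_enum.
by move=> c /= /(before_find a0); rewrite nth_ord_enum => ->.
Qed.

Lemma first_posE (P : pred 'I_p) (a : 'I_p) : P a ->
  (forall c : 'I_p, (c < a)%N -> ~~ P c) -> first_pos P = a.
Proof.
move=> Pa h; have [a' [<- Pa' h']] := first_posP Pa.
case: (ltngtP a' a) => // [/h|/h']; by rewrite ?Pa ?Pa'.
Qed.

(** If [a] is the first block other than [b] with [y_a = 0], the blocks before it other than [b]
    contain a [y] and hence no [z]. *)
Lemma G_first b : G (fun x => [/\ yz0 x, vexp x = 0%N, no_t x, yexp x b = 0%N &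
  exists a, a != b /\ yexp x a = 0%N]).
Proof.
apply: (G_rank (f := fun x => first_pos (fun a => (a != b) && (yexp x a == 0%N))) (r := p.+1)).
- by move=> x _; rewrite ltnS -[X in (_ <= X)%N]size_enum_ord find_size.
- move=> x x' _ _ [hy _ _ _]; apply: sub_find => a /andP[-> /eqP e] /=.
  by rewrite -leqn0 -e.
move=> i _.
have [[a ea]|na] := pselect (exists a : 'I_p, a = i :> nat); last first.
  apply: G_empty => x [[_ _ _ _ [a [ab ya]]] e].
  have [|a' [ea' _ _]] := @first_posP (fun a => (a != b) && (yexp x a == 0%N)) a.
    by rewrite ab ya.
  by apply: na; exists a'; rewrite ea'.
have [eab|ab] := eqVneq a b.
  apply: G_empty => x [[_ _ _ _ [d [db yd]]] e].
  have [|a' [ea' /andP[a'b _] _]] := @first_posP (fun a => (a != b) && (yexp x a == 0%N)) d.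
    by rewrite db yd.
  have e' : a' = a by apply: val_inj; rewrite /= ea' e ea.
  by rewrite e' eab eqxx in a'b.
apply: (@G_cellV (fun c => (c < a)%N && (c != b)) (fun=> 0%N) (fun c => if (c == b) || (c == a) then Some true
  else if (c < a)%N then Some false else None)) => x; split.
  move=> [[hyz v tx yb [d [db yd]]] e].
  have [|a' [ea' /andP[_ /eqP ya] h]] := @first_posP (fun a => (a != b) && (yexp x a == 0%N)) d.
    by rewrite db yd.
  have e' : a' = a by apply: val_inj; rewrite /= ea' e ea.
  rewrite {}e' in ya h; split=> // c; have := hyz c.
  case: (eqVneq c b) => [->|cb] /=; first by rewrite andbF yb.
  rewrite andbT; case: (ord_cases c a) => [[ca nca]|->|[ca nca]].
  - have := h c ca; rewrite cb /= -lt0n => yc; rewrite ca (negPf nca) /= => yz; split=> //; lia.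
  - by rewrite ltnn eqxx /= ya.
  - by rewrite (negPf nca) ltnNge (ltnW ca) /= !subn0.
move=> [h v tx].
have yb : yexp x b = 0%N by have [_ _] := h b; rewrite eqxx andbF /= subn0.
have ya : yexp x a = 0%N by have [_ _] := h a; rewrite eqxx orbT ltnn /= subn0.
split; first split=> //.
- move=> c; have := h c; case: (eqVneq c b) => [->|cb] /=; first by left.
  case: (eqVneq c a) => [->|ca] /=; first by left.
  by rewrite andbT; case: (c < a)%N => /= -[]; lia.
- by exists a.
rewrite -ea; apply: first_posE; first by rewrite ab ya.
move=> c ca; rewrite negb_and negbK; case: (eqVneq c b) => //= cb.
by have [+ _ _] := h c; rewrite ca cb /= lt0n.
Qed.

(** Cofactors of [y_b z_b] in monomials of [inQ2] outside [sqJ], without [v] and [t_c]. As [z_b] is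
    present, [inQ2] asks for another [z] or for all other [y_a]; avoiding [sqJ] excludes a further
    [y_a z_a] and a further [\prod_a y_a]. *)
Definition mixed_cell b x := [/\ yz0 x, vexp x = 0%N, no_t x, exists a, yexp x a = 0%N &
  (exists a, (0 < zexp x a)%N) \/ (forall a, a != b -> (0 < yexp x a)%N)].

Lemma G_mixed b : G (mixed_cell b).
Proof.
(* In rank 2 all [y_a] with [a != b] occur, which forces [y_b = 0] and [z_a = 0] for these [a]. Rank
   1 is [z_b] times the set of [G_first], and rank 0 is a linear cell without [z_b]. *)
apply: (G_rank (f := fun x => if `[< forall a, a != b -> (0 < yexp x a)%N >] then 2%N
  else (0 < zexp x b)%N : nat) (r := 3)).
- by move=> x _; case: asboolP => //; case: (0 < _)%N.
- move=> x x' _ _ [hy hz _ _]; case: asboolP => [y|_].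
    have -> // : `[< forall a, a != b -> (0 < yexp x' a)%N >].
    by apply/asboolP => a /y ya; apply: leq_trans ya _.
  case: asboolP => _; first by case: (0 < _)%N.
  by case: ltnP => // zb; rewrite (leq_trans zb (hz b)).
move=> [|[|[|//]]] _.
- apply: G_ext (G_linear (pred1 b)) => x; split.
    move=> [zb hyz v tx [a za]].
    have ab : a != b by apply: contraTneq za => ab; rewrite zb //=; apply/eqP.
    have ya : yexp x a = 0%N by case: (hyz a) => // e; rewrite e in za.
    split; first split=> //; try by [exists a | left; exists a].
    rewrite zb /= ?eqxx //; case: asboolP => // y.
    by have := y a ab; rewrite ya.
  move=> [[hyz v tx [a ya] h]]; case: asboolP => // ny; case: ltnP => // zb _.
  split=> // [d /eqP->|]; first by apply/eqP; rewrite -leqn0.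
  by case: h.
- apply: (G_shift (u := eZ b) _ (G_first b)) => x; split.
    move=> [[hyz v tx _ _]]; case: asboolP => // ny; case: ltnP => // zb _.
    have yb : yexp x b = 0%N by case: (hyz b) => // e; rewrite e in zb.
    split; first by split=> // a /=; case: eqP => // ->.
    split=> //=.
    + by move=> a /=; rewrite subn0; case: (hyz a) => ->; [left | right].
    + by rewrite v.
    + by move=> c /=; rewrite tx.
    + by rewrite subn0.
    apply: contrapT => n; apply: ny => a ab; rewrite lt0n; apply/eqP => ya.
    by apply: n; exists a; rewrite subn0.
  move=> [[_ hz _ _] [/= hyz v tx yb [a [ab ya]]]]; rewrite !subn0 in v yb ya.
  have zb : (0 < zexp x b)%N by have := hz b; rewrite /= eqxx.
  split; first split=> //.
  + move=> c; have := hyz c; rewrite /= subn0.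
    case: (eqVneq c b) => [-> _|_]; first by left.
    by rewrite subn0.
  + by move=> c; have := tx c; rewrite /= subn0.
  + by exists a.
  + by left; exists b.
  case: asboolP => [y|_]; first by have := y a ab; rewrite ya.
  by rewrite zb.
apply: (@G_cellV (fun a => a != b) (fun=> 0%N) (fun a => if a == b then Some true
  else Some false)) => x; split.
  move=> [[hyz v tx [d yd] _]]; case: asboolP => [y _|_]; last by case: (0 < _)%N.
  split=> // a; have := hyz a; case: (eqVneq a b) => [->|ab] /=.
    have <- : d = b by apply/eqP; apply: contraT => /y; rewrite yd.
    by rewrite yd.
  by have := y a ab => ya; split=> //; lia.
move=> [h v tx].
have yb : yexp x b = 0%N by have [_ _] := h b; rewrite eqxx /= subn0.
have y a : a != b -> (0 < yexp x a)%N by move=> ab; have [+ _ _] := h a; rewrite ab.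
split; last by case: asboolP.
split=> //; [|by exists b|by right].
move=> a; have [_ _] := h a; case: (eqVneq a b) => [-> _|_] /=; first by left.
by rewrite subn0; right.
Qed.

(** Outside the square at most one block [b] contains [y_b z_b], and this product is divided out. If
    there is none, only multiples of a product of two [z] remain. *)
Lemma G_v0 : G (fun x => [/\ no_t x, vexp x = 0%N, inQ2 x & ~ sqJ x]).
Proof.
apply: (G_rank (f := fun x => last_pos (fun a => 0 < yexp x a)%N (zexp x)) (r := p.+1)) => [x _|x x' _ _ [hy hz _ _]|].
- exact: last_pos_le.
- by apply: last_pos_mono2 => // a ya; apply: leq_trans ya _.
case=> [|i] ip.
  apply: G_ext G_quadratic => x; split.
    move=> [hyz v tx tz]; split; last first.
      by apply/last_pos0 => a ya; case: (hyz a) => // e; rewrite e in ya.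
    have nyz a : (0 < yexp x a)%N -> (0 < zexp x a)%N -> False by case: (hyz a) => ->.
    split=> //; first by constructor 1.
    case=> [[a [b [_ /nyz h /h //]]]|[a [ya za]]|[_ [a [ya za]]]|].
    - by apply: (nyz a); lia.
    - by apply: (nyz a); lia.
    case=> [y|[v0]|[v0]|[v0]]; try by rewrite v in v0.
    by case: tz => [[a za]|[a [b [_ za _]]]]; apply: (nyz a) => //; have := y a; lia.
  move=> [[tx v Q nsq] /last_pos0 h].
  have hyz : yz0 x by move=> a; case: (posnP (yexp x a)) => [|/h]; by [left | right].
  split=> //; case: Q => [//|[[a za] y]|y].
    by have := h a (y a) => e; rewrite e in za.
  by case: nsq; constructor 4; constructor 1.
pose b := Ordinal (ip : (i < p)%N).
apply: (G_shift (u := Expo (fun a => a == b) (fun a => a == b) 0 (fun=> 0%N)) _ (G_mixed b)) => x; split.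
  move=> [[tx v Q nsq] /last_posS[b' [eb yb zb _]]].
  have {}eb : b' = b by exact: val_inj.
  rewrite {b'}eb in yb zb.
  split; first by split=> // a /=; case: eqP => // ->.
  split=> /=.
  - move=> a /=; case: (eqVneq a b) => [->|ab] /=.
      have [|/ltP y2] := leqP (yexp x b) 1; first by left; lia.
      have [|z2] := leqP (zexp x b) 1; first by right; lia.
      by case: nsq; constructor 2; exists b; split=> //; lia.
    rewrite !subn0; have [|ya] := posnP (yexp x a); first by left.
    have [|za] := posnP (zexp x a); first by right.
    by case: nsq; constructor 1; exists a, b.
  - by rewrite v.
  - by move=> c; rewrite /= tx.
  - apply: contrapT => n; apply: nsq; constructor 3.
    have y a : (0 < yexp x a - (a == b))%N.
      by rewrite lt0n; apply/eqP => e; apply: n; exists a.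
    split; first by move=> a; have := y a; lia.
    by exists b; have := y b; rewrite eqxx; lia.
  case: Q => [[[a za]|[a [d [ad za zd]]]]|[_ y]|y].
  - by left; exists a; lia.
  - left; case: (eqVneq a b) => [e|ab]; last by exists a; rewrite (negPf ab) subn0.
    by exists d; rewrite -e eq_sym (negPf ad) subn0.
  - by right=> a ab; rewrite (negPf ab) subn0.
  - by right=> a ab; rewrite (negPf ab) subn0 ltnW.
move=> [[hy hz _ _] [/= hyz v tx [d yd] h]].
have yb : (0 < yexp x b)%N by have := hy b; rewrite /= eqxx.
have zb : (0 < zexp x b)%N by have := hz b; rewrite /= eqxx.
rewrite subn0 in v.
have nyz a : a != b -> (0 < yexp x a)%N -> (0 < zexp x a)%N -> False.
  by move=> ab; have := hyz a; rewrite /= (negPf ab) !subn0 => -[->|->].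
have ny : ~ ((1 < yexp x b)%N /\ forall a, (0 < yexp x a)%N).
  move=> [y2 y]; move: yd; case: (eqVneq d b) => [->|_]; first by lia.
  by have := y d; lia.
split; last first.
  apply: (last_posE (a := b)) => // a ya ba.
  have ab : a != b by apply: contraTneq ba => ->; rewrite ltnn.
  by apply/eqP; rewrite -leqn0 leqNgt; apply/negP; exact: (nyz a ab ya).
split=> //.
- by move=> c; have := tx c; rewrite /= subn0.
- case: h => [[a za]|y].
    constructor 1; case: (eqVneq a b) za => [->|ab] za; first by left; exists b; lia.
    by right; exists a, b; split=> //; lia.
  constructor 2; split=> [|a]; first by exists b.
  case: (eqVneq a b) => [->//|ab]; by have := y a ab; rewrite (negPf ab) subn0.
case=> [[a [e [ae ya za [ye ze]]]]|[a [ya za]]|[y [a [ya za]]]|].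
- case: (eqVneq a b) => [ab|ab]; last exact: (nyz a ab).
  by apply: (nyz e) => //; rewrite -ab eq_sym.
- case: (eqVneq a b) => [ab|ab]; last by apply: (nyz a ab); lia.
  by subst a; have := hyz b; rewrite /= eqxx; lia.
- case: (eqVneq a b) => [ab|ab]; last by apply: (nyz a ab); lia.
  by apply: ny; rewrite -{1}ab.
case=> [y|[v0]|[v0]|[v0]]; try by rewrite v in v0.
by apply: ny; split=> // a; apply: ltnW.
Qed.

Definition eV := Expo (fun=> 0%N) (fun=> 0%N) 1 (fun=> 0%N).
Definition eT (c : T) := Expo (fun=> 0%N) (fun=> 0%N) 0 (fun c' => c' == c).

(** Since [v^2 Q^2] lies in the square, beyond the complement of [Q^2] only the layers with exponent
    0 and 1 in [v] are left. In the second one only products of two [z] survive, [v z_a \prod_a y_a]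
    being in the square. *)
Lemma G_t0 : G (fun x => no_t x /\ ~ sqJ x).
Proof.
apply: (G_rank (f := fun x => if `[< inQ2 x >] then (vexp x).+1 else 0%N) (r := 3)).
- move=> x [tx nsq]; case: asboolP => // Q; rewrite !ltnS leqNgt; apply/negP => v.
  apply: nsq; constructor 4; case: Q => [tz|[z y]|y]; [constructor 4 | constructor 3 | constructor 1] => //.
  by split=> //; lia.
- move=> x x' _ _ xx'; have [_ _ hv _] := xx'; case: asboolP => // Q.
  by have -> : `[< inQ2 x' >] by apply/asboolP; apply: inQ2_le Q.
move=> [|[|[|//]]] _.
- apply: G_ext G_P1 => x; split=> [[tx nQ]|[[tx nsq]]]; last by case: asboolP.
  by split; [split=> // /sqJ_Q2 | case: asboolP].
- apply: G_ext G_v0 => x; split=> [[tx v Q nsq]|[[tx nsq]]].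
    by split=> //; case: asboolP => // _; rewrite v.
  by case: asboolP => // Q [v].
apply: (G_shift (u := eV) _ G_quadratic) => x; split.
  move=> [[tx nsq]]; case: asboolP => // Q [v].
  have tz : two_z x.
    case: Q => [//|[z y]|y]; case: nsq; constructor 4; first by constructor 3; rewrite v.
    by constructor 1.
  split; first by split=> //=; rewrite v.
  split=> /=; [|by rewrite v|by move=> c /=; rewrite tx|].
    move=> a /=; rewrite !subn0; have [|ya] := posnP (yexp x a); first by left.
    have [|za] := posnP (zexp x a); first by right.
    by case: nsq; constructor 4; constructor 2; rewrite v; split=> //; exists a.
  case: tz => [[a za]|[a [b [ab za zb]]]]; [left; exists a | right; exists a, b];
    by rewrite /= !subn0.
move=> [[_ _ /= v1 _] [/= hyz v tx tz]].
have {}v : vexp x = 1%N by lia.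
have {}tz : two_z x.
  case: tz => [[a za]|[a [b [ab za zb]]]]; first by left; exists a; rewrite /= subn0 in za.
  by right; exists a, b; rewrite /= !subn0 in za zb.
have nyz a : (0 < yexp x a)%N -> (0 < zexp x a)%N -> False.
  by have := hyz a; rewrite /= !subn0 => -[->|->].
split; last by case: asboolP => [_|[]]; [rewrite v | constructor 1].
split; first by move=> c; have := tx c; rewrite /= subn0.
case=> [[a [b [_ ya za _]]]|[a [ya za]]|[_ [a [ya za]]]|].
- exact: (nyz a ya za).
- by apply: (nyz a); lia.
- by apply: (nyz a); lia.
case=> [y|[_ [b yb [zb _]]]|[_ y [a za]]|[v2 _]].
- by case: tz => [[a za]|[a [b [_ za _]]]]; apply: (nyz a) => //; have := y a; lia.
- exact: (nyz b yb zb).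
- exact: (nyz a (y a) za).
- by rewrite v in v2.
Qed.

(** A monomial with some [z] must avoid [v] and every [y_a z_a], and then avoids [\prod_a y_a]
    automatically; without any [z] only [\prod_a y_a] has to be avoided and [v] is free. *)
Lemma G_notJ : G (fun x => no_t x /\ ~ inJ x).
Proof.
apply: (G_rank (f := fun x => `[< exists a, (0 < zexp x a)%N >] : nat) (r := 2)).
- by move=> x _; case: asboolP.
- move=> x x' _ _ [_ hz _ _]; case: asboolP => // -[a za].
  have -> // : `[< exists a, (0 < zexp x' a)%N >].
  by apply/asboolP; exists a; apply: leq_trans za _.
move=> [|[|//]] _.
  apply: (@G_cellY (fun=> 0%N) (fun=> 0%N)) => x; split.
    move=> [[tx nJ]]; case: asboolP => // /no_z z0 _; split=> // [a|]; first by rewrite z0.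
    have [a ya] : exists a, yexp x a = 0%N by apply: no_y => y; apply: nJ; constructor 2.
    by exists a; rewrite ya.
  move=> [h [b yb] tx]; rewrite subn0 in yb.
  have z0 a : zexp x a = 0%N by have [_ _] := h a; rewrite subn0.
  split; last by case: asboolP => // -[a]; rewrite z0.
  split=> // -[[a []]|y|[_ [a]]|[c]]; rewrite ?z0 ?tx //.
  by have := y b; rewrite yb.
apply: G_ext (G_linear pred0) => x; split.
  move=> [_ hyz v tx [a za]]; split; last by case: asboolP => // -[]; exists a.
  split=> // -[[b [yb zb]]|y|[]|[c]]; rewrite ?v ?tx //.
    by case: (hyz b) => e; [rewrite e in yb | rewrite e in zb].
  by have := y a; case: (hyz a) => e; [rewrite e | rewrite e in za].
move=> [[tx nJ]]; case: asboolP => // z _; split=> //.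
  move=> a; have [|ya] := posnP (yexp x a); first by left.
  have [|za] := posnP (zexp x a); first by right.
  by case: nJ; constructor 1; exists a.
by have [//|v] := posnP (vexp x); case: nJ; constructor 3.
Qed.

(** Outside the square at most one [t_c] occurs, and only once; its cofactor then ranges over the
    complement of the ideal itself. *)
Lemma G_notJ2 : G (fun x => ~ inJ2 x).
Proof.
have uniq_t x c c' : ~ inJ2 x -> (0 < texp x c)%N -> (0 < texp x c')%N -> c = c'.
  move=> nJ2 tc tc'; apply/eqP; apply: contraT => cc'; case: nJ2.
  apply: (@inJ2_intro _ (eT c)).
  - by split=> // d /=; case: eqP => // ->.
  - by constructor 4; exists c; rewrite /= eqxx.
  - by constructor 4; exists c'; rewrite /= eq_sym (negPf cc') subn0.
apply: (G_rank (f := fun x => if [pick c | 0 < texp x c]%N is Some c then (enum_rank c).+1 else 0%N)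
   (r := #|T|.+1)).
- by move=> x _; case: pickP => [c _|]; rewrite ltnS.
- move=> x x' _ nJ' [_ _ _ ht]; case: pickP => [c tc|//]; case: pickP => [c' tc'|n].
    by rewrite (uniq_t x' c c') // (leq_trans tc).
  by have := n c; rewrite (leq_trans tc (ht c)).
move=> [|i] ip.
  apply: G_ext G_t0 => x; split.
    move=> [tx nsq]; split; first by move=> /(inJ2_sqJ tx).
    by case: pickP => // c; rewrite tx.
  move=> [nJ]; case: pickP => // n _; split; last by move=> /sqJ_inJ2.
  by move=> c; have := n c; case: (texp x c).
pose c := enum_val (Ordinal (ip : (i < #|T|)%N)).
apply: (G_shift (u := eT c) _ G_notJ) => x; split.
  move=> [nJ]; case: pickP => // c' tc' [ec].
  have {}ec : c' = c by rewrite /c -[LHS]enum_rankK; congr enum_val; apply: val_inj.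
  rewrite {c'}ec in tc'.
  have le : ele (eT c) x by split=> // d /=; case: eqP => // ->.
  have Jc : inJ (eT c) by constructor 4; exists c; rewrite /= eqxx.
  have nJ' : ~ inJ (esub x (eT c)) by move=> J; apply: nJ; exists (eT c).
  split=> //; split=> // d; apply/eqP; rewrite -leqn0 leqNgt; apply/negP => td.
  by apply: nJ'; constructor 4; exists d.
move=> [[_ _ _ /= ht] [tx nJ]].
have tc : (0 < texp x c)%N by have := ht c; rewrite eqxx.
have tE d : texp x d = (d == c) by have := tx d; have := ht d; rewrite /=; lia.
split; last first.
  case: pickP => [c'|n]; last by have := n c; rewrite tc.
  by rewrite tE; case: eqP => // -> _; rewrite /c enum_valK.
move=> [x1 [[hy hz hv h1] J1 J2]].
(* [t_c] occurs once, so only one of the two factors contains it. The other one lies in the ideal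
   and divides the cofactor of [t_c]. *)
have [t1|t1] := posnP (texp x1 c).
  apply: nJ; apply: inJ_le J1; split=> [a|a||d] /=; rewrite ?subn0 //.
  case: (eqVneq d c) => [->|dc]; first by rewrite t1.
  by rewrite subn0.
apply: nJ; apply: inJ_le J2; split=> [a|a||d] /=; rewrite ?subn0 ?leq_subr //.
rewrite tE; case: (eqVneq d c) => [->|//].
by rewrite leq_sub2l.
Qed.

End Shelling.

End Cells.

(** * The Cohen-Macaulay property of the square *)

Section Labelled.
Variables (k : fieldType) (n p : nat) (T : finType).
Local Notation S := {mpoly k[n]}.
Local Notation letter := (('I_p + 'I_p) + option T)%type.
Variable lab : 'I_n -> letter.
Hypothesis lab_surj : forall l, exists w, lab w = l.
Hypothesis p_gt0 : (0 < p)%N.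

(** The largest power of the product of the variables labelled [l] that divides [m]. The default
    [mdeg m] bounds every exponent, so it does not affect a minimum over a nonempty class. *)
Definition lpow (m : 'X_{1..n}) (l : letter) : nat :=
  \big[minn/mdeg m]_(w | lab w == l) m w.

Lemma leq_lpow e m l : (e <= lpow m l)%N <-> forall w, lab w = l -> (e <= m w)%N.
Proof.
rewrite /lpow; split=> [h w wl|h].
  apply: leq_trans h _; move: (mem_index_enum w).
  elim: (index_enum _) => // x s IH; rewrite big_cons inE => /orP[/eqP<-|/IH {}IH].
    by rewrite wl eqxx geq_minl.
  by case: ifP => // _; apply: leq_trans (geq_minr _ _) IH.
elim/big_rec: _ => [|w x /eqP wl exponents]; last by rewrite leq_min h.
have [w wl] := lab_surj l; apply: leq_trans (h w wl) _.
by rewrite mdegE (bigD1 w) //= leq_addr.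
Qed.

Lemma lpow_eq0 m l : lpow m l = 0%N <-> exists2 w, lab w = l & m w = 0%N.
Proof.
split=> [e|[w wl mw]]; last first.
  have /leq_lpow/(_ w wl) := leqnn (lpow m l).
  by rewrite mw leqn0 => /eqP.
apply: contrapT => n'; have : (0 < lpow m l)%N; last by rewrite e.
by apply/leq_lpow => w wl; rewrite lt0n; apply/eqP => mw; apply: n'; exists w.
Qed.

Lemma leq_eqn x y : (forall e, (e <= x)%N <-> (e <= y)%N) -> x = y.
Proof. by move=> h; apply/anti_leq/andP; split; [apply/h | apply/(h y)]. Qed.

Definition exponents (m : 'X_{1..n}) : expo p T :=
  Expo (fun a => lpow m (inl (inl a))) (fun a => lpow m (inl (inr a)))
    (lpow m (inr None)) (fun c => lpow m (inr (Some c))).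

Definition at_letter (u : expo p T) (l : letter) : nat :=
  match l with
  | inl (inl a) => yexp u a | inl (inr a) => zexp u a
  | inr None => vexp u | inr (Some c) => texp u c
  end.

Definition mono_of (u : expo p T) : 'X_{1..n} := [multinom at_letter u (lab w) | w < n].

Lemma eleP (u x : expo p T) : ele u x <-> forall l, (at_letter u l <= at_letter x l)%N.
Proof.
split=> [[hy hz hv ht] [[a|a]|[c|]] //=|h].
split=> [a|a||c]; [exact: (h (inl (inl a))) | exact: (h (inl (inr a))) |
  exact: (h (inr None)) | exact: (h (inr (Some c)))].
Qed.

Lemma at_ex m l : at_letter (exponents m) l = lpow m l.
Proof. by case: l => [[a|a]|[c|]]. Qed.

Lemma at_esub x u l : at_letter (esub x u) l = (at_letter x l - at_letter u l)%N.
Proof. by case: l => [[a|a]|[c|]]. Qed.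

Lemma expo_ext (x u : expo p T) : (forall l, at_letter x l = at_letter u l) -> x = u.
Proof.
case: x u => [y z v t] [y' z' v' t'] h; congr Expo.
- by apply/funext => a; exact: (h (inl (inl a))).
- by apply/funext => a; exact: (h (inl (inr a))).
- exact: (h (inr None)).
- by apply/funext => c; exact: (h (inr (Some c))).
Qed.

(** A Galois connection: divisibility by a monomial in the grouped products depends on the grouped
    exponents only. *)
Lemma mono_ofP u m : (mono_of u <= m)%MM <-> ele u (exponents m).
Proof.
rewrite eleP; split=> [/mnm_lepP h l|h].
  by rewrite at_ex; apply/leq_lpow => w <-; have := h w; rewrite mnmE.
apply/mnm_lepP => w; rewrite mnmE.
by have := h (lab w); rewrite at_ex => /leq_lpow; apply.
Qed.

(** Dividing by [mono_of u] lowers all exponents of a label by the same amount, hence also their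
    minimum. *)
Lemma ex_sub u m : (mono_of u <= m)%MM -> exponents (m - mono_of u)%MM = esub (exponents m) u.
Proof.
move=> /mnm_lepP um; apply: expo_ext => l; rewrite at_esub !at_ex.
apply: leq_eqn => e; rewrite leq_lpow.
have ul w : lab w = l -> (at_letter u l <= m w)%N by move=> <-; have := um w; rewrite mnmE.
have [w0 wl0] := lab_surj l.
split=> [h|].
  rewrite -(leq_add2r (at_letter u l)) subnK; last by apply/leq_lpow.
  apply/leq_lpow => w wl; have := h w wl; rewrite mnmBE mnmE wl; have := ul w wl; lia.
case: e => [//|e] h w wl; rewrite mnmBE mnmE wl.
have : (e.+1 + at_letter u l <= lpow m l)%N by lia.
move=> /leq_lpow/(_ w wl); lia.
Qed.

Lemma ex_mono_of u : exponents (mono_of u) = u.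
Proof.
apply: expo_ext => l; rewrite at_ex; apply: leq_eqn => e; rewrite leq_lpow.
have [w0 wl0] := lab_surj l.
split=> [/(_ w0 wl0)|h w wl]; first by rewrite mnmE wl0.
by rewrite mnmE wl.
Qed.

Lemma ele_ex m m' : (m <= m')%MM -> ele (exponents m) (exponents m').
Proof.
move=> /mnm_lepP h; apply/eleP => l; rewrite !at_ex; apply/leq_lpow => w wl.
by apply: leq_trans (h w); have /leq_lpow := leqnn (lpow m l); apply.
Qed.

(** Minima are only superadditive, since those of [m] and [m'] may be attained at different
    variables; the inequality is enough because [inJ] is closed upwards. *)
Lemma ele_esub_ex m m' : ele (exponents m') (esub (exponents (m + m')%MM) (exponents m)).
Proof.
apply/eleP => l; rewrite at_esub !at_ex.
have : (lpow m l + lpow m' l <= lpow (m + m')%MM l)%N; last by lia.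
apply/leq_lpow => w wl; rewrite mnmDE leq_add //.
  by have /leq_lpow := leqnn (lpow m l); apply.
by have /leq_lpow := leqnn (lpow m' l); apply.
Qed.

Lemma inJ2_le (x x' : expo p T) : ele x x' -> inJ2 x -> inJ2 x'.
Proof.
move=> /eleP xx' [x1 [/eleP x1x J1 J2]]; exists x1; split=> //.
  by apply/eleP => l; apply: leq_trans (x1x l) (xx' l).
apply: inJ_le J2; apply/eleP => l; rewrite !at_esub.
by have := x1x l; have := xx' l; lia.
Qed.

Lemma upset_inJ2 : upset (fun m => inJ2 (exponents m)).
Proof. by move=> m m'; apply/inJ2_le/ele_ex/lem_addr. Qed.

Local Notation index := ('I_p + option T)%type.

(** Each member is the set of variables of one generator: [inr None] stands for [v], and [o] selects
    [y_a], [z_a] or [y_a z_a]. *)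
Definition familyV (o : 'I_p -> option bool) (i : index) : {set 'I_n} :=
  [set w | match lab w, i with
    | inl (inl a), inl a' => (a == a') && (o a != Some false)
    | inl (inr a), inl a' => (a == a') && (o a != Some true)
    | inr c, inr c' => c == c'
    | _, _ => false
    end].

(** The index type is that of [familyV], so both complete intersections have the same height;
    [inr None] now stands for [\prod_a y_a], and [v] belongs to no member. *)
Definition familyY (i : index) : {set 'I_n} :=
  [set w | match lab w, i with
    | inl (inl a), inr None => true
    | inl (inr a), inl a' => a == a'
    | inr (Some c), inr (Some c') => c == c'
    | _, _ => false
    end].

Lemma familyV_neq0 o i : familyV o i != finset.set0.
Proof.
apply/set0Pn; case: i => [a|c].
  case ea: (o a) => [[]|].
  - by have [w wl] := lab_surj (inl (inl a)); exists w; rewrite inE wl eqxx ea.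
  - by have [w wl] := lab_surj (inl (inr a)); exists w; rewrite inE wl eqxx ea.
  - by have [w wl] := lab_surj (inl (inl a)); exists w; rewrite inE wl eqxx ea.
by have [w wl] := lab_surj (inr c); exists w; rewrite inE wl eqxx.
Qed.

Lemma familyY_neq0 i : familyY i != finset.set0.
Proof.
apply/set0Pn; case: i => [a|[c|]].
- by have [w wl] := lab_surj (inl (inr a)); exists w; rewrite inE wl.
- by have [w wl] := lab_surj (inr (Some c)); exists w; rewrite inE wl.
- by have [w wl] := lab_surj (inl (inl (Ordinal p_gt0))); exists w; rewrite inE wl.
Qed.

Lemma familyV_disjoint o i i' : i != i' -> [disjoint familyV o i & familyV o i'].
Proof.
move=> ii'; rewrite disjoint_subset; apply/fintype.subsetP => w; rewrite !inE.
case: (lab w) => [[a|a]|c]; case: i ii' => [b|b] ii' //; case: i' ii' => [b'|b'] ii' //.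
- by move=> /andP[/eqP-> _]; case: eqP => // e; rewrite e eqxx in ii'.
- by move=> /andP[/eqP-> _]; case: eqP => // e; rewrite e eqxx in ii'.
- by move=> /eqP->; case: eqP => // e; rewrite e eqxx in ii'.
Qed.

Lemma familyY_disjoint i i' : i != i' -> [disjoint familyY i & familyY i'].
Proof.
move=> ii'; rewrite disjoint_subset; apply/fintype.subsetP => w; rewrite !inE.
case: (lab w) => [[a|a]|[c|]]; case: i ii' => [b|[b|]] ii' //; case: i' ii' => [b'|[b'|]] ii' //.
- by move=> /eqP->; case: eqP => // e; rewrite e eqxx in ii'.
- by move=> /eqP->; case: eqP => // e; rewrite e eqxx in ii'.
Qed.

Lemma familyVP o m :
  [/\ forall a, cond (o a) (yexp (exponents m) a) (zexp (exponents m) a),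
      vexp (exponents m) = 0%N & no_t (exponents m)]
  <-> forall i, exists2 w, w \in familyV o i & m w = 0%N.
Proof.
split=> [[h v t] [a|[c|]]|h].
- have := h a; case ea: (o a) => [[]|] /=.
  + by move=> /lpow_eq0[w wl mw]; exists w; rewrite // inE wl eqxx ea.
  + by move=> /lpow_eq0[w wl mw]; exists w; rewrite // inE wl eqxx ea.
  + by case=> /lpow_eq0[w wl mw]; exists w; rewrite // inE wl eqxx ea.
- by have /lpow_eq0[w wl mw] := t c; exists w; rewrite // inE wl.
- by have /lpow_eq0[w wl mw] := v; exists w; rewrite // inE wl.
split=> [a||c].
- have [w] := h (inl a); rewrite inE; case wl: (lab w) => [[b|b]|//] /andP[/eqP eb ob] mw;
    subst b.
    have y0 : yexp (exponents m) a = 0%N by apply/lpow_eq0; exists w.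
    by case: (o a) ob => [[]|] //=; left.
  have z0 : zexp (exponents m) a = 0%N by apply/lpow_eq0; exists w.
  by case: (o a) ob => [[]|] //=; right.
- have [w] := h (inr None); rewrite inE; case wl: (lab w) => [[b|b]|c] // /eqP ec mw; subst c.
  by apply/lpow_eq0; exists w.
- have [w] := h (inr (Some c)); rewrite inE; case wl: (lab w) => [[b|b]|c'] // /eqP ec mw; subst c'.
  by apply/lpow_eq0; exists w.
Qed.

Lemma familyYP m :
  [/\ forall a, zexp (exponents m) a = 0%N, exists a, yexp (exponents m) a = 0%N
    & no_t (exponents m)]
  <-> forall i, exists2 w, w \in familyY i & m w = 0%N.
Proof.
split=> [[h [a0 y0] t] [a|[c|]]|h].
- by have /lpow_eq0[w wl mw] := h a; exists w; rewrite // inE wl.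
- by have /lpow_eq0[w wl mw] := t c; exists w; rewrite // inE wl.
- by have /lpow_eq0[w wl mw] := y0; exists w; rewrite // inE wl.
split=> [a||c].
- have [w] := h (inl a); rewrite inE; case wl: (lab w) => [[b|b]|[c|]] // /eqP eb mw; subst b.
  by apply/lpow_eq0; exists w.
- have [w] := h (inr None); rewrite inE; case wl: (lab w) => [[b|b]|[c|]] // _ mw.
  by exists b; apply/lpow_eq0; exists w.
- have [w] := h (inr (Some c)); rewrite inE; case wl: (lab w) => [[b|b]|[c'|]] // /eqP ec mw; subst c'.
  by apply/lpow_eq0; exists w.
Qed.

Section Regular.
Variable h : 'I_n -> {poly k}.
Hypothesis h_neq0 : forall w, h w != 0.
Hypothesis Xh : forall w, 'X %| h w.

Lemma good_notJ2 : good (esym_seq h (n - #|{: index}|)) (fun m => ~ inJ2 (exponents m)).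
Proof.
set sq := esym_seq _ _.
apply: (@G_notJ2 p T (fun D => good sq (fun m => D (exponents m)))) => //.
- by move=> D D' e; apply: good_ext => m; exact: e.
- move=> D f r fr fm gf; apply: (@good_rank _ _ _ _ (fun m => f (exponents m)) r) => [m|m a|i].
  + exact: fr.
  + by move=> Dm Dma; apply: fm => //; apply/ele_ex/lem_addr.
  + exact: gf.
- move=> u D D' e; apply: (@good_shift _ _ _ (mono_of u)) => m; rewrite e.
  split=> [[/mono_ofP um]|[um]]; first by rewrite ex_sub.
  by rewrite ex_sub //; split=> //; apply/mono_ofP.
- move=> o; apply: (@good_hits _ _ h h_neq0 Xh _ (familyV o)).
  + exact: familyV_neq0.
  + exact: familyV_disjoint.
  + exact: familyVP.
- apply: (@good_hits _ _ h h_neq0 Xh _ familyY).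
  + exact: familyY_neq0.
  + exact: familyY_disjoint.
  + exact: familyYP.
Qed.

End Regular.

Variable I : ideal S.
Hypothesis I_mono : I = mono_ideal (fun m => inJ (exponents m)) :> set S.

Lemma pow2_mono : ideal_pow I 2 = mono_ideal (fun m => inJ2 (exponents m)) :> set S.
Proof.
apply/seteqP; split.
  apply: ideal_gen_min; first exact/mono_ideal_closed/upset_inJ2.
  move=> _ [f fI ->] m; rewrite big_ord_recl big_ord1.
  have fI' l : mono_ideal (fun m => inJ (exponents m)) (f l) by rewrite -I_mono; apply: fI.
  move=> /msuppM_le/allpairsP[[a b] /= [/fI' Ja /fI' Jb ->]].
  exists (exponents a); split=> //; first exact/ele_ex/lem_addr.
  exact: inJ_le (ele_esub_ex _ _) Jb.
apply: mono_ideal_ind; first exact: idealP.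
move=> m [x1 [/mono_ofP x1m J1 J2]]; apply: ideal_gen_sub.
have II m' : inJ (exponents m') -> I 'X_[m'].
  by move=> J; have : (I : set S) 'X_[m'] by rewrite I_mono; apply/mono_idealX.
exists (fun l : 'I_2 => if l == ord0 then 'X_[mono_of x1] else 'X_[m - mono_of x1]).
  move=> l; case: eqP => _; apply: II; first by rewrite ex_mono_of.
  by rewrite ex_sub.
by rewrite big_ord_recl big_ord1 /= -mpolyXD addmC submK.
Qed.

(** A squarefree monomial outside the ideal omits a variable from every member of a disjoint family:
    of [familyV] if [v] does not divide it, of [familyY] if it does. *)
Lemma not_inJ_card (A : {set 'I_n}) : ~ inJ (exponents [multinom (w \in A : nat) | w < n]) ->
  (#|A| <= n - #|{: index}|)%N.
Proof.
set m := [multinom _ | w < n] => nJ.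
suff [C [Cd hC]] : exists C : index -> {set 'I_n},
    (forall i i', i != i' -> [disjoint C i & C i']) /\
    forall i, exists2 w, w \in C i & m w = 0%N.
  have /choice[c Hc] : forall i, exists w, w \in C i /\ m w = 0%N.
    by move=> i; have [w wC mw] := hC i; exists w.
  have c_inj : injective c.
    move=> i i' e; apply/eqP; apply: contraT => /Cd/disjointFr/(_ (proj1 (Hc i))).
    by rewrite e (proj1 (Hc i')).
  have sub : c @: finset.setT \subset ~: A.
    apply/fintype.subsetP => _ /imsetP[i _ ->]; have [_] := Hc i.
    by rewrite mnmE inE; case: (_ \in A).
  have := subset_leq_card sub; rewrite card_imset // cardsT => le.
  have e := cardsC A; rewrite card_ord in e.
  by rewrite -[X in (_ <= X - _)%N]e -addnBA ?leq_addr.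
have tx : no_t (exponents m).
  by move=> c; have [//|tc] := posnP (texp (exponents m) c); case: nJ; constructor 4; exists c.
have [a0 y0] : exists a, yexp (exponents m) a = 0%N.
  by apply: no_y => y; apply: nJ; constructor 2.
have [v|v] := posnP (vexp (exponents m)).
  exists (familyV (fun=> None)); split; first exact: familyV_disjoint.
  apply/familyVP; split=> // a /=.
  have [|ya] := posnP (lpow m (inl (inl a))); first by left.
  have [|za] := posnP (lpow m (inl (inr a))); first by right.
  by case: nJ; constructor 1; exists a.
exists familyY; split; first exact: familyY_disjoint.
apply/familyYP; split=> //; last by exists a0.
by apply: no_z => z; apply: nJ; constructor 3.
Qed.

Theorem cohen_macaulay_pow2 : cohen_macaulay (qring (ideal_pow I 2)).
Proof.
set J := ideal_pow I 2; set d := (n - #|{: index}|)%N.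
split; first exact/qring_noetherian/mpoly_noetherian.
move=> M maxM; have pM := maximal_prime maxM.
set M' := qpreim M.
have [M'1 _] : prime_ideal M' by apply: qpreim_prime.
have M'u x : ~ M' x -> exists y, M' (x * y - 1).
  move=> /(maximal_unit maxM)[y My]; have [z ez] := qproj_surj y.
  by exists z; rewrite /= rmorphB rmorphM rmorph1 /= ez.
have /choice[h0 H0] : forall i : 'I_n, exists h : {poly k}, h != 0 /\ M' (uni i h).
  by move=> i; have [h h0 Mh] := zariski_ideal i M'1 M'u; exists h.
(* The factor ['X] puts [uni i (h i)] into every ideal generated by variables that contains ['X_i],
   and keeps it in [M']. *)
pose h i := 'X * h0 i.
have h_neq0 i : h i != 0 by rewrite mulf_neq0 ?polyX_eq0 //; have [] := H0 i.
have Xh i : 'X %| h i by apply: dvdp_mulr.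
have Mh i : M' (uni i (h i)).
  by rewrite uniM; apply: (iclM (idealP M')); have [] := H0 i.
pose sq := esym_seq h d.
have sqM x : x \in map (qproj J) sq -> M x.
  by move=> /mapP[f fsq ->]; exact: (@esym_seq_mem _ _ h M' d f Mh fsq).
have wr : wreg sq J setT.
  rewrite pow2_mono -(mono_idealT k n); apply: (good_notJ2 h_neq0 Xh) => //.
    exact: upset_inJ2.
  by move=> m; split=> [|[]].
have reg : regular_sequence (map (qproj J) sq).
  split=> [l|].
    by rewrite size_map; apply: wreg_qring.
  move=> /(ideal_gen_min (idealP M)) M1; have [+ _] := pM; apply; apply: M1.
  by move=> x; exact: sqM.
have size_sq : size (map (qproj J) sq) = d by rewrite size_map size_esym_seq.
have chain_regular m : regular_sequence_in M m -> prime_chain M m.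
  move=> [s [<- [rs _] sM]]; exact: prime_chain_weak_regular.
have bound m : prime_chain M m -> (m <= d)%N.
  move=> [c [pc sc _]]; rewrite leqNgt; apply/negP => dm.
  pose P l := qpreim (c l).
  have pP l : (l <= d.+1)%N -> prime_ideal (P l).
    by move=> ld; apply/qpreim_prime/pc/(leq_trans ld).
  have sP l : (l < d.+1)%N -> (P l `<` P l.+1)%classic.
    by move=> ld; apply/qpreim_proper/sc/(leq_trans ld).
  (* The variables outside the smallest prime of the chain: their product is outside it, and so is
     the square of the product. Hence the product is not in the ideal [I], which bounds their number
     by [d]. *)
  pose A := [set i : 'I_n | ~~ `[< P 0%N 'X_i >]].
  apply: (@prime_chain_bound k n d A P _ pP sP) => [|i]; last first.
    by rewrite inE negbK => /asboolP.
  apply: not_inJ_card => Jm; have [P1 pr] := pP 0%N isT.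
  set m0 := [multinom _ | w < n] in Jm.
  have : P 0%N ('X_[m0] * 'X_[m0]).
    apply: qpreim_ideal; have : (J : set S) ('X_[m0] * 'X_[m0]).
      rewrite pow2_mono -mpolyXD; apply/mono_idealX; exists (exponents m0); split=> //.
        exact/ele_ex/lem_addr.
      exact: inJ_le (ele_esub_ex _ _) Jm.
    by [].
  have {pr} prX : ~ P 0%N 'X_[m0].
    rewrite mpolyXE_id; elim/big_rec: _ => [//|i x _ nx /pr[|//]].
    rewrite mnmE inE; case: asboolP => [_|ni]; first by rewrite expr0.
    by rewrite expr1.
  by have [_ pr] := pP 0%N isT; move=> /pr[].
have regM : regular_sequence_in M d by exists (map (qproj J) sq).
exists d; split; split.
- exact: chain_regular.
- exact: bound.
- exact: regM.
- by move=> m /chain_regular/bound.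
Qed.

End Labelled.

(** * The stellar subdivision *)

Section StanleyReisnerMonomials.
Variables (k : fieldType) (W : finType).

Definition mset (H : {set W}) : 'X_{1..#|W|} := [multinom (enum_val w \in H : nat) | w < #|W|].

Definition msupport (m : 'X_{1..#|W|}) : {set W} := [set w | (0 < m (enum_rank w))%N].

Lemma mset_le (H : {set W}) m : (mset H <= m)%MM = (H \subset msupport m).
Proof.
apply/mnm_lepP/fintype.subsetP => [h w wH|h w].
  by have := h (enum_rank w); rewrite mnmE enum_rankK wH inE.
rewrite mnmE; case: (boolP (enum_val w \in H)) => // /h.
by rewrite inE enum_valK.
Qed.

Lemma msupport_mset (H : {set W}) : msupport (mset H) = H.
Proof. by apply/setP => w; rewrite inE mnmE enum_rankK lt0b. Qed.

Lemma prod_vertex_var (H : {set W}) : \prod_(w in H) vertex_var k w = 'X_[mset H].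
Proof.
rewrite /vertex_var mprodXE; congr 'X_[_]; apply/mnmP => w.
rewrite mnm_sumE mnmE; under eq_bigr do rewrite mnm1E.
case: (boolP (enum_val w \in H)) => wH.
  rewrite (bigD1 (enum_val w)) //= enum_valK eqxx big1 // => w' /andP[_ ww'].
  by apply/eqP; rewrite eqb0; apply: contraNneq ww' => <-; rewrite enum_rankK.
rewrite big1 // => w' w'H; apply/eqP; rewrite eqb0.
by apply: contraNneq wH => <-; rewrite enum_rankK.
Qed.

Lemma SR_idealE (D : {set {set W}}) : SR_ideal k D =
  mono_ideal (fun m => exists2 H : {set W}, H \notin D & H \subset msupport m) :> set _.
Proof.
pose Gen m := exists2 H : {set W}, H \notin D & m = mset H.
transitivity (ideal_gen [set g : {mpoly k[#|W|]} | exists2 m, Gen m & g = 'X_[m]]%classic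
    : set _).
  congr (ideal_set (ideal_gen _)); apply/seteqP; split=> f.
    by move=> [H HD ->]; exists (mset H); [exists H | rewrite prod_vertex_var].
  by move=> [_ [H HD ->] ->]; exists H; rewrite ?prod_vertex_var.
rewrite ideal_gen_mono; congr mono_ideal; apply/funext => m; apply/propext; split.
  by move=> [_ [H HD ->]]; rewrite mset_le => Hm; exists H.
by move=> [H HD Hm]; exists (mset H); [exists H | rewrite mset_le].
Qed.

End StanleyReisnerMonomials.

Section Subdivision.
Variables (k : fieldType) (mu : nat) (i : 'I_mu -> nat).
Local Notation V := {a : 'I_mu & 'I_(i a)}.
Variables (Gamma : {set {set V}}) (p : nat) (j : 'I_p -> nat).
Hypothesis hi : forall a, (2 <= i a)%N.
Hypothesis hGamma : simplicial_complex Gamma.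
Hypothesis hI : SR_ideal k Gamma =
  ideal_gen [set g | exists a : 'I_mu,
    g = \prod_(b < i a) vertex_var k (Tagged (fun a => 'I_(i a)) b)]%classic :> set _.
Hypothesis hp : (p <= mu)%N.
Hypothesis hj : forall a : 'I_p, (1 <= j a < i (widen_ord hp a))%N.

Definition block (a : 'I_mu) : {set V} := [set w | tag w == a].

Lemma prod_block a : \prod_(b < i a) vertex_var k (Tagged (fun a => 'I_(i a)) b) =
  'X_[mset (block a)].
Proof.
have := sig_big_dep (idx := 1) (op := *%R) (fun a' => a' == a) (fun _ _ => true)
  (fun a' (b : 'I_(i a')) => vertex_var k (Tagged (fun a => 'I_(i a)) b)).
rewrite big_pred1_eq => ->; rewrite -prod_vertex_var.
by apply: eq_big => [w|[a' b] _ //]; rewrite inE andbT.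
Qed.

(** The ideal determines the complex: a squarefree monomial lies in it exactly when its support
    contains a nonface, hence is one. Both descriptions of the ideal are compared on such
    monomials. *)
Lemma GammaP (H : {set V}) : reflect (exists a, block a \subset H) (H \notin Gamma).
Proof.
have [_ closed _] := hGamma.
have E : mono_ideal (fun m => exists2 H : {set V}, H \notin Gamma & H \subset msupport m) =
    mono_ideal (fun m => exists2 m', (exists a, m' = mset (block a)) & (m' <= m)%MM) :> set {mpoly k[_]}.
  rewrite -SR_idealE hI -ideal_gen_mono; congr (ideal_set (ideal_gen _)).
  apply/seteqP; split=> f.
    by move=> [a ->]; exists (mset (block a)); [exists a | rewrite prod_block].
  by move=> [_ [a ->] ->]; exists a; rewrite prod_block.
have EX (A : {set V}) : (exists2 H : {set V}, H \notin Gamma & H \subset A) <->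
    exists a, block a \subset A.
  have := congr1 (fun I : set {mpoly k[_]} => I 'X_[mset A]) E => /= e.
  split=> [h|[a aA]].
    have : mono_ideal (k := k) (fun m => exists2 H : {set V}, H \notin Gamma & H \subset msupport m) 'X_[mset A].
      by apply/mono_idealX; rewrite msupport_mset.
    rewrite e => /mono_idealX[_ [a ->]]; rewrite mset_le msupport_mset => aA.
    by exists a.
  have : mono_ideal (k := k) (fun m => exists2 m', (exists a, m' = mset (block a)) & (m' <= m)%MM) 'X_[mset A].
    apply/mono_idealX; exists (mset (block a)); first by exists a.
    by rewrite mset_le msupport_mset.
  by rewrite -e => /mono_idealX; rewrite msupport_mset.
apply: (iffP idP) => [HG|aH]; first by apply/EX; exists H.
have [H' H'G H'H] : exists2 H' : {set V}, H' \notin Gamma & H' \subset H by apply/EX.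
by apply: contra H'G => HG; apply: closed HG H'H.
Qed.

Definition rest := {a : 'I_mu | (p <= a)%N}.

(** The first [insub] succeeds exactly on the [p] blocks that meet the face. On the others the
    second one always succeeds, so an old vertex never receives the label [inr None] of the new
    one. *)
Definition label (x : option V) : (('I_p + 'I_p) + option rest)%type :=
  if x is Some w then
    if insub (tag w : nat) is Some a then
      if (tagged w < j a)%N then inl (inl a) else inl (inr a)
    else inr (insub (tag w))
  else inr None.

Lemma label_lt (w : V) (a : 'I_p) : tag w = widen_ord hp a ->
  label (Some w) = if (tagged w < j a)%N then inl (inl a) else inl (inr a).
Proof.
move=> e; rewrite /label; have -> : insub (tag w : nat) = Some a; last by [].
by rewrite e /= valK.
Qed.

Lemma label_ge (w : V) (c : rest) : tag w = val c -> label (Some w) = inr (Some c).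
Proof.
move=> e; rewrite /label insubN ?e; last by rewrite -leqNgt (valP c).
by rewrite valK.
Qed.

Variant label_spec (w : V) : (('I_p + 'I_p) + option rest)%type -> Prop :=
| LabelY a of tag w = widen_ord hp a & (tagged w < j a)%N : label_spec w (inl (inl a))
| LabelZ a of tag w = widen_ord hp a & ~~ (tagged w < j a)%N : label_spec w (inl (inr a))
| LabelT c of tag w = val c : label_spec w (inr (Some c)).

Lemma labelP w : label_spec w (label (Some w)).
Proof.
have [lt|ge] := ltnP (tag w) p.
  have e : tag w = widen_ord hp (Ordinal lt) by apply: val_inj.
  by rewrite (label_lt e); case: ifPn; constructor.
rewrite (@label_ge w (exist _ (tag w) ge)) //; exact: LabelT.
Qed.

(** Here the bounds on [j] enter: [1 <= j a] provides a vertex of the [y] part and [j a < i a] one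
    of the [z] part. *)
Lemma label_surj l : exists x, label x = l.
Proof.
case: l => [[a|a]|[c|]].
- have /andP[ja ji] := hj a.
  have lt : (0 < i (widen_ord hp a))%N by apply: ltn_trans ji.
  by exists (Some (Tagged (fun a => 'I_(i a)) (Ordinal lt))); rewrite (label_lt (a := a)) //= ja.
- have /andP[ja ji] := hj a.
  by exists (Some (Tagged (fun a => 'I_(i a)) (Ordinal ji))); rewrite (label_lt (a := a)) //= ltnn.
- have lt : (0 < i (val c))%N by apply: ltnW.
  by exists (Some (Tagged (fun a => 'I_(i a)) (Ordinal lt))); apply: label_ge.
- by exists None.
Qed.

Local Notation F := (block_face i hp j).

Lemma mem_block_face w : reflect (exists a, label (Some w) = inl (inl a)) (w \in F).
Proof.
rewrite inE; apply: (iffP existsP) => [[a /andP[/eqP e lt]]|[a]].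
  by exists a; rewrite (label_lt e) lt.
by case: labelP => // a' e lt _; exists a'; apply/andP; split=> //; apply/eqP.
Qed.

Definition covers (H : {set option V}) l := forall x, label x = l -> x \in H.

Definition base (H : {set option V}) : {set V} := [set w | Some w \in H].

Lemma block_lt H (a : 'I_p) : block (widen_ord hp a) \subset base H <->
  covers H (inl (inl a)) /\ covers H (inl (inr a)).
Proof.
split=> [/fintype.subsetP h|[hY hZ]].
  split=> -[w|//]; case: labelP => // a' e lt [ea]; subst a';
    by have := h w; rewrite !inE e eqxx; apply.
apply/fintype.subsetP => w; rewrite !inE => /eqP e.
by have := label_lt e; case: ifP => _ h; [apply: hY | apply: hZ].
Qed.

Lemma block_ge H (c : rest) : block (val c) \subset base H <-> covers H (inr (Some c)).
Proof.
split=> [/fintype.subsetP h [w|//]|h].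
  by case: labelP => // c' e [ec]; subst c'; have := h w; rewrite !inE e eqxx; apply.
by apply/fintype.subsetP => w; rewrite !inE => /eqP e; apply: h; apply: label_ge.
Qed.

Lemma face_sub H : F \subset base H <-> forall a, covers H (inl (inl a)).
Proof.
split=> [/fintype.subsetP h a [w|//] e|h].
  by have := h w (introT (mem_block_face w) (ex_intro _ a e)); rewrite inE.
by apply/fintype.subsetP => w /mem_block_face[a /h]; rewrite inE.
Qed.

Lemma block_cases (P : 'I_mu -> Prop) : (exists a, P a) <->
  (exists a : 'I_p, P (widen_ord hp a)) \/ exists c : rest, P (val c).
Proof.
split=> [[a Pa]|[[a Pa]|[c Pc]]]; [|by exists (widen_ord hp a)|by exists (val c)].
have [lt|ge] := ltnP a p; [left|right].
  by exists (Ordinal lt); have -> : widen_ord hp (Ordinal lt) = a by apply: val_inj.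
by exists (exist _ a ge).
Qed.

Lemma mem_stellar H : H \in stellar_subdivision Gamma F <->
  [/\ base H \in Gamma, ~~ (F \subset base H) & (None \in H -> F :|: base H \in Gamma)].
Proof.
have baseS (H' : {set V}) : base (Some @: H') = H'.
  by apply/setP => w; rewrite inE mem_imset //; exact: Some_inj.
have baseN (H' : {set V}) : base (None |: Some @: H') = H'.
  by apply/setP => w; rewrite !inE mem_imset //; exact: Some_inj.
have nN (H' : {set V}) : None \notin Some @: H' by apply/imsetP => -[].
rewrite inE; split.
  case/orP => /imsetP[H']; rewrite inE.
    by move=> /andP[HG FH] ->; rewrite baseS; split=> //; rewrite (negPf (nN _)).
  by move=> /and3P[HG FH FHG] ->; rewrite baseN; split.
move=> [HG FH FHG]; apply/orP; case: (boolP (None \in H)) => NH; [right|left].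
  apply/imsetP; exists (base H); first by rewrite inE HG FH FHG.
  apply/setP => -[w|]; rewrite !inE /= ?NH //.
  by rewrite mem_imset ?inE //; exact: Some_inj.
apply/imsetP; exists (base H); first by rewrite inE HG FH.
apply/setP => -[w|]; last by rewrite (negPf NH) (negPf (nN _)).
by rewrite mem_imset ?inE //; exact: Some_inj.
Qed.

Lemma nonface_stellar H : H \notin stellar_subdivision Gamma F <->
  [\/ exists a, covers H (inl (inl a)) /\ covers H (inl (inr a)),
     forall a, covers H (inl (inl a)),
     covers H (inr None) /\ exists a, covers H (inl (inr a)) |
     exists c, covers H (inr (Some c))].
Proof.
have notin A : A \notin Gamma -> exists a, block a \subset A by move=> /GammaP.
have coverN : covers H (inr None) <-> None \in H.
  split=> [h|NH [w|//]]; first exact: h.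
  by case: labelP.
split=> [nH|C].
  have [|HG] := boolP (base H \in Gamma); last first.
    move: HG => /notin/block_cases[[a /block_lt h]|[c /block_ge h]].
      by constructor 1; exists a.
    by constructor 4; exists c.
  move=> HG; have [/face_sub h|FH] := boolP (F \subset base H); first by constructor 2.
  have [NH FHG] : None \in H /\ F :|: base H \notin Gamma.
    have [NH|NH] := boolP (None \in H); last first.
      by case/negP: nH; apply/mem_stellar; split=> // NH'; rewrite NH' in NH.
    by split=> //; apply: contra nH => FHG; apply/mem_stellar.
  (* The face supplies the [y] part of block [a], so the [z] part must come from [H]; this is the
     origin of the generator [v z_a]. *)
  move: FHG => /notin/block_cases[[a]|[c]] /fintype.subsetP h.
    constructor 3; split; first exact/coverN.
    exists a => -[w|//]; case: labelP => // a' e nlt [ea]; subst a'.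
    have hw : w \in block (widen_ord hp a) by rewrite inE e.
    case/finset.setUP: (h w hw) => [/mem_block_face[a']|]; last by rewrite inE.
    by rewrite (label_lt e) (negPf nlt).
  constructor 4; exists c => -[w|//]; case: labelP => // c' e [ec]; subst c'.
  have hw : w \in block (val c) by rewrite inE e.
  case/finset.setUP: (h w hw) => [/mem_block_face[a']|]; last by rewrite inE.
  by rewrite (label_ge e).
apply/negP => /mem_stellar[HG FH FHG].
have inG A a : A \in Gamma -> ~ block a \subset A.
  move=> AG aA; have : A \notin Gamma by apply/GammaP; exists a.
  by rewrite AG.
case: C => [[a h]|h|[/coverN NH [a h]]|[c h]].
- by apply: (inG _ _ HG); apply/block_lt; exact: h.
- by case/negP: FH; apply/face_sub.
- apply: (inG _ (widen_ord hp a) (FHG NH)); apply/fintype.subsetP => w.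
  rewrite inE => /eqP e; apply/finset.setUP.
  have := label_lt e; case: ifP => _ e'; [left|right].
    by apply/mem_block_face; exists a.
  by rewrite inE; apply: h.
- by apply: (inG _ _ HG); apply/block_ge; exact: h.
Qed.

Definition vertex_label (w : 'I_#|{: option V}|) := label (enum_val w).

Lemma vertex_label_surj l : exists w, vertex_label w = l.
Proof.
by have [x xl] := label_surj l; exists (enum_rank x); rewrite /vertex_label enum_rankK.
Qed.

Lemma covers_lpow m l : covers (msupport m) l <-> (0 < lpow vertex_label m l)%N.
Proof.
rewrite (leq_lpow vertex_label_surj); split=> [h w wl|h x xl].
  by have := h _ wl; rewrite inE enum_valK.
by rewrite inE; apply: h; rewrite /vertex_label enum_rankK.
Qed.

Lemma SR_stellar : SR_ideal k (stellar_subdivision Gamma F) =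
  mono_ideal (fun m => inJ (exponents vertex_label m)) :> set _.
Proof.
rewrite SR_idealE; congr mono_ideal; apply/funext => m; apply/propext.
have -> : inJ (exponents vertex_label m) <-> msupport m \notin stellar_subdivision Gamma F.
  rewrite nonface_stellar; split=> -[[a [/covers_lpow ya /covers_lpow za]]|y|
    [/covers_lpow v [a /covers_lpow za]]|[c /covers_lpow tc]].
  - by constructor 1; exists a.
  - by constructor 2 => a; apply/covers_lpow; exact: y.
  - by constructor 3; split=> //; exists a.
  - by constructor 4; exists c.
  - by constructor 1; exists a.
  - by constructor 2 => a; apply/covers_lpow; exact: y.
  - by constructor 3; split=> //; exists a.
  - by constructor 4; exists c.
split=> [[H /nonface_stellar HD /fintype.subsetP Hm]|h]; last by exists (msupport m).
have cov l : covers H l -> covers (msupport m) l by move=> h x /h/Hm.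
apply/nonface_stellar; case: HD => [[a [h1 h2]]|h|[h1 [a h2]]|[c h]].
- by constructor 1; exists a; split; exact: cov.
- by constructor 2 => a; exact: cov.
- by constructor 3; split; [exact: cov | exists a; exact: cov].
- by constructor 4; exists c; exact: cov.
Qed.

End Subdivision.

Theorem theorem5p4 (k : fieldType) (mu : nat) (i : 'I_mu -> nat)
    (Gamma : {set {set {a : 'I_mu & 'I_(i a)}}})
    (p : nat) (j : 'I_p -> nat)
    (hmu : (1 <= mu)%N) (hi : forall a, (2 <= i a)%N)
    (hGamma : simplicial_complex Gamma)
    (hI : SR_ideal k Gamma =
      ideal_gen [set g | exists a : 'I_mu,
        g = \prod_(b < i a)
              vertex_var k (Tagged (fun a => 'I_(i a)) b)]%classic
      :> set _)
    (hp1 : (1 <= p)%N) (hp : (p <= mu)%N)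
    (hj : forall a : 'I_p, (1 <= j a < i (widen_ord hp a))%N)
    (hj2 : (2 <= \sum_(a < p) j a)%N) :
  cohen_macaulay
    (qring (ideal_pow
      (SR_ideal k (stellar_subdivision Gamma (block_face i hp j))) 2)).
Proof.
(* [rest mu p] has [mu - p] elements, so the families of generators have [p + (mu - p) + 1 = mu + 1]
   members. *)
apply: (@cohen_macaulay_pow2 k _ p (rest mu p) (vertex_label j)).
- exact: vertex_label_surj.
- exact: hp1.
- exact: SR_stellar.
Qed.
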